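(* Let $f\in\mathcal F$ with associated integer $\rho\ge 1$. Then for every $t\ge 0$, $$\limsup_{r\to\infty}\frac{1}{r^{\rho}}\int_0^t\int_0^r \frac{n(\tau;\nu)}{\nu}\,d\nu\,d\tau\le \frac{\ell_f(t)}{2\pi\rho^2}.$$
   Context: The class $\mathcal F$: $f\in\mathcal F$ if for some integer $\rho\ge 1$ (i) $f$ is holomorphic in the closed lower half-plane $\{-\pi\le\arg z\le 0\}$ and is of order at most $\rho$ and finite type there, i.e. $f(z)=O(e^{C|z|^\rho})$ as $|z|\to\infty$, $\operatorname{Im} z\le 0$, for some constant $C$; and (ii) $\int_0^r \frac{f'(s)}{f(s)}\,ds=O(|r|^{\rho-1})$ as $r\to+\infty$ and as $r\to-\infty$ along the real axis (in particular these integrals are assumed to make sense). For $f\in\mathcal F$ and $t\ge0$, $$\ell_f(t):=\limsup_{\substack{|z|\to\infty\\ \operatorname{Im} z=-t\log|z|,\ \operatorname{Re} z>0}}\frac{\log|f(z)|}{|z|^{\rho-1}\log|z|}.$$ For $0\le t<\infty$, $n(t;r):=\#\{z: f(z)=0,\ \operatorname{Re}z>0,\ 0\ge\operatorname{Im}z\ge -t\log(1+|z|),\ |z|<r\}$, zeros counted with multiplicity. *)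

(* Defs.v *)
From Stdlib Require Import Reals List ClassicalEpsilon.
From Coquelicot Require Import Coquelicot.
Open Scope R_scope.

Definition holomorphic_at (f : C -> C) (z : C) : Prop :=
  locally (T := C_UniformSpace) z
    (fun w => ex_derive (K := C_AbsRing) (V := C_NormedModule) f w).

(* [f] is a total function on [C], but nothing is required of it away from a
   neighbourhood of the closed lower half-plane.

   [F_nonzero] is the requirement that the integrals of f'/f along the real
   axis make sense: f'/f has a simple pole, hence is not integrable, at any
   isolated real zero of f.  It cannot be left to the convention on division by
   zero, under which f'/f would be integrable for f = 0. *)
Record class_F (rho : nat) (f : C -> C) : Prop := {
  F_rho : (1 <= rho)%nat;
  F_holomorphic : forall z : C, Im z <= 0 -> holomorphic_at f z;
  F_growth : exists c K R0 : R, forall z : C,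
    Im z <= 0 -> R0 <= Cmod z -> Cmod (f z) <= K * exp (c * Cmod z ^ rho);
  F_nonzero : forall x : R, f (RtoC x) <> RtoC 0;
  F_logder : exists K R0 : R, forall r : R, R0 <= Rabs r ->
    Cmod (RInt (V := C_R_CompleteNormedModule)
            (fun s : R => Cdiv (C_derive f (RtoC s)) (f (RtoC s))) 0 r)
    <= K * Rabs r ^ (rho - 1)
}.

(* Upper limit of an extended-real function along a filter: the infimum of the
   real numbers that eventually bound it from above. *)
Definition LimSup_filter {T : Type} (F : (T -> Prop) -> Prop) (g : T -> Rbar) :
    Rbar :=
  Glb_Rbar (fun M : R => F (fun x => Rbar_le (g x) (Finite M))).

Definition C_infinity (P : C -> Prop) : Prop :=
  exists M : R, forall z : C, M < Cmod z -> P z.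

(* Logarithm of a nonnegative real, with log 0 = -oo, so that zeros of f on the
   curve do not contribute to the upper limit [ell]. *)
Definition Rbar_ln (x : R) : Rbar :=
  if Rlt_dec 0 x then Finite (ln x) else m_infty.

Definition log_curve (t : R) (z : C) : Prop :=
  Im z = - t * ln (Cmod z) /\ 0 < Re z.

Definition ell (rho : nat) (f : C -> C) (t : R) : Rbar :=
  LimSup_filter (within (log_curve t) C_infinity)
    (fun z => Rbar_div (Rbar_ln (Cmod (f z)))
                       (Finite (Cmod z ^ (rho - 1) * ln (Cmod z)))).

(* [k] is the order of vanishing of [f] at [z] (with [k = 0] iff [f z <> 0]). *)
Definition zero_order (f : C -> C) (z : C) (k : nat) : Prop :=
  exists g : C -> C, holomorphic_at g z /\ g z <> RtoC 0 /\
    locally (T := C_UniformSpace) z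
      (fun w => f w = Cmult (Cpow (Cminus w z) k) (g w)).

(* [l] lists the zeros of [f] in [A], each repeated according to its
   multiplicity. *)
Definition lists_zeros (f : C -> C) (A : C -> Prop) (l : list C) : Prop :=
  forall z : C, (A z -> zero_order f z (count_occ Ceq_dec l z)) /\
                (~ A z -> ~ In z l).

(* Any two lists as above are permutations of each other, so the length is
   well defined.  For the sets used in [n_zeros] such a list exists when
   [class_F rho f]: they are bounded subsets of the closed half-plane, where
   f is holomorphic and not identically zero. *)
Definition zero_count (f : C -> C) (A : C -> Prop) : nat :=
  epsilon (inhabits 0%nat)
    (fun N => exists l : list C, lists_zeros f A l /\ length l = N).

Definition n_zeros (f : C -> C) (t r : R) : nat :=
  zero_count f (fun z => 0 < Re z /\ - t * ln (1 + Cmod z) <= Im z <= 0 /\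
                         Cmod z < r).

(* Main.v *)
(* Let a zero a with Im a >= - t ln |a| have height Im a + t ln |a| above the curve
   Im z = - t ln |z|.  The map W(z) = z + i t Log z straightens this curve: for large |z| it is
   injective, Re W(z) is |z| up to O(1), Im W(z) is the height of z, and the real axis is sent to
   Im W = t ln (Re W).  Integrating f'/f against - (W - B)^2 / 2 along the boundary of the region
   A <= Re W <= B, Im W >= 0, Im z <= 0, with the residue theorem, bounds the sum of
   (B - |a|)_+ times the height of a.  The weight is real on the curve and on the side
   Re W = B, and integrating by parts there leaves only the growth of ln |f|, from above: its
   bound on the curve gives the main term M B^(rho+1) ln B / (2 pi rho (rho+1)), its bound of
   order B^rho on the side Re W = B, a segment of length O(ln B), an error O(B^(rho+1)).  On
   the real axis, the bound on the integral of f'/f gives an error of the same order.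

   For r > 0, the double integral of the counting function is the sum over the zeros |a| < r of
   (t - tau(a))_+ ln (r / |a|), where tau(a) = - Im a / ln (1 + |a|).  Up to O(1 / |a|),
   (t - tau(a)) ln |a| is the height of a, so each height gets multiplied by the kernel
   ln r / ln |a| - 1, a convex function of |a| and hence a superposition of the functions
   (B - |a|)_+.  Integrating the first bound against it yields M r^rho / (2 pi rho^2). *)

Require Import Defs.
From Stdlib Require Import Reals Ranalysis5 Lra Lia List Permutation ClassicalEpsilon.
From Coquelicot Require Import Coquelicot.
From Stdlib Require Import ssreflect.
Open Scope general_if_scope.
Open Scope R_scope.

(** * Complex differentiability *)

(** Nothing bounds |f| from below near the curve, and f may vanish on it. Hence the bottom of the
    contour is raised to a generic small height [dl], and lower bounds of ln |f| are needed only
    where they are at hand: on the fixed left side, and at real points, where ln |f| is, up to a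
    constant, the real part of the integral of f'/f. Apart from the real segment all sides are
    horizontal or vertical in the W-plane, so that Cauchy's theory is needed for rectangles only.
    The logarithms cancel for the following reason: the bound alpha B^(rho+1) ln B has second
    derivative about alpha rho (rho+1) B^(rho-1) ln B, and the denominator of ln r / ln B - 1
    removes this ln B; the integral of (ln r - ln B) B^(rho-1) over 0 < B < r is r^rho / rho^2. The
    errors O(1 / |a|) must be summed over all zeros in question: each, if large, lies at height at
    least 1 above the curve for t + 1, and for that curve the growth of f alone gives a bound
    O(B^(rho+2)), enough against the factor 1 / |a|. For t = 0 the left side is 0, and what has to
    be shown is that ell is not negative. *)

Ltac Cnorm := repeat match goal with x : UniformSpace.sort C_UniformSpace |- _ => change C in (type of x) end;
  match goal with |- @eq _ ?a ?b => change (@eq C a b) | _ => idtac end.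
Ltac Cring := Cnorm; ring.
Ltac Cre := unfold Re, Im in *; simpl in *.
Tactic Notation "Cfield" := Cnorm; field.
Ltac Rring := match goal with |- @eq _ ?a ?b => change (@eq R a b); ring end.

Notation ccont := (continuous (T:=C_UniformSpace) (U:=C_UniformSpace)).
Notation clocally := (locally (T:=C_UniformSpace)).
Notation pcont := (continuous (T:=R_UniformSpace) (U:=C_UniformSpace)).

Lemma continuous_plusR {U : UniformSpace} (f g : U -> R) (x : U) :
  continuous f x -> continuous g x -> continuous (fun y => f y + g y) x.
Proof. exact: (continuous_plus (V:=R_NormedModule)). Qed.

Lemma continuous_oppR {U : UniformSpace} (f : U -> R) (x : U) : continuous f x -> continuous (fun y => - f y) x.
Proof. exact: (continuous_opp (V:=R_NormedModule)). Qed.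

Lemma continuous_minusR {U : UniformSpace} (f g : U -> R) (x : U) :
  continuous f x -> continuous g x -> continuous (fun y => f y - g y) x.
Proof. exact: (continuous_minus (V:=R_NormedModule)). Qed.

Lemma continuous_multR {U : UniformSpace} (f g : U -> R) (x : U) :
  continuous f x -> continuous g x -> continuous (fun y => f y * g y) x.
Proof. exact: (continuous_mult (K:=R_AbsRing)). Qed.

Lemma ex_derive_continuousR (f : R -> R) (x : R) : ex_derive f x -> continuous f x.
Proof. exact: (ex_derive_continuous (K:=R_AbsRing) (V:=R_NormedModule)). Qed.

Lemma ex_RInt_continuousR (f : R -> R) (a b : R) : a <= b -> (forall x, a <= x <= b -> continuous f x) -> ex_RInt f a b.
Proof.
  move=> ab h. apply: (ex_RInt_continuous (V:=R_CompleteNormedModule)) => x. rewrite Rmin_left // Rmax_right //. exact: h.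
Qed.

Lemma C_eta (z : C) : z = (Re z, Im z).
Proof. by case: z. Qed.

Lemma C_ext (z w : C) : Re z = Re w -> Im z = Im w -> z = w.
Proof. rewrite (C_eta z) (C_eta w) /= => -> -> //. Qed.

Lemma Cmod_ReIm (z : C) : Cmod z <= Rabs (Re z) + Rabs (Im z).
Proof.
  rewrite (_ : z = (RtoC (Re z) + Ci * RtoC (Im z))%C); last by apply C_ext => /=; ring.
  apply: (Rle_trans _ _ _ (Cmod_triangle _ _)).
  rewrite Cmod_mult Cmod_Ci !Cmod_R /=. right.
  by rewrite !Rmult_1_l !(Rmult_0_l, Rmult_0_r, Rminus_0_r, Rplus_0_r, Rplus_0_l, Rmult_1_l).
Qed.

Lemma im_le_Cmod (z : C) : Rabs (Im z) <= Cmod z.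
Proof. apply: Rle_trans (Rmax_Cmod z). apply Rmax_r. Qed.

Lemma re_bounds (z : C) : - Cmod z <= Re z <= Cmod z.
Proof. apply/Rabs_le_between; exact: re_le_Cmod. Qed.

Lemma im_bounds (z : C) : - Cmod z <= Im z <= Cmod z.
Proof. apply/Rabs_le_between; exact: im_le_Cmod. Qed.

Lemma continuous_ReIm {U : UniformSpace} (f : U -> C) (x : U) :
  continuous (U:=R_UniformSpace) (fun y => Re (f y)) x ->
  continuous (U:=R_UniformSpace) (fun y => Im (f y)) x ->
  continuous (U:=C_UniformSpace) f x.
Proof.
  move=> h1 h2.
  have h := continuous_comp_2 (fun y => Re (f y)) (fun y => Im (f y)) (fun a b => (a, b) : C_UniformSpace) x h1 h2.
  apply: continuous_ext; last apply: h.
  - by move=> y /=; case: (f y).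
  - apply: continuous_ext; last exact: continuous_id. by move=> [a b].
Qed.

Lemma continuous_Re {U : UniformSpace} (f : U -> C) (x : U) :
  continuous (U:=C_UniformSpace) f x -> continuous (U:=R_UniformSpace) (fun y => Re (f y)) x.
Proof.
  move=> h. apply: (continuous_comp f fst) => //.
  by rewrite (surjective_pairing (f x)); apply: continuous_fst.
Qed.

Lemma continuous_Im {U : UniformSpace} (f : U -> C) (x : U) :
  continuous (U:=C_UniformSpace) f x -> continuous (U:=R_UniformSpace) (fun y => Im (f y)) x.
Proof.
  move=> h. apply: (continuous_comp f snd) => //.
  by rewrite (surjective_pairing (f x)); apply: continuous_snd.
Qed.

Lemma continuous_Cplus {U : UniformSpace} (f g : U -> C) (x : U) :
  continuous (U:=C_UniformSpace) f x -> continuous (U:=C_UniformSpace) g x ->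
  continuous (U:=C_UniformSpace) (fun y => (f y + g y)%C) x.
Proof.
  move=> hf hg. apply: continuous_ReIm.
  - apply: continuous_plusR; by apply continuous_Re.
  - apply: continuous_plusR; by apply continuous_Im.
Qed.

Lemma continuous_Copp {U : UniformSpace} (f : U -> C) (x : U) :
  continuous (U:=C_UniformSpace) f x ->
  continuous (U:=C_UniformSpace) (fun y => (- f y)%C) x.
Proof.
  move=> hf. apply: continuous_ReIm.
  - apply: continuous_oppR; by apply continuous_Re.
  - apply: continuous_oppR; by apply continuous_Im.
Qed.

Lemma continuous_Cmult {U : UniformSpace} (f g : U -> C) (x : U) :
  continuous (U:=C_UniformSpace) f x -> continuous (U:=C_UniformSpace) g x ->
  continuous (U:=C_UniformSpace) (fun y => (f y * g y)%C) x.
Proof.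
  move=> hf hg. apply: continuous_ReIm.
  - apply: continuous_minusR; apply: continuous_multR;
      by (apply continuous_Re || apply continuous_Im).
  - apply: continuous_plusR; apply: continuous_multR;
      by (apply continuous_Re || apply continuous_Im).
Qed.

Lemma Csq_nz (z : C) : z <> RtoC 0 -> Re z ^ 2 + Im z ^ 2 <> 0.
Proof.
  move=> h e. apply: h. apply C_ext => /=; move: e; nra.
Qed.

Lemma continuous_Cinv {U : UniformSpace} (f : U -> C) (x : U) :
  continuous (U:=C_UniformSpace) f x -> f x <> RtoC 0 ->
  continuous (U:=C_UniformSpace) (fun y => (/ f y)%C) x.
Proof.
  move=> hf nz.
  have hR := continuous_Re _ _ hf. have hI := continuous_Im _ _ hf.
  have hd : continuous (U:=R_UniformSpace) (fun y => Re (f y) ^ 2 + Im (f y) ^ 2) x.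
  { apply: continuous_plusR.
    - apply: continuous_multR => //. apply: continuous_multR => //. exact: continuous_const.
    - apply: continuous_multR => //. apply: continuous_multR => //. exact: continuous_const. }
  have hi : continuous (U:=R_UniformSpace) (fun y => / (Re (f y) ^ 2 + Im (f y) ^ 2)) x.
  { apply: (continuous_comp (fun y => Re (f y) ^ 2 + Im (f y) ^ 2) Rinv) => //.
    apply: continuous_Rinv. exact: Csq_nz. }
  apply: continuous_ReIm.
  - apply: continuous_multR => //.
  - apply: continuous_multR => //. exact: continuous_oppR.
Qed.

Lemma continuous_Cmod {U : UniformSpace} (f : U -> C) (x : U) :
  continuous (U:=C_UniformSpace) f x -> continuous (U:=R_UniformSpace) (fun y => Cmod (f y)) x.
Proof.
  move=> hf.
  have hR := continuous_Re _ _ hf. have hI := continuous_Im _ _ hf.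
  apply: (continuous_comp (fun y => Re (f y) ^ 2 + Im (f y) ^ 2) sqrt); last exact: continuous_sqrt.
  apply: continuous_plusR.
    - apply: continuous_multR => //. apply: continuous_multR => //. exact: continuous_const.
    - apply: continuous_multR => //. apply: continuous_multR => //. exact: continuous_const.
Qed.

Lemma locally_Cmod (z : C) (P : C -> Prop) :
  clocally z P <-> exists d, 0 < d /\ forall w, Cmod (w - z) < d -> P w.
Proof.
  split.
  - move=> [d hd]. exists d. split; first by case: d {hd}.
    move=> w hw. apply: hd. apply: C_NormedModule_mixin_compat1. exact: hw.
  - move=> [d [d0 hd]].
    have d20 : 0 < d / 2 by lra.
    exists (mkposreal _ d20) => w [h1 h2]. apply: hd.
    apply: Rle_lt_trans (Cmod_ReIm _) _.
    rewrite /ball /= /AbsRing_ball /abs /minus /plus /opp /= in h1 h2.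
    rewrite /Re /Im /=. rewrite /Rminus in h1 h2 *. lra.
Qed.

Lemma pcont_line (q : C -> C) (p e : C) (s : R) :
  ccont q (p + RtoC s * e)%C -> pcont (fun s => q (p + RtoC s * e)%C) s.
Proof.
  move=> h. apply: (continuous_comp (fun s : R => (p + RtoC s * e)%C) q) => //.
  apply: continuous_Cplus; first exact: continuous_const.
  apply: continuous_Cmult; last exact: continuous_const.
  apply: continuous_ReIm; [exact: continuous_id | exact: continuous_const].
Qed.

(* Caratheodory's derivative: f is differentiable at z iff its slope at z extends
   continuously, which makes the differentiation rules purely algebraic. *)
Definition slope (f : C -> C) (z d w : C) : C :=
  if Ceq_dec w z then d else ((f w - f z) / (w - z))%C.
Definition cder (f : C -> C) (z d : C) : Prop := ccont (slope f z d) z.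
Definition cdiff (f : C -> C) (z : C) : Prop := exists d, cder f z d.

Lemma Cminus_nz (w z : C) : w <> z -> (w - z)%C <> RtoC 0.
Proof. move=> h e. apply: h. by rewrite -(Cplus_0_r z) -e; Cring. Qed.

Lemma slope_eq (f : C -> C) (z d w : C) : f w = (f z + slope f z d w * (w - z))%C.
Proof.
  rewrite /slope; case: Ceq_dec => [->|n]; first by Cring.
  Cfield. exact: Cminus_nz.
Qed.

Lemma slope_at (f : C -> C) (z d : C) : slope f z d z = d.
Proof. by rewrite /slope; case: Ceq_dec. Qed.

Lemma cder_intro (f q : C -> C) (z d : C) : ccont q z -> q z = d ->
  clocally z (fun w => f w = (f z + q w * (w - z))%C) -> cder f z d.
Proof.
  move=> hq <- hl. apply: (continuous_ext_loc _ q) hq.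
  apply: filter_imp hl => w hw. rewrite /slope. case: Ceq_dec => [->|n] //.
  rewrite hw. Cfield. exact: Cminus_nz.
Qed.

Lemma cder_intro' (f q : C -> C) (z d : C) : ccont q z -> q z = d ->
  (forall w, f w = (f z + q w * (w - z))%C) -> cder f z d.
Proof. move=> h1 h2 h3. apply: (cder_intro f q) => //. exact: filter_forall. Qed.

Lemma cder_cont (f : C -> C) (z d : C) : cder f z d -> ccont f z.
Proof.
  move=> h. apply: (continuous_ext (fun w => f z + slope f z d w * (w - z))%C).
  - move=> w. by rewrite -slope_eq.
  - apply: continuous_Cplus; first exact: continuous_const.
    apply: continuous_Cmult => //. apply: continuous_Cplus; first exact: continuous_id. exact: continuous_const.
Qed.

Lemma cdiff_cont (f : C -> C) (z : C) : cdiff f z -> ccont f z.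
Proof. move=> [d]; exact: cder_cont. Qed.

Lemma cder_const (c z : C) : cder (fun _ => c) z 0.
Proof. apply: (cder_intro' _ (fun _ => RtoC 0)) => //; first exact: continuous_const. move=> w; Cring. Qed.

Lemma cder_id (z : C) : cder (fun w => w) z 1.
Proof. apply: (cder_intro' _ (fun _ => RtoC 1)) => //; first exact: continuous_const. move=> w; Cring. Qed.

Lemma cder_plus (f g : C -> C) (z a b : C) : cder f z a -> cder g z b -> cder (fun w => f w + g w)%C z (a + b)%C.
Proof.
  move=> hf hg. apply: (cder_intro' _ (fun w => slope f z a w + slope g z b w)%C).
  - exact: continuous_Cplus.
  - by rewrite !slope_at.
  - move=> w. rewrite (slope_eq f z a w) (slope_eq g z b w). Cring.
Qed.

Lemma cder_mult (f g : C -> C) (z a b : C) : cder f z a -> cder g z b ->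
  cder (fun w => f w * g w)%C z (a * g z + f z * b)%C.
Proof.
  move=> hf hg. apply: (cder_intro' _ (fun w => slope f z a w * g w + f z * slope g z b w)%C).
  - apply: continuous_Cplus; apply: continuous_Cmult => //; [exact: cder_cont hg | exact: continuous_const].
  - by rewrite !slope_at.
  - move=> w. rewrite {1}(slope_eq f z a w). rewrite {1}(slope_eq g z b w).
    have -> : g w = (g z + slope g z b w * (w - z))%C by rewrite -slope_eq. Cring.
Qed.

Lemma locally_nz {U : UniformSpace} (f : U -> C) (x : U) :
  continuous (U:=C_UniformSpace) f x -> f x <> RtoC 0 -> locally x (fun y => f y <> RtoC 0).
Proof.
  move=> hf nz. have h0 := proj1 (Cmod_gt_0 _) nz.
  have hl : locally x (fun y => Rabs (Cmod (f y) - Cmod (f x)) < Cmod (f x)).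
  { apply (continuous_Cmod _ _ hf (fun y => Rabs (y - Cmod (f x)) < Cmod (f x))). by exists (mkposreal _ h0). }
  apply: filter_imp hl => y hy e. move: hy. rewrite e Cmod_0 => hy.
  have := Rle_abs (- (0 - Cmod (f x))). rewrite Rabs_Ropp. lra.
Qed.

Lemma cder_inv (f : C -> C) (z a : C) : cder f z a -> f z <> RtoC 0 -> cder (fun w => / f w)%C z (- a / (f z * f z))%C.
Proof.
  move=> hf nz. apply: (cder_intro _ (fun w => - slope f z a w * (/ f w * / f z))%C).
  - apply: continuous_Cmult; first exact: continuous_Copp.
    apply: continuous_Cmult; last exact: continuous_const.
    apply: continuous_Cinv => //. exact: cder_cont hf.
  - rewrite !slope_at. by Cfield.
  - have hl := locally_nz _ _ (cder_cont _ _ _ hf) nz. apply: filter_imp hl => w nw.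
    have e : (slope f z a w * (w - z))%C = (f w - f z)%C.
    { rewrite {1}(slope_eq f z a w). Cring. }
    rewrite (_ : (- slope f z a w * (/ f w * / f z) * (w - z))%C = (- (slope f z a w * (w - z)) * (/ f w * / f z))%C); last by Cring.
    rewrite e. Cfield. by split.
Qed.

Lemma cder_comp (f g : C -> C) (z a b : C) : cder g z a -> cder f (g z) b -> cder (fun w => f (g w)) z (b * a)%C.
Proof.
  move=> hg hf. apply: (cder_intro' _ (fun w => slope f (g z) b (g w) * slope g z a w)%C).
  - apply: continuous_Cmult => //. apply: (continuous_comp g (slope f (g z) b)) => //. exact: cder_cont hg.
  - by rewrite !slope_at.
  - move=> w. rewrite {1}(slope_eq f (g z) b (g w)).
    rewrite (_ : g w - g z = slope g z a w * (w - z))%C; first Cring.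
    rewrite {1}(slope_eq g z a w). Cring.
Qed.

Lemma cder_ext_loc (f g : C -> C) (z a : C) : clocally z (fun w => f w = g w) -> cder f z a -> cder g z a.
Proof.
  move=> hl hf. apply: (cder_intro _ (slope f z a)) => //; first exact: slope_at.
  have hz := locally_singleton _ _ hl.
  apply: filter_imp hl => w <-. rewrite -hz. exact: slope_eq.
Qed.

Lemma cder_eq (f : C -> C) (z a b : C) : cder f z a -> a = b -> cder f z b.
Proof. by move=> h <-. Qed.

Lemma cder_opp (f : C -> C) (z a : C) : cder f z a -> cder (fun w => - f w)%C z (- a)%C.
Proof.
  move=> hf. apply: (cder_eq _ _ (0 * f z + (-1) * a)%C); last by Cring.
  apply: (cder_ext_loc (fun w => (-1) * f w)%C). { apply: filter_forall => w. Cring. }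
  apply: cder_mult => //. exact: cder_const.
Qed.

Lemma cder_minus (f g : C -> C) (z a b : C) : cder f z a -> cder g z b -> cder (fun w => f w - g w)%C z (a - b)%C.
Proof. move=> hf hg. apply: cder_plus => //. exact: cder_opp. Qed.

Lemma cder_scal (c : C) (f : C -> C) (z a : C) : cder f z a -> cder (fun w => c * f w)%C z (c * a)%C.
Proof.
  move=> hf. apply: (cder_eq _ _ (0 * f z + c * a)%C); last by Cring.
  apply: cder_mult => //. exact: cder_const.
Qed.

(** The difference of the two slopes is continuous at [z] with value [a - b], but it vanishes off
    [z], where a slope does not depend on the proposed derivative. *)
Lemma cder_unique (f : C -> C) (z a b : C) : cder f z a -> cder f z b -> a = b.
Proof.
  move=> ha hb.
  case: (Ceq_dec a b) => // nab.
  have h := continuous_Cplus _ _ _ ha (continuous_Copp _ _ hb).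
  have nz : (slope f z a z + - slope f z b z)%C <> RtoC 0 by rewrite !slope_at; exact: Cminus_nz.
  have /locally_Cmod [d [d0 hd]] := locally_nz _ _ h nz.
  exfalso. apply (hd (z + RtoC (d/2))%C).
  - rewrite (_ : z + RtoC (d/2) - z = RtoC (d/2))%C; last by Cring.
    rewrite Cmod_R Rabs_pos_eq; lra.
  - rewrite /slope. case: Ceq_dec => [e|n]; last by Cring.
    exfalso. have : Re (z + RtoC (d/2))%C = Re z by rewrite e. move=> hh; Cre; lra.
Qed.

Lemma cder_eps (f : C -> C) (z d : C) :
  (forall eps, 0 < eps -> clocally z (fun w : C => Cmod (f w - f z - d * (w - z)) <= eps * Cmod (w - z))) ->
  cder f z d.
Proof.
  move=> h. apply/filterlim_locally => eps.
  have e2 : 0 < eps / 2 by case: eps => e /=; lra.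
  apply: filter_imp (h _ e2) => w hw.
  apply: C_NormedModule_mixin_compat1. rewrite /minus /plus /opp /= slope_at /slope.
  case: Ceq_dec => [e|n].
  - rewrite (_ : d + - d = 0)%C; last by Cring. rewrite Cmod_0. lra.
  - have nz := Cminus_nz _ _ n. have p0 := proj1 (Cmod_gt_0 _) nz.
    apply: (Rmult_lt_reg_r (Cmod (w - z))) => //. rewrite -Cmod_mult.
    rewrite (_ : ((f w - f z) / (w - z) + - d) * (w - z) = f w - f z - d * (w - z))%C; last by Cfield.
    apply: (Rle_lt_trans _ _ _ hw). nra.
Qed.

Lemma cder_eps_inv (f : C -> C) (z d : C) : cder f z d -> forall eps, 0 < eps ->
  clocally z (fun w : C => Cmod (f w - f z - d * (w - z)) <= eps * Cmod (w - z)).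
Proof.
  move=> h eps e0.
  have hc : continuous (T:=C_UniformSpace) (U:=R_UniformSpace) (fun w : C_UniformSpace => Cmod (slope f z d w - d)) z.
  { apply: continuous_Cmod. apply: continuous_Cplus => //. exact: continuous_const. }
  have hl : clocally z (fun w => Cmod (slope f z d w - d) < eps).
  { apply (hc (fun y => y < eps)).
    rewrite /= slope_at (_ : d - d = 0)%C; last by Cring.
    rewrite Cmod_0. exists (mkposreal _ e0) => y. rewrite /ball /= /AbsRing_ball /abs /minus /plus /opp /=.
    move/Rabs_def2. lra. }
  apply: filter_imp hl => w hw.
  rewrite (_ : f w - f z - d * (w - z) = (slope f z d w - d) * (w - z))%C.
  - rewrite Cmod_mult. apply: Rmult_le_compat_r; [exact: Cmod_ge_0 | lra].
  - rewrite {1}(slope_eq f z d w). Cring.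
Qed.

(** [is_derive] over [C_AbsRing] takes neighbourhoods in the metric of the modulus, [ccont] in the
    product uniform structure; [locally_C] identifies the two. The holomorphy hypothesis and
    [C_derive] of the statement enter the proof through this equivalence. *)
Lemma cder_is_derive (f : C -> C) (z a : C) : cder f z a <-> is_derive (K:=C_AbsRing) (V:=C_NormedModule) f z a.
Proof.
  have e : forall w, (f w + - f z + - ((w + - z) * a))%C = (f w - f z - a * (w - z))%C by move=> w; Cring.
  split.
  - move=> h. split; first exact: is_linear_scal_l.
    move=> x hx. have <- : z = x by apply: (is_filter_lim_locally_unique (V:=AbsRing_NormedModule C_AbsRing)).
    move=> eps. apply/locally_C. apply: filter_imp (cder_eps_inv f z a h eps (cond_pos eps)) => w hw.
    change (Cmod (f w + - f z + - ((w + - z) * a))%C <= eps * Cmod (w - z)%C). by rewrite e.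
  - move=> [_ h]. apply: cder_eps => eps e0.
    have hl := proj2 (locally_C z _) (h z (fun P hP => hP) (mkposreal _ e0)).
    refine (filter_imp (F:=clocally z) _ _ _ hl) => w hw. rewrite -e. exact: hw.
Qed.

Lemma cder_C_derive (f : C -> C) (z a : C) : cder f z a -> C_derive f z = a.
Proof. move=> h. apply: is_C_derive_unique. exact/cder_is_derive. Qed.

Lemma holo_iff (f : C -> C) (z : C) : holomorphic_at f z <-> clocally z (cdiff f).
Proof.
  split; apply: (filter_imp (F:=clocally z)) => w [a ha]; exists a; exact/cder_is_derive.
Qed.

(** * Integrals along segments and rectangles *)

(** Taken componentwise, so that the order and comparison lemmas for real integrals apply to each
    part. [Lg_RInt] matches it with the vector-valued [RInt] of [F_logder]. *)
Definition CI (g : R -> C) (a b : R) : C :=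
  (RInt (fun s => Re (g s)) a b, RInt (fun s => Im (g s)) a b).

Definition pcont_on (g : R -> C) (a b : R) :=
  forall s, Rmin a b <= s <= Rmax a b -> pcont g s.

Lemma ex_RInt_Re g a b : pcont_on g a b -> ex_RInt (fun s => Re (g s)) a b.
Proof. move=> h; apply: (ex_RInt_continuous (V:=R_CompleteNormedModule)) => s hs. apply: continuous_Re. exact: h. Qed.

Lemma ex_RInt_Im g a b : pcont_on g a b -> ex_RInt (fun s => Im (g s)) a b.
Proof. move=> h; apply: (ex_RInt_continuous (V:=R_CompleteNormedModule)) => s hs. apply: continuous_Im. exact: h. Qed.

Lemma CI_ext (g h : R -> C) a b :
  (forall s, Rmin a b < s < Rmax a b -> g s = h s) -> CI g a b = CI h a b.
Proof. move=> e. by apply C_ext => /=; apply: RInt_ext => s hs; rewrite e. Qed.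

Lemma CI_plus (g h : R -> C) a b : pcont_on g a b -> pcont_on h a b ->
  CI (fun s => g s + h s)%C a b = (CI g a b + CI h a b)%C.
Proof.
  move=> hg hh. apply C_ext => /=.
  - apply: (RInt_plus (V:=R_CompleteNormedModule)); exact: ex_RInt_Re.
  - apply: (RInt_plus (V:=R_CompleteNormedModule)); exact: ex_RInt_Im.
Qed.

Lemma CI_scal (c : C) (g : R -> C) a b : pcont_on g a b ->
  CI (fun s => c * g s)%C a b = (c * CI g a b)%C.
Proof.
  move=> hg. have hR := ex_RInt_Re _ _ _ hg. have hI := ex_RInt_Im _ _ _ hg.
  have e1 : forall k, RInt (fun s => k * Re (g s)) a b = k * RInt (fun s => Re (g s)) a b.
  { move=> k; exact: (RInt_scal (V:=R_CompleteNormedModule)). }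
  have e2 : forall k, RInt (fun s => k * Im (g s)) a b = k * RInt (fun s => Im (g s)) a b.
  { move=> k; exact: (RInt_scal (V:=R_CompleteNormedModule)). }
  have x1 : forall k, ex_RInt (fun s => k * Re (g s)) a b.
  { move=> k; exact: (ex_RInt_scal (V:=R_NormedModule)). }
  have x2 : forall k, ex_RInt (fun s => k * Im (g s)) a b.
  { move=> k; exact: (ex_RInt_scal (V:=R_NormedModule)). }
  apply C_ext.
  - rewrite /= -/(Re c) -/(Im c) -e1 -e2. apply: (RInt_minus (V:=R_CompleteNormedModule)) => //.
  - rewrite /= -/(Re c) -/(Im c) -e1 -e2. apply: (RInt_plus (V:=R_CompleteNormedModule)) => //.
Qed.

Lemma CI_Chasles (g : R -> C) a b c : pcont_on g a b -> pcont_on g b c ->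
  CI g a c = (CI g a b + CI g b c)%C.
Proof.
  move=> h1 h2. apply C_ext => /=; symmetry; apply: (RInt_Chasles (V:=R_CompleteNormedModule));
    by (apply: ex_RInt_Re || apply: ex_RInt_Im).
Qed.

(** The factor 2 comes from bounding the real and the imaginary part separately. It is harmless: the
    main term of the theorem never passes through this bound. *)
Lemma CI_bound (g : R -> C) a b M : a <= b -> pcont_on g a b ->
  (forall s, a <= s <= b -> Cmod (g s) <= M) -> Cmod (CI g a b) <= 2 * M * (b - a).
Proof.
  move=> ab h hM. apply: Rle_trans (Cmod_ReIm _) _. rewrite /=.
  have := abs_RInt_le_const (fun s => Re (g s)) a b M ab (ex_RInt_Re _ _ _ h)
    (fun s hs => Rle_trans _ _ _ (re_le_Cmod _) (hM s hs)).
  have := abs_RInt_le_const (fun s => Im (g s)) a b M ab (ex_RInt_Im _ _ _ h)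
    (fun s hs => Rle_trans _ _ _ (im_le_Cmod _) (hM s hs)).
  lra.
Qed.

Lemma car_derive (h k : R -> R) s : continuous k s -> (forall s', h s' = h s + k s' * (s' - s)) ->
  is_derive h s (k s).
Proof.
  move=> hk he. apply/is_derive_Reals => eps e0.
  have := hk (fun y => Rabs (y - k s) < eps) => [] [].
  { by exists (mkposreal _ e0). }
  move=> d hd. exists d => u nu hu. rewrite (he (s + u)).
  rewrite (_ : (h s + k (s + u) * (s + u - s) - h s) / u - k s = k (s + u) - k s); last by field.
  apply: hd. rewrite /ball /= /AbsRing_ball /abs /minus /plus /opp /=.
  by rewrite (_ : s + u + - s = u); last ring.
Qed.

Lemma cder_line (G : C -> C) (p e d : C) s : cder G (p + RtoC s * e)%C d ->
  is_derive (fun s => Re (G (p + RtoC s * e)%C)) s (Re (d * e)%C) /\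
  is_derive (fun s => Im (G (p + RtoC s * e)%C)) s (Im (d * e)%C).
Proof.
  move=> h. set z := (p + RtoC s * e)%C in h.
  have hc : pcont (fun s' => slope G z d (p + RtoC s' * e) * e)%C s.
  { apply: continuous_Cmult; last exact: continuous_const. by apply: (pcont_line (slope G z d)). }
  have e1 : forall s', G (p + RtoC s' * e)%C = (G z + (slope G z d (p + RtoC s' * e) * e) * RtoC (s' - s))%C.
  { move=> s'. rewrite {1}(slope_eq G z d). rewrite /z RtoC_minus. ring. }
  have e2 : (slope G z d (p + RtoC s * e) * e = d * e)%C by rewrite -/z slope_at.
  split.
  - rewrite -e2. apply: (car_derive _ (fun s' => Re (slope G z d (p + RtoC s' * e) * e)%C)).
    + exact: continuous_Re hc.
    + move=> s'. rewrite (e1 s') -/z. move: (slope _ _ _ _) (G z) => u v. Cre. ring.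
  - rewrite -e2. apply: (car_derive _ (fun s' => Im (slope G z d (p + RtoC s' * e) * e)%C)).
    + exact: continuous_Im hc.
    + move=> s'. rewrite (e1 s') -/z. move: (slope _ _ _ _) (G z) => u v. Cre. ring.
Qed.

Lemma CI_prim_line (G q : C -> C) (p e : C) a b :
  (forall s, Rmin a b <= s <= Rmax a b -> cder G (p + RtoC s * e)%C (q (p + RtoC s * e)%C)) ->
  (forall s, Rmin a b <= s <= Rmax a b -> ccont q (p + RtoC s * e)%C) ->
  CI (fun s => q (p + RtoC s * e) * e)%C a b = (G (p + RtoC b * e) - G (p + RtoC a * e))%C.
Proof.
  move=> hG hq.
  have hc : forall s, Rmin a b <= s <= Rmax a b -> pcont (fun s => q (p + RtoC s * e) * e)%C s.
  { move=> s hs. apply: continuous_Cmult; last exact: continuous_const. apply: pcont_line. exact: hq. }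
  apply C_ext; rewrite [LHS]/=.
  - apply: is_RInt_unique. apply: (is_RInt_derive (V:=R_CompleteNormedModule) (fun s => Re (G (p + RtoC s * e)%C))) => s hs.
    + exact: (proj1 (cder_line _ _ _ _ _ (hG s hs))).
    + exact: (continuous_Re _ _ (hc s hs)).
  - apply: is_RInt_unique. apply: (is_RInt_derive (V:=R_CompleteNormedModule) (fun s => Im (G (p + RtoC s * e)%C))) => s hs.
    + exact: (proj2 (cder_line _ _ _ _ _ (hG s hs))).
    + exact: (continuous_Im _ _ (hc s hs)).
Qed.

Definition pt (x y : R) : C := (x, y).

Definition HI (q : C -> C) y a b : C := CI (fun x => q (pt x y)) a b.
Definition VI (q : C -> C) x a b : C := (Ci * CI (fun y => q (pt x y)) a b)%C.

Lemma pt_h x y : pt x y = (pt 0 y + RtoC x * 1)%C.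
Proof. apply C_ext => /=; ring. Qed.
Lemma pt_v x y : pt x y = (pt x 0 + RtoC y * Ci)%C.
Proof. apply C_ext => /=; ring. Qed.

Lemma pcont_h q x y : ccont q (pt x y) -> pcont (fun x => q (pt x y)) x.
Proof.
  move=> h. apply: (continuous_ext (fun x => q (pt 0 y + RtoC x * 1)%C)).
  - move=> s. by rewrite -pt_h.
  - apply: pcont_line. by rewrite -pt_h.
Qed.
Lemma pcont_v q x y : ccont q (pt x y) -> pcont (fun y => q (pt x y)) y.
Proof.
  move=> h. apply: (continuous_ext (fun y => q (pt x 0 + RtoC y * Ci)%C)).
  - move=> s. by rewrite -pt_v.
  - apply: pcont_line. by rewrite -pt_v.
Qed.

Definition hcont (q : C -> C) y a b := forall x, Rmin a b <= x <= Rmax a b -> ccont q (pt x y).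
Definition vcont (q : C -> C) x a b := forall y, Rmin a b <= y <= Rmax a b -> ccont q (pt x y).

Lemma hcont_on q y a b : hcont q y a b -> pcont_on (fun x => q (pt x y)) a b.
Proof. move=> h s hs. apply: pcont_h. exact: h. Qed.
Lemma vcont_on q x a b : vcont q x a b -> pcont_on (fun y => q (pt x y)) a b.
Proof. move=> h s hs. apply: pcont_v. exact: h. Qed.

Lemma HI_prim G q y a b :
  (forall x, Rmin a b <= x <= Rmax a b -> cder G (pt x y) (q (pt x y))) -> hcont q y a b ->
  HI q y a b = (G (pt b y) - G (pt a y))%C.
Proof.
  move=> hG hq. rewrite (pt_h b) (pt_h a) -(CI_prim_line G q).
  - apply: CI_ext => s _. rewrite -pt_h. ring.
  - move=> s hs. rewrite -pt_h. exact: hG.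
  - move=> s hs. rewrite -pt_h. exact: hq.
Qed.

Lemma VI_prim G q x a b :
  (forall y, Rmin a b <= y <= Rmax a b -> cder G (pt x y) (q (pt x y))) -> vcont q x a b ->
  VI q x a b = (G (pt x b) - G (pt x a))%C.
Proof.
  move=> hG hq. rewrite (pt_v _ b) (pt_v _ a) -(CI_prim_line G q).
  - rewrite /VI -CI_scal; last exact: vcont_on. apply: CI_ext => s _. rewrite -pt_v. ring.
  - move=> s hs. rewrite -pt_v. exact: hG.
  - move=> s hs. rewrite -pt_v. exact: hq.
Qed.

Lemma HI_plus q1 q2 y a b : hcont q1 y a b -> hcont q2 y a b ->
  HI (fun z => q1 z + q2 z)%C y a b = (HI q1 y a b + HI q2 y a b)%C.
Proof. move=> h1 h2. apply: CI_plus; exact: hcont_on. Qed.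
Lemma VI_plus q1 q2 y a b : vcont q1 y a b -> vcont q2 y a b ->
  VI (fun z => q1 z + q2 z)%C y a b = (VI q1 y a b + VI q2 y a b)%C.
Proof. move=> h1 h2. rewrite /VI CI_plus; try exact: vcont_on. ring. Qed.
Lemma HI_scal c q y a b : hcont q y a b -> HI (fun z => c * q z)%C y a b = (c * HI q y a b)%C.
Proof. move=> h. apply: CI_scal; exact: hcont_on. Qed.
Lemma VI_scal c q y a b : vcont q y a b -> VI (fun z => c * q z)%C y a b = (c * VI q y a b)%C.
Proof. move=> h. rewrite /VI CI_scal; try exact: vcont_on. ring. Qed.
Lemma HI_bound q y a b M : a <= b -> hcont q y a b ->
  (forall x, a <= x <= b -> Cmod (q (pt x y)) <= M) -> Cmod (HI q y a b) <= 2 * M * (b - a).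
Proof. move=> ab h hM. apply: CI_bound => //. exact: hcont_on. Qed.
Lemma VI_bound q x a b M : a <= b -> vcont q x a b ->
  (forall y, a <= y <= b -> Cmod (q (pt x y)) <= M) -> Cmod (VI q x a b) <= 2 * M * (b - a).
Proof. move=> ab h hM. rewrite /VI Cmod_mult Cmod_Ci Rmult_1_l. apply: CI_bound => //. exact: vcont_on. Qed.
Lemma HI_Chasles q y a b c : a <= b <= c -> hcont q y a c -> HI q y a c = (HI q y a b + HI q y b c)%C.
Proof.
  move=> h hq. apply: CI_Chasles; apply: hcont_on => s; rewrite Rmin_left ?Rmax_right; try lra; move=> hs;
    apply: hq; rewrite Rmin_left ?Rmax_right; lra.
Qed.
Lemma VI_Chasles q x a b c : a <= b <= c -> vcont q x a c -> VI q x a c = (VI q x a b + VI q x b c)%C.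
Proof.
  move=> h hq. rewrite /VI (CI_Chasles _ a b c); first ring; apply: vcont_on => s; rewrite Rmin_left ?Rmax_right; try lra;
    move=> hs; apply: hq; rewrite Rmin_left ?Rmax_right; lra.
Qed.
Lemma HI_ext q1 q2 y a b : (forall x, Rmin a b < x < Rmax a b -> q1 (pt x y) = q2 (pt x y)) -> HI q1 y a b = HI q2 y a b.
Proof. exact: CI_ext. Qed.
Lemma VI_ext q1 q2 y a b : (forall x, Rmin a b < x < Rmax a b -> q1 (pt y x) = q2 (pt y x)) -> VI q1 y a b = VI q2 y a b.
Proof. move=> h. rewrite /VI. congr (_ * _)%C. exact: CI_ext. Qed.

Definition RectI (q : C -> C) x1 x2 y1 y2 : C :=
  (HI q y1 x1 x2 + VI q x2 y1 y2 - HI q y2 x1 x2 - VI q x1 y1 y2)%C.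

Definition on_edge x1 x2 y1 y2 (z : C) : Prop :=
  x1 <= Re z <= x2 /\ y1 <= Im z <= y2 /\ (Re z = x1 \/ Re z = x2 \/ Im z = y1 \/ Im z = y2).
Definition in_rect x1 x2 y1 y2 (z : C) : Prop := x1 <= Re z <= x2 /\ y1 <= Im z <= y2.
Definition in_box x1 x2 y1 y2 (z : C) : Prop := x1 < Re z < x2 /\ y1 < Im z < y2.

Lemma box_margin x1 x2 y1 y2 z : in_box x1 x2 y1 y2 z ->
  exists m, 0 < m /\ m <= Re z - x1 /\ m <= x2 - Re z /\ m <= Im z - y1 /\ m <= y2 - Im z.
Proof.
  move=> [hx hy]. exists (Rmin (Rmin (Re z - x1) (x2 - Re z)) (Rmin (Im z - y1) (y2 - Im z))).
  split; first by repeat apply: Rmin_glb_lt; lra.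
  have a1 := Rmin_l (Rmin (Re z - x1) (x2 - Re z)) (Rmin (Im z - y1) (y2 - Im z)).
  have a2 := Rmin_r (Rmin (Re z - x1) (x2 - Re z)) (Rmin (Im z - y1) (y2 - Im z)).
  have a3 := Rmin_l (Re z - x1) (x2 - Re z). have a4 := Rmin_r (Re z - x1) (x2 - Re z).
  have a5 := Rmin_l (Im z - y1) (y2 - Im z). have a6 := Rmin_r (Im z - y1) (y2 - Im z). lra.
Qed.

Lemma edge_conts q x1 x2 y1 y2 : x1 <= x2 -> y1 <= y2 ->
  (forall z, on_edge x1 x2 y1 y2 z -> ccont q z) ->
  hcont q y1 x1 x2 /\ hcont q y2 x1 x2 /\ vcont q x1 y1 y2 /\ vcont q x2 y1 y2.
Proof.
  move=> hx hy h. split; [|split; [|split]] => s; rewrite Rmin_left // Rmax_right // => hs; apply: h; rewrite /on_edge /=; intuition lra.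
Qed.

Lemma RectI_prim G q x1 x2 y1 y2 : x1 <= x2 -> y1 <= y2 ->
  (forall z, on_edge x1 x2 y1 y2 z -> cder G z (q z)) ->
  (forall z, on_edge x1 x2 y1 y2 z -> ccont q z) -> RectI q x1 x2 y1 y2 = RtoC 0.
Proof.
  move=> hx hy hG hq. have [h1 [h2 [h3 h4]]] := edge_conts _ _ _ _ _ hx hy hq.
  rewrite /RectI (HI_prim G q y1) // ?(HI_prim G q y2) // ?(VI_prim G q x1) // ?(VI_prim G q x2) //; first ring;
   move=> s; rewrite Rmin_left // Rmax_right // => hs; apply: hG; rewrite /on_edge /=; intuition lra.
Qed.

Lemma RectI_plus q1 q2 x1 x2 y1 y2 : x1 <= x2 -> y1 <= y2 ->
  (forall z, on_edge x1 x2 y1 y2 z -> ccont q1 z) -> (forall z, on_edge x1 x2 y1 y2 z -> ccont q2 z) ->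
  RectI (fun z => q1 z + q2 z)%C x1 x2 y1 y2 = (RectI q1 x1 x2 y1 y2 + RectI q2 x1 x2 y1 y2)%C.
Proof.
  move=> hx hy hq1 hq2. have [h1 [h2 [h3 h4]]] := edge_conts _ _ _ _ _ hx hy hq1.
  have [h1' [h2' [h3' h4']]] := edge_conts _ _ _ _ _ hx hy hq2.
  rewrite /RectI !HI_plus // !VI_plus //. ring.
Qed.

Lemma RectI_scal c q x1 x2 y1 y2 : x1 <= x2 -> y1 <= y2 ->
  (forall z, on_edge x1 x2 y1 y2 z -> ccont q z) ->
  RectI (fun z => c * q z)%C x1 x2 y1 y2 = (c * RectI q x1 x2 y1 y2)%C.
Proof.
  move=> hx hy hq1. have [h1 [h2 [h3 h4]]] := edge_conts _ _ _ _ _ hx hy hq1.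
  rewrite /RectI !HI_scal // !VI_scal //. ring.
Qed.

Lemma RectI_ext q1 q2 x1 x2 y1 y2 : x1 <= x2 -> y1 <= y2 ->
  (forall z, on_edge x1 x2 y1 y2 z -> q1 z = q2 z) -> RectI q1 x1 x2 y1 y2 = RectI q2 x1 x2 y1 y2.
Proof.
  move=> hx hy h.
  rewrite /RectI (HI_ext q1 q2 y1) ?(HI_ext q1 q2 y2) ?(VI_ext q1 q2 x1) ?(VI_ext q1 q2 x2) //;
   move=> s; rewrite Rmin_left // Rmax_right // => hs; apply: h; rewrite /on_edge /=; intuition lra.
Qed.

Lemma Cmod_4 (a b c d : C) : Cmod (a + b - c - d) <= Cmod a + Cmod b + Cmod c + Cmod d.
Proof.
  have h1 := Cmod_triangle (a + b - c) (- d). have h2 := Cmod_triangle (a + b) (- c).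
  have h3 := Cmod_triangle a b. rewrite !Cmod_opp in h1 h2. rewrite /Cminus in h1 h2 *. lra.
Qed.

Lemma RectI_bound q x1 x2 y1 y2 M : x1 <= x2 -> y1 <= y2 ->
  (forall z, on_edge x1 x2 y1 y2 z -> ccont q z) ->
  (forall z, on_edge x1 x2 y1 y2 z -> Cmod (q z) <= M) ->
  Cmod (RectI q x1 x2 y1 y2) <= 4 * M * (x2 - x1 + (y2 - y1)).
Proof.
  move=> hx hy hq hM. have [h1 [h2 [h3 h4]]] := edge_conts _ _ _ _ _ hx hy hq.
  apply: Rle_trans (Cmod_4 _ _ _ _) _.
  have b1 := HI_bound q y1 x1 x2 M hx h1. have b2 := HI_bound q y2 x1 x2 M hx h2.
  have b3 := VI_bound q x1 y1 y2 M hy h3. have b4 := VI_bound q x2 y1 y2 M hy h4.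
  have {}b1 : Cmod (HI q y1 x1 x2) <= 2 * M * (x2 - x1) by apply: b1 => s hs; apply: hM; rewrite /on_edge /=; intuition lra.
  have {}b2 : Cmod (HI q y2 x1 x2) <= 2 * M * (x2 - x1) by apply: b2 => s hs; apply: hM; rewrite /on_edge /=; intuition lra.
  have {}b3 : Cmod (VI q x1 y1 y2) <= 2 * M * (y2 - y1) by apply: b3 => s hs; apply: hM; rewrite /on_edge /=; intuition lra.
  have {}b4 : Cmod (VI q x2 y1 y2) <= 2 * M * (y2 - y1) by apply: b4 => s hs; apply: hM; rewrite /on_edge /=; intuition lra.
  lra.
Qed.

Lemma RectI_split_x q x1 x x2 y1 y2 : x1 <= x <= x2 -> y1 <= y2 ->
  (forall z, on_edge x1 x2 y1 y2 z -> ccont q z) ->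
  RectI q x1 x2 y1 y2 = (RectI q x1 x y1 y2 + RectI q x x2 y1 y2)%C.
Proof.
  move=> hx hy hq. have hx' : x1 <= x2 by lra. have [h1 [h2 [h3 h4]]] := edge_conts _ _ _ _ _ hx' hy hq.
  rewrite /RectI (HI_Chasles q y1 x1 x x2) // (HI_Chasles q y2 x1 x x2) //. ring.
Qed.

Lemma RectI_split_y q x1 x2 y1 y y2 : x1 <= x2 -> y1 <= y <= y2 ->
  (forall z, on_edge x1 x2 y1 y2 z -> ccont q z) ->
  RectI q x1 x2 y1 y2 = (RectI q x1 x2 y1 y + RectI q x1 x2 y y2)%C.
Proof.
  move=> hx hy hq. have hy' : y1 <= y2 by lra. have [h1 [h2 [h3 h4]]] := edge_conts _ _ _ _ _ hx hy' hq.
  rewrite /RectI (VI_Chasles q x1 y1 y y2) // (VI_Chasles q x2 y1 y y2) //. ring.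
Qed.

(** * Goursat's theorem *)

Lemma pow2_ge n : INR n <= 2 ^ n.
Proof.
  elim: n => [|n IH]; first by rewrite /=; lra.
  rewrite S_INR /=. have : 1 <= 2 ^ n by apply: pow_R1_Rle; lra. lra.
Qed.

Lemma halving_small (w d : R) : 0 < d -> exists N, w / 2 ^ N < d.
Proof.
  move=> d0. have [N hN] := INR_unbounded (w / d). exists N.
  have h2 := pow2_ge N. have p : 0 < 2 ^ N by apply: pow_lt; lra.
  apply: (Rmult_lt_reg_r (2 ^ N)) => //.
  rewrite /Rdiv Rmult_assoc Rinv_l; last lra.
  have : w = w / d * d by field; lra. nra.
Qed.

(* Cousin's lemma for rectangles. *)
Lemma bisection (P : R -> R -> R -> R -> Prop) (x0 y0 w0 h0 : R) : 0 <= w0 -> 0 <= h0 ->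
  (forall x y w h, 0 <= w -> 0 <= h -> x0 <= x -> x + w <= x0 + w0 -> y0 <= y -> y + h <= y0 + h0 ->
    P x y (w/2) (h/2) -> P (x + w/2) y (w/2) (h/2) -> P x (y + h/2) (w/2) (h/2) ->
    P (x + w/2) (y + h/2) (w/2) (h/2) -> P x y w h) ->
  (forall p q, x0 <= p <= x0 + w0 -> y0 <= q <= y0 + h0 -> exists d, 0 < d /\
    forall x y w h, 0 <= w < d -> 0 <= h < d -> x <= p <= x + w -> y <= q <= y + h ->
      x0 <= x -> x + w <= x0 + w0 -> y0 <= y -> y + h <= y0 + h0 -> P x y w h) ->
  P x0 y0 w0 h0.
Proof.
  move=> w00 h00 hcomb hloc. apply NNPP => hn.
  set W := fun n => w0 / 2 ^ n. set H := fun n => h0 / 2 ^ n.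
  have p2 : forall n, 0 < 2 ^ n by move=> n; apply: pow_lt; lra.
  have Wp : forall n, 0 <= W n by move=> n; apply: Rmult_le_pos => //; left; apply: Rinv_0_lt_compat.
  have Hp : forall n, 0 <= H n by move=> n; apply: Rmult_le_pos => //; left; apply: Rinv_0_lt_compat.
  have WS : forall n, W (S n) = W n / 2 by move=> n; rewrite /W /=; field; apply: Rgt_not_eq; apply: p2.
  have HS : forall n, H (S n) = H n / 2 by move=> n; rewrite /H /=; field; apply: Rgt_not_eq; apply: p2.
  set inv := fun n (s : R * R) => x0 <= fst s /\ fst s + W n <= x0 + w0 /\ y0 <= snd s /\ snd s + H n <= y0 + h0 /\
     ~ P (fst s) (snd s) (W n) (H n).
  set step := fun n (s s' : R * R) => inv (S n) s' /\ fst s <= fst s' <= fst s + W n / 2 /\ snd s <= snd s' <= snd s + H n / 2.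
  have ex : forall n s, inv n s -> exists s', step n s s'.
  { move=> n [x y] [i1 [i2 [i3 [i4 i5]]]]; rewrite /= in i1 i2 i3 i4 i5. apply NNPP => hs. apply: i5.
    have wp := Wp n. have hp := Hp n.
    apply: hcomb => //; apply NNPP => hP; apply: hs.
    - exists (x, y). rewrite /step /inv /= WS HS. intuition lra.
    - exists (x + W n / 2, y). rewrite /step /inv /= WS HS. intuition lra.
    - exists (x, y + H n / 2). rewrite /step /inv /= WS HS. intuition lra.
    - exists (x + W n / 2, y + H n / 2). rewrite /step /inv /= WS HS. intuition lra. }
  set nxt := fun n s => epsilon (inhabits s) (step n s).
  have nxtP : forall n s, inv n s -> step n s (nxt n s) by move=> n s hs; apply: epsilon_spec; exact: ex.
  set sq := fix sq n := match n with O => (x0, y0) | S n => nxt n (sq n) end.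
  have hinv : forall n, inv n (sq n).
  { elim => [|n IH]; last by case: (nxtP n _ IH).
    rewrite /inv /sq /W /H /= !Rdiv_1_r. intuition lra. }
  have hstep : forall n, step n (sq n) (sq (S n)) by move=> n; apply: nxtP.
  have mono : forall m n, (m <= n)%nat -> fst (sq m) <= fst (sq n) /\ fst (sq n) + W n <= fst (sq m) + W m /\
     snd (sq m) <= snd (sq n) /\ snd (sq n) + H n <= snd (sq m) + H m.
  { move=> m n. elim: n => [|n IH] hmn.
    - have -> : m = O by lia. intuition lra.
    - case: (Nat.eq_dec m (S n)) => [->|ne]; first by intuition lra.
      have hmn' : (m <= n)%nat by lia. have {}IH := IH hmn'.
      have [_ [s1 s2]] := hstep n. rewrite WS HS. move: IH s1 s2. move: (Wp n) (Hp n). lra. }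
  have cmp : forall m n, fst (sq m) <= fst (sq n) + W n /\ snd (sq m) <= snd (sq n) + H n.
  { move=> m n. have := Wp m. have := Wp n. have := Hp m. have := Hp n. case: (Nat.le_gt_cases m n) => hmn.
    - have := mono _ _ hmn. lra.
    - have {}hmn : (n <= m)%nat by lia. have := mono _ _ hmn. lra. }
  have [p [hp1 hp2]] : {p | is_lub (fun x => exists n, x = fst (sq n)) p}.
  { apply: completeness.
    - exists (fst (sq O) + W O) => x [n ->]. exact: (proj1 (cmp _ _)).
    - by exists (fst (sq O)); exists O. }
  have [q [hq1 hq2]] : {p | is_lub (fun x => exists n, x = snd (sq n)) p}.
  { apply: completeness.
    - exists (snd (sq O) + H O) => x [n ->]. exact: (proj2 (cmp _ _)).
    - by exists (snd (sq O)); exists O. }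
  have px : forall n, fst (sq n) <= p <= fst (sq n) + W n.
  { move=> n; split; first by apply: hp1; exists n. apply: hp2 => x [m ->]. exact: (proj1 (cmp _ _)). }
  have qx : forall n, snd (sq n) <= q <= snd (sq n) + H n.
  { move=> n; split; first by apply: hq1; exists n. apply: hq2 => x [m ->]. exact: (proj2 (cmp _ _)). }
  have [d [d0 hd]] : exists d, 0 < d /\
    forall x y w h, 0 <= w < d -> 0 <= h < d -> x <= p <= x + w -> y <= q <= y + h ->
      x0 <= x -> x + w <= x0 + w0 -> y0 <= y -> y + h <= y0 + h0 -> P x y w h.
  { apply: hloc.
    - have := px O. by rewrite /W /= Rdiv_1_r.
    - have := qx O. by rewrite /H /= Rdiv_1_r. }
  have [N hN] := halving_small (w0 + h0) d d0.
  have eN : (w0 + h0) / 2 ^ N = W N + H N by rewrite /W /H; field; apply: Rgt_not_eq.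
  have [i1 [i2 [i3 [i4 i5]]]] := hinv N. have wN := Wp N. have hhN := Hp N.
  apply: i5. apply: hd => //; lra.
Qed.

Lemma in_rect_edge x1 x2 y1 y2 z : on_edge x1 x2 y1 y2 z -> in_rect x1 x2 y1 y2 z.
Proof. rewrite /on_edge /in_rect; tauto. Qed.

Lemma Cmod_rect x1 x2 y1 y2 z p : in_rect x1 x2 y1 y2 z -> in_rect x1 x2 y1 y2 p ->
  Cmod (z - p) <= x2 - x1 + (y2 - y1).
Proof.
  rewrite /in_rect => hz hp. apply: Rle_trans (Cmod_ReIm _) _.
  have : Rabs (Re (z - p)) <= x2 - x1 by apply: Rabs_le; Cre; lra.
  have : Rabs (Im (z - p)) <= y2 - y1 by apply: Rabs_le; Cre; lra. lra.
Qed.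

(** On a small rectangle around a point, f differs from its affine approximation, which has a
    primitive, by at most eps/4 times the half-perimeter w + h; the integral is then at most eps (w
    + h)^2. This bound is stable under gluing four quarters, since 4 ((w + h)/2)^2 = (w + h)^2, and
    that is what [bisection] requires. *)
Theorem goursat f x1 x2 y1 y2 : x1 <= x2 -> y1 <= y2 ->
  (forall z, in_rect x1 x2 y1 y2 z -> cdiff f z) -> RectI f x1 x2 y1 y2 = RtoC 0.
Proof.
  move=> hx hy hf.
  have key : forall eps, 0 < eps -> Cmod (RectI f x1 x2 y1 y2) <= eps * (x2 - x1 + (y2 - y1)) ^ 2.
  { move=> eps e0.
    have := bisection (fun x y w h => Cmod (RectI f x (x + w) y (y + h)) <= eps * (w + h) ^ 2) x1 y1 (x2 - x1) (y2 - y1).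
    have -> : x1 + (x2 - x1) = x2 by ring. have -> : y1 + (y2 - y1) = y2 by ring.
    apply; try lra.
    - move=> x y w h w0 h0 a1 a2 a3 a4 b1 b2 b3 b4.
      have hc : forall z, in_rect x (x + w) y (y + h) z -> ccont f z.
      { move=> z hz. apply: cdiff_cont. apply: hf. move: hz; rewrite /in_rect; lra. }
      have -> : RectI f x (x + w) y (y + h) = (RectI f x (x + w/2) y (y + h/2) + RectI f (x + w/2) (x + w) y (y + h/2)
          + RectI f x (x + w/2) (y + h/2) (y + h) + RectI f (x + w/2) (x + w) (y + h/2) (y + h))%C.
      { rewrite (RectI_split_y _ _ _ _ (y + h/2)); try lra; last by move=> z hz; apply: hc; apply: in_rect_edge.
        rewrite (RectI_split_x _ x (x + w/2) (x + w) y (y + h/2)); try lra;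
         last by move=> z hz; apply: hc; move: hz; rewrite /on_edge /in_rect; lra.
        rewrite (RectI_split_x _ x (x + w/2) (x + w) (y + h/2) (y + h)); try lra;
         last by move=> z hz; apply: hc; move: hz; rewrite /on_edge /in_rect; lra.
        ring. }
      have e1 : x + w = x + w/2 + w/2 by field. have e2 : y + h = y + h/2 + h/2 by field.
      rewrite e1 e2. set A := RectI _ _ _ _ _ in b1 *. set B := RectI _ _ _ _ _ in b2 *.
      set D := RectI _ _ _ _ _ in b3 *. set E := RectI _ _ _ _ _ in b4 *.
      have t1 := Cmod_triangle (A + B + D) E. have t2 := Cmod_triangle (A + B) D. have t3 := Cmod_triangle A B.
      nra.
    - move=> p q hp hq.
      have [d hd] : cdiff f (pt p q) by apply: hf; rewrite /in_rect /=; lra.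
      have e4 : 0 < eps / 4 by lra.
      have /locally_Cmod [del [del0 hdel]] := cder_eps_inv _ _ _ hd _ e4.
      exists (del / 2). split; first lra.
      move=> x y w h hw hh xp yq a1 a2 a3 a4.
      have xw : x <= x + w by lra. have yh : y <= y + h by lra.
      set L := fun z : C => (f (pt p q) + d * (z - pt p q))%C.
      set E := fun z => (f z - L z)%C.
      have inp : in_rect x (x + w) y (y + h) (pt p q) by rewrite /in_rect /=; lra.
      have Lc : forall z, cder L z d.
      { move=> z. apply: (cder_eq _ _ (0 + d * (1 - 0))%C); last by ring.
        apply: cder_plus; first exact: cder_const. apply: cder_scal. apply: cder_minus; [exact: cder_id | exact: cder_const]. }
      have fc : forall z, on_edge x (x + w) y (y + h) z -> ccont f z.
      { move=> z hz. apply: cdiff_cont. apply: hf. move: hz; rewrite /on_edge /in_rect; lra. }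
      have Ec : forall z, on_edge x (x + w) y (y + h) z -> ccont E z.
      { move=> z hz. apply: continuous_Cplus; first exact: fc. apply: continuous_Copp. exact: cder_cont (Lc z). }
      have -> : RectI f x (x + w) y (y + h) = RectI E x (x + w) y (y + h).
      { rewrite -(Cplus_0_r (RectI E _ _ _ _)).
        have <- : RectI L x (x + w) y (y + h) = RtoC 0.
        { apply: (RectI_prim (fun z => (f (pt p q) + d * - pt p q) * z + d / 2 * (z * z))%C) => // z hz.
          - apply: (cder_eq _ _ ((f (pt p q) + d * - pt p q) * 1 + d / 2 * (1 * z + z * 1))%C).
            + apply: cder_plus; apply: cder_scal; [exact: cder_id | apply: cder_mult; exact: cder_id].
            + rewrite /L. field.
          - exact: cder_cont (Lc z). }
        rewrite -RectI_plus //.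
        - apply: RectI_ext => // z _. rewrite /E. ring.
        - move=> z _; exact: cder_cont (Lc z). }
      apply: Rle_trans (RectI_bound _ _ _ _ _ (eps / 4 * (w + h)) xw yh Ec _) _.
      + move=> z hz. have hm := Cmod_rect _ _ _ _ _ _ (in_rect_edge _ _ _ _ _ hz) inp.
        rewrite (_ : E z = f z - f (pt p q) - d * (z - pt p q))%C; last by rewrite /E /L; ring.
        apply: Rle_trans (hdel z _) _; first lra.
        apply: Rmult_le_compat_l; lra.
      + right. field. }
  apply: Cmod_eq_0. apply: Rle_antisym; last exact: Cmod_ge_0.
  apply: le_epsilon => eps e0. rewrite Rplus_0_l.
  set S := (x2 - x1 + (y2 - y1)) ^ 2 in key.
  have S0 : 0 <= S by rewrite /S; nra.
  apply: Rle_trans (key (eps / (S + 1)) _) _.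
  - apply: Rdiv_lt_0_compat; lra.
  - rewrite (_ : eps / (S + 1) * S = eps * (S / (S + 1))); last by field; lra.
    rewrite -{2}(Rmult_1_r eps). apply: Rmult_le_compat_l; first lra.
    apply: (Rmult_le_reg_r (S + 1)); first lra. rewrite /Rdiv Rmult_assoc Rinv_l; lra.
Qed.

Lemma CI_swap (g : R -> C) a b : pcont_on g a b -> CI g b a = (- CI g a b)%C.
Proof.
  move=> h. apply C_ext => /=; symmetry; apply: (opp_RInt_swap (V:=R_CompleteNormedModule)).
  - exact: ex_RInt_Re.
  - exact: ex_RInt_Im.
Qed.

Lemma pcont_on_swap g a b : pcont_on g a b -> pcont_on g b a.
Proof. move=> h s. rewrite Rmin_comm Rmax_comm. exact: h. Qed.

Lemma CI_bound_gen (g : R -> C) a b M : pcont_on g a b ->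
  (forall s, Rmin a b <= s <= Rmax a b -> Cmod (g s) <= M) -> Cmod (CI g a b) <= 2 * M * Rabs (b - a).
Proof.
  move=> h hM. case: (Rle_dec a b) => ab.
  - rewrite Rabs_pos_eq; last lra. apply: CI_bound => // s hs. apply: hM. by rewrite Rmin_left // Rmax_right.
  - have ba : b <= a by lra. rewrite CI_swap; last exact: pcont_on_swap. rewrite Cmod_opp Rabs_minus_sym Rabs_pos_eq; last lra.
    apply: CI_bound => //; first exact: pcont_on_swap. move=> s hs. apply: hM. by rewrite Rmin_right // Rmax_left.
Qed.

Lemma HI_swap q y a b : hcont q y a b -> HI q y b a = (- HI q y a b)%C.
Proof. move=> h; apply: CI_swap; exact: hcont_on. Qed.
Lemma VI_swap q y a b : vcont q y a b -> VI q y b a = (- VI q y a b)%C.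
Proof. move=> h; rewrite /VI CI_swap; last exact: vcont_on. ring. Qed.

Definition between a b s := Rmin a b <= s <= Rmax a b.

Lemma between_box (x1 x2 a b s : R) : x1 < a < x2 -> x1 < b < x2 -> between a b s -> x1 < s < x2.
Proof. rewrite /between /Rmin /Rmax. case: Rle_dec; lra. Qed.

Lemma box_hcont f x1 x2 y1 y2 a b c :
  (forall z, in_box x1 x2 y1 y2 z -> cdiff f z) ->
  x1 < a < x2 -> x1 < b < x2 -> y1 < c < y2 -> hcont f c a b.
Proof.
  move=> hf ha hb hc s hs. apply: cdiff_cont. apply: hf. split => //=. exact: (between_box _ _ a b).
Qed.

Lemma box_vcont f x1 x2 y1 y2 a b c :
  (forall z, in_box x1 x2 y1 y2 z -> cdiff f z) ->
  y1 < a < y2 -> y1 < b < y2 -> x1 < c < x2 -> vcont f c a b.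
Proof.
  move=> hf ha hb hc s hs. apply: cdiff_cont. apply: hf. split => //=. exact: (between_box _ _ a b).
Qed.

(** Extends [goursat] to corners given in any order, since the paths of [primitive_box] leave the
    centre in all directions. *)
Lemma goursat_box f x1 x2 y1 y2 a b c d :
  (forall z, in_box x1 x2 y1 y2 z -> cdiff f z) ->
  x1 < a < x2 -> x1 < b < x2 -> y1 < c < y2 -> y1 < d < y2 -> RectI f a b c d = RtoC 0.
Proof.
  move=> hf ha hb hc hd.
  have le : forall a b c d, x1 < a < x2 -> x1 < b < x2 -> y1 < c < y2 -> y1 < d < y2 -> a <= b -> c <= d ->
     RectI f a b c d = RtoC 0.
  { move=> {ha hb hc hd}a {}b {}c {}d ha hb hc hd ab cd. apply: goursat => // z [h1 h2]. apply: hf; split; lra. }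
  have H := fun a b c => box_hcont f x1 x2 y1 y2 a b c hf. have V := fun a b c => box_vcont f x1 x2 y1 y2 a b c hf.
  have sx : forall a b c d, x1 < a < x2 -> x1 < b < x2 -> y1 < c < y2 -> y1 < d < y2 -> RectI f a b c d = (- RectI f b a c d)%C.
  { move=> {ha hb hc hd}a {}b {}c {}d ha hb hc hd. rewrite /RectI (HI_swap f c b a) ?(HI_swap f d b a); try exact: H. ring. }
  have sy : forall a b c d, x1 < a < x2 -> x1 < b < x2 -> y1 < c < y2 -> y1 < d < y2 -> RectI f a b c d = (- RectI f a b d c)%C.
  { move=> {ha hb hc hd}a {}b {}c {}d ha hb hc hd. rewrite /RectI (VI_swap f a d c) ?(VI_swap f b d c); try exact: V. ring. }
  case: (Rle_dec a b) => ab; case: (Rle_dec c d) => cd.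
  - exact: le.
  - rewrite sy // le //; try lra. ring.
  - rewrite sx // le //; try lra. ring.
  - rewrite sx // sy // le //; try lra. ring.
Qed.

Lemma in_box_locally x1 x2 y1 y2 z : in_box x1 x2 y1 y2 z -> clocally z (in_box x1 x2 y1 y2).
Proof.
  move=> /box_margin [m [m0 hm]]. apply/locally_Cmod. exists m. split => // w hw.
  have h1 := re_bounds (w - z). have h2 := im_bounds (w - z). rewrite /in_box. Cre. lra.
Qed.

(** The primitive integrates from the centre of the box, horizontally and then vertically. Goursat
    on the rectangle between the two horizontal levels shows that its increment from z to w is the
    integral along the two legs joining z to w, which is close to f z (w - z) by continuity of f. *)
Lemma primitive_box f x1 x2 y1 y2 : (forall z, in_box x1 x2 y1 y2 z -> cdiff f z) ->
  exists G, forall z, in_box x1 x2 y1 y2 z -> cder G z (f z).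
Proof.
  move=> hf. set a := (x1 + x2) / 2. set b := (y1 + y2) / 2.
  exists (fun z => HI f b a (Re z) + VI f (Re z) b (Im z))%C => z hz.
  have [hz1 hz2] := hz.
  have H := fun a b c => box_hcont f x1 x2 y1 y2 a b c hf. have V := fun a b c => box_vcont f x1 x2 y1 y2 a b c hf.
  have ha : x1 < a < x2 by rewrite /a; lra. have hb : y1 < b < y2 by rewrite /b; lra.
  apply: cder_eps => eps e0.
  have hc : clocally z (fun w => Cmod (f w - f z) < eps / 4).
  { have hc : continuous (T:=C_UniformSpace) (U:=R_UniformSpace) (fun w : C_UniformSpace => Cmod (f w - f z)) z.
    { apply: continuous_Cmod. apply: continuous_Cplus; [exact: cdiff_cont (hf z hz) | exact: continuous_const]. }
    apply (hc (fun y => y < eps / 4)). rewrite /= (_ : f z - f z = 0)%C; last by Cring.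
    have e4 : 0 < eps / 4 by lra.
    rewrite Cmod_0. exists (mkposreal _ e4) => y. rewrite /ball /= /AbsRing_ball /abs /minus /plus /opp /=.
    move/Rabs_def2. lra. }
  have hb' := in_box_locally _ _ _ _ _ hz.
  have [d hd] := filter_and _ _ hc hb'.
  exists d => w hw. have [_ [hw1 hw2]] := hd _ hw.
  have seg : forall s u, between (Re z) (Re w) s -> between (Im z) (Im w) u -> ball z d (pt s u : C_UniformSpace).
  { move=> s u hs hu. case: hw. rewrite /ball /= /AbsRing_ball /abs /minus /plus /opp /= => w1 w2.
    move: w1 w2 hs hu. rewrite /between /Re /Im /= => w1 w2 hs hu.
    move/Rabs_def2: w1 => w1. move/Rabs_def2: w2 => w2.
    split; rewrite /ball /= /AbsRing_ball /abs /minus /plus /opp /=; apply: Rabs_def1.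
    - move: hs. rewrite /Rmin /Rmax. case: Rle_dec; lra.
    - move: hs. rewrite /Rmin /Rmax. case: Rle_dec; lra.
    - move: hu. rewrite /Rmin /Rmax. case: Rle_dec; lra.
    - move: hu. rewrite /Rmin /Rmax. case: Rle_dec; lra. }
  have bz1 : between (Re z) (Re w) (Re z) by split; [exact: Rmin_l | exact: Rmax_l].
  have bz2 : between (Im z) (Im w) (Im z) by split; [exact: Rmin_l | exact: Rmax_l].
  have bw1 : between (Re z) (Re w) (Re w) by split; [exact: Rmin_r | exact: Rmax_r].
  set e := fun u => (f u - f z)%C.
  have ec : forall u, in_box x1 x2 y1 y2 u -> ccont e u.
  { move=> u hu. apply: continuous_Cplus; [exact: cdiff_cont (hf u hu) | exact: continuous_const]. }
  have hh : hcont e (Im z) (Re z) (Re w).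
  { move=> s hs. apply: ec. split => //=. exact: (between_box _ _ (Re z) (Re w)). }
  have hv : vcont e (Re w) (Im z) (Im w).
  { move=> s hs. apply: ec. split => //=. exact: (between_box _ _ (Im z) (Im w)). }
  have eq : (HI f b a (Re w) + VI f (Re w) b (Im w) - (HI f b a (Re z) + VI f (Re z) b (Im z)) - f z * (w - z) =
     HI e (Im z) (Re z) (Re w) + VI e (Re w) (Im z) (Im w))%C.
  { have cc : forall c u, ccont (fun _ => c) u by move=> c u; exact: continuous_const.
    have k1 : (HI e (Im z) (Re z) (Re w) + f z * RtoC (Re w - Re z) = HI f (Im z) (Re z) (Re w))%C.
    { have <- : HI (fun _ => f z) (Im z) (Re z) (Re w) = (f z * RtoC (Re w - Re z))%C.
      { rewrite (HI_prim (fun u => f z * u)%C).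
        - rewrite RtoC_minus. rewrite (_ : pt (Re w) (Im z) = RtoC (Re w) + Ci * RtoC (Im z))%C; last by apply C_ext => /=; ring.
          rewrite (_ : pt (Re z) (Im z) = RtoC (Re z) + Ci * RtoC (Im z))%C; last by apply C_ext => /=; ring. ring.
        - move=> s _. apply: (cder_eq _ _ (f z * 1)%C); last by ring. apply: cder_scal. exact: cder_id.
        - by move=> s _. }
      rewrite -HI_plus //. apply: HI_ext => s _. rewrite /e. ring. }
    have k2 : (VI e (Re w) (Im z) (Im w) + f z * (Ci * RtoC (Im w - Im z)) = VI f (Re w) (Im z) (Im w))%C.
    { have <- : VI (fun _ => f z) (Re w) (Im z) (Im w) = (f z * (Ci * RtoC (Im w - Im z)))%C.
      { rewrite (VI_prim (fun u => f z * u)%C).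
        - rewrite RtoC_minus. rewrite (_ : pt (Re w) (Im z) = RtoC (Re w) + Ci * RtoC (Im z))%C; last by apply C_ext => /=; ring.
          rewrite (_ : pt (Re w) (Im w) = RtoC (Re w) + Ci * RtoC (Im w))%C; last by apply C_ext => /=; ring. ring.
        - move=> s _. apply: (cder_eq _ _ (f z * 1)%C); last by ring. apply: cder_scal. exact: cder_id.
        - by move=> s _. }
      rewrite -VI_plus //. apply: VI_ext => s _. rewrite /e. ring. }
    have k3 : HI f b a (Re w) = (HI f b a (Re z) + HI f b (Re z) (Re w))%C.
    { apply: CI_Chasles; apply: hcont_on; exact: H. }
    have k4 : VI f (Re w) b (Im w) = (VI f (Re w) b (Im z) + VI f (Re w) (Im z) (Im w))%C.
    { rewrite /VI (CI_Chasles _ b (Im z) (Im w)); first ring; apply: vcont_on; exact: V. }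
    have k5 : RectI f (Re z) (Re w) b (Im z) = RtoC 0 by apply: (goursat_box f x1 x2 y1 y2).
    have k6 : (HI f b (Re z) (Re w) + VI f (Re w) b (Im z) = HI f (Im z) (Re z) (Re w) + VI f (Re z) b (Im z))%C.
    { rewrite -(Cplus_0_r (HI f (Im z) _ _)) -k5 /RectI. ring. }
    rewrite k3 k4.
    rewrite (_ : (w - z)%C = (RtoC (Re w - Re z) + Ci * RtoC (Im w - Im z))%C); last by apply C_ext; Cre; ring.
    transitivity ((HI f b (Re z) (Re w) + VI f (Re w) b (Im z)) + VI f (Re w) (Im z) (Im w) - VI f (Re z) b (Im z)
       - f z * (RtoC (Re w - Re z) + Ci * RtoC (Im w - Im z)))%C; first by ring.
    rewrite k6 -k1 -k2. ring. }
  rewrite eq.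
  apply: Rle_trans (Cmod_triangle _ _) _.
  have b1 : Cmod (HI e (Im z) (Re z) (Re w)) <= 2 * (eps / 4) * Rabs (Re w - Re z).
  { apply: CI_bound_gen; first exact: hcont_on. move=> s hs.
    left. exact: (proj1 (hd _ (seg s (Im z) hs bz2))). }
  have b2 : Cmod (VI e (Re w) (Im z) (Im w)) <= 2 * (eps / 4) * Rabs (Im w - Im z).
  { rewrite /VI Cmod_mult Cmod_Ci Rmult_1_l. apply: CI_bound_gen; first exact: vcont_on. move=> s hs.
    left. exact: (proj1 (hd _ (seg (Re w) s bw1 hs))). }
  have r1 : Rabs (Re w - Re z) <= Cmod (w - z) by apply: Rle_trans (re_le_Cmod _); right.
  have r2 : Rabs (Im w - Im z) <= Cmod (w - z) by apply: Rle_trans (im_le_Cmod _); right.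
  nra.
Qed.

(** * The logarithm and Cauchy's integral formula *)

Lemma filterdiff_bound (u : R -> R -> R) (x y a b : R) :
  filterdiff (fun p : R * R => u (fst p) (snd p)) (locally (x, y)) (fun h : R * R => plus (scal (fst h) a) (scal (snd h) b)) ->
  forall eps, 0 < eps -> clocally (x, y) (fun w : C =>
    Rabs (u (Re w) (Im w) - u x y - (a * (Re w - x) + b * (Im w - y))) <= eps * Cmod (w - (x, y))%C).
Proof.
  move=> [_ h] eps e0. have {}h := h (x, y) (fun P hP => hP) (mkposreal _ e0).
  refine (filter_imp (F:=clocally (x, y)) _ _ _ h). move=> [w1 w2] /= {}h.
  have -> : Cmod ((w1, w2) - (x, y))%C = norm (minus (w1, w2) (x, y) : prod_NormedModule R_AbsRing R_NormedModule R_NormedModule).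
  { rewrite /norm /= /prod_norm /Cmod /=. congr sqrt. rewrite /norm /= /abs /= !Rmult_1_r.
    by rewrite -!Rabs_mult !Rabs_pos_eq //; apply: Rle_0_sqr. }
  apply: Rle_trans h. right.
  rewrite /norm /= /abs /= /minus /plus /opp /scal /= /mult /=. congr Rabs. ring.
Qed.

(** The Cauchy-Riemann criterion, in the form needed for [Log], which is given by its real and
    imaginary parts. *)
Lemma cder_CR (u v : R -> R -> R) (x y a b : R) :
  filterdiff (fun p : R * R => u (fst p) (snd p)) (locally (x, y)) (fun h : R * R => plus (scal (fst h) a) (scal (snd h) (- b))) ->
  filterdiff (fun p : R * R => v (fst p) (snd p)) (locally (x, y)) (fun h : R * R => plus (scal (fst h) b) (scal (snd h) a)) ->
  cder (fun z => (u (Re z) (Im z), v (Re z) (Im z))) (x, y) (a, b).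
Proof.
  move=> hu hv. apply: cder_eps => eps e0.
  have e2 : 0 < eps / 2 by lra.
  have h := filter_and (F:=clocally (x, y)) _ _ (filterdiff_bound _ _ _ _ _ hu _ e2) (filterdiff_bound _ _ _ _ _ hv _ e2).
  refine (filter_imp (F:=clocally (x, y)) _ _ _ (h (@filter_filter _ _ (locally_filter (T:=C_UniformSpace) (x, y))))). move=> w [h1 h2].
  apply: Rle_trans (Cmod_ReIm _) _.
  rewrite (_ : Re (_ - _ - _)%C = u (Re w) (Im w) - u x y - (a * (Re w - x) + - b * (Im w - y))); last by Cre; ring.
  rewrite (_ : Im (_ - _ - _)%C = v (Re w) (Im w) - v x y - (b * (Re w - x) + a * (Im w - y))); last by Cre; ring.
  lra.
Qed.

(* The principal branch off the negative real axis, by the half-angle formula. *)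
Definition Log (z : C) : C := (ln (Cmod z), 2 * atan (Im z / (Cmod z + Re z))).
Definition slit (z : C) : Prop := 0 < Re z \/ Im z <> 0.

Lemma sq_pos (x y : R) : 0 < x \/ y <> 0 -> 0 < x ^ 2 + y ^ 2.
Proof. move=> [h|h]; first by nra. have : 0 < y ^ 2 by rewrite -Rsqr_pow2; apply: Rsqr_pos_lt. nra. Qed.

Lemma sqrt_plus_pos (x y : R) : 0 < x \/ y <> 0 -> 0 < sqrt (x ^ 2 + y ^ 2) + x.
Proof.
  move=> h. have p := sq_pos _ _ h. have s0 := sqrt_lt_R0 _ p. have s2 := sqrt_sqrt _ (Rlt_le _ _ p).
  case: h => h; first lra. have : 0 < y ^ 2 by rewrite -Rsqr_pow2; apply: Rsqr_pos_lt. nra.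
Qed.

Lemma slit_locally x y : 0 < x \/ y <> 0 ->
  locally (T:=prod_UniformSpace R_UniformSpace R_UniformSpace) (x, y) (fun p => 0 < fst p \/ snd p <> 0).
Proof.
  move=> [h|h].
  - exists (mkposreal _ h) => [[a b]] []. rewrite /ball /= /AbsRing_ball /abs /minus /plus /opp /=.
    move/Rabs_def2 => ? _. left; lra.
  - have h' := Rabs_pos_lt _ h. exists (mkposreal _ h') => [[a b]] []. rewrite /ball /= /AbsRing_ball /abs /minus /plus /opp /=.
    move=> _ hb. right => e. move: hb. rewrite e Rplus_0_l Rabs_Ropp. lra.
Qed.

Lemma Log_cder z : slit z -> cder Log z (/ z)%C.
Proof.
  case: z => x y h. rewrite /slit /= in h.
  have p := sq_pos _ _ h. have q := sqrt_plus_pos _ _ h.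
  have s0 := sqrt_lt_R0 _ p. have s2 := sqrt_sqrt _ (Rlt_le _ _ p).
  rewrite (_ : (/ (x, y))%C = (x / (x^2 + y^2), - (y / (x^2+y^2)))); last by rewrite /Cinv /=; congr pair; field; nra.
  have cq : forall (N : R -> R -> R), (forall a b, 0 < a ^ 2 + b ^ 2 -> continuous (T:=prod_UniformSpace R_UniformSpace R_UniformSpace) (fun p => N (fst p) (snd p)) (a, b)) ->
     continuous (T:=prod_UniformSpace R_UniformSpace R_UniformSpace) (fun u => N (fst u) (snd u) / (fst u ^ 2 + snd u ^ 2)) (x, y).
  { move=> N hN. apply: continuous_multR; first exact: hN.
    apply: (continuous_comp (fun u : R * R => fst u ^ 2 + snd u ^ 2) Rinv); last by apply: continuous_Rinv => /=; simpl in p; lra.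
    apply: continuous_plusR.
    - apply: continuous_multR; first exact: continuous_fst.
      apply: continuous_multR; [exact: continuous_fst | exact: continuous_const].
    - apply: continuous_multR; first exact: continuous_snd.
      apply: continuous_multR; [exact: continuous_snd | exact: continuous_const]. }
  apply: (cder_CR (fun x y => ln (sqrt (x ^ 2 + y ^ 2))) (fun x y => 2 * atan (y / (sqrt (x ^ 2 + y ^ 2) + x)))).
  - rewrite Ropp_involutive.
    apply: (is_derive_filterdiff (fun x y => ln (sqrt (x ^ 2 + y ^ 2))) x y (fun x y => x / (x^2+y^2)) (y / (x^2+y^2))).
    + apply: filter_imp (slit_locally _ _ h) => [[a b]] /= hab.
      have pa := sq_pos _ _ hab. have s0a := sqrt_lt_R0 _ pa. have s2a := sqrt_sqrt _ (Rlt_le _ _ pa).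
      simpl in pa, s0a, s2a. auto_derive; first by intuition.
      set r := sqrt _ in s0a s2a *. rewrite -s2a. field. lra.
    + simpl in p, s0, s2. auto_derive; first by intuition.
      set r := sqrt _ in s0 s2 *. rewrite -s2. field. lra.
    + apply: (cq (fun a b => a)) => a b _. exact: continuous_fst.
  - apply: (is_derive_filterdiff (fun x y => 2 * atan (y / (sqrt (x ^ 2 + y ^ 2) + x))) x y (fun x y => - (y / (x^2+y^2))) (x / (x^2+y^2))).
    + apply: filter_imp (slit_locally _ _ h) => [[a b]] /= hab.
      have pa := sq_pos _ _ hab. have qa := sqrt_plus_pos _ _ hab. have s0a := sqrt_lt_R0 _ pa. have s2a := sqrt_sqrt _ (Rlt_le _ _ pa).
      simpl in pa, qa, s0a, s2a. auto_derive; first by repeat split => //; lra.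
      set r := sqrt _ in s0a s2a qa *. rewrite -s2a.
      have e : b * b = r * r - a * a by lra. field_simplify_eq; last first.
      { repeat split; try lra; try nra. }
      have : b * (b * b - r * r + a * a) = 0 by rewrite e; ring. lra.
    + simpl in p, q, s0, s2. auto_derive; first by repeat split => //; lra.
      set r := sqrt _ in s0 s2 q *. rewrite -s2.
      field_simplify_eq; last first.
      { repeat split; try lra; try nra. }
      have e : y * y = r * r - x * x by lra.
      have k0 : x * (y * y - r * r + x * x) = 0 by rewrite e; ring.
      have k1 : r * (y * y - r * r + x * x) = 0 by rewrite e; ring.
      lra.
    + apply: (continuous_ext (fun u : R * R => (- snd u) / (fst u ^ 2 + snd u ^ 2))).
      { move=> [a b] /=. by rewrite /Rdiv Ropp_mult_distr_l. }
      apply: (cq (fun a b => - b)) => a b _. apply: continuous_oppR. exact: continuous_snd.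
Qed.

(** A branch of the logarithm up to an additive constant, with its cut along the upper imaginary
    half-axis; the cut of [Ldown] is the lower one. *)
Definition Lup (w : C) : C := Log (Ci * w).
Definition Ldown (w : C) : C := Log (- Ci * w).

Lemma slit_nz z : slit z -> z <> RtoC 0.
Proof. move=> h e. move: h. rewrite e /slit /=. lra. Qed.

Lemma Lup_cder w : Im w < 0 \/ Re w <> 0 -> cder Lup w (/ w)%C.
Proof.
  move=> h. have s : slit (Ci * w) by rewrite /slit; Cre; lra.
  have nz := slit_nz _ s.
  have wn : w <> RtoC 0 by move=> e; apply: nz; rewrite e; ring.
  apply: (cder_eq _ _ (/ (Ci * w) * (Ci * 1))%C).
  - apply: (cder_comp Log (fun w => Ci * w)%C); last exact: Log_cder. apply: cder_scal. exact: cder_id.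
  - field. split => // e. by have := f_equal Im e; rewrite /=; lra.
Qed.

Lemma Ldown_cder w : 0 < Im w \/ Re w <> 0 -> cder Ldown w (/ w)%C.
Proof.
  move=> h. have s : slit (- Ci * w) by rewrite /slit; Cre; lra.
  have nz := slit_nz _ s.
  have wn : w <> RtoC 0 by move=> e; apply: nz; rewrite e; ring.
  apply: (cder_eq _ _ (/ (- Ci * w) * (- Ci * 1))%C).
  - apply: (cder_comp Log (fun w => - Ci * w)%C); last exact: Log_cder. apply: cder_scal. exact: cder_id.
  - field. split => // e. by have := f_equal Im e; rewrite /=; lra.
Qed.

Lemma cder_shift f a z d : cder f (z - a)%C d -> cder (fun w => f (w - a)%C) z d.
Proof.
  move=> h. apply: (cder_eq _ _ (d * (1 - 0))%C); last by ring.
  apply: (cder_comp f (fun w => w - a)%C) => //. apply: cder_minus; [exact: cder_id | exact: cder_const].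
Qed.

Lemma Cmod_iu (w : C) : Cmod (Ci * w) = Cmod w.
Proof. by rewrite Cmod_mult Cmod_Ci Rmult_1_l. Qed.
Lemma Cmod_iu' (w : C) : Cmod (- Ci * w) = Cmod w.
Proof. by rewrite Cmod_mult Cmod_opp Cmod_Ci Rmult_1_l. Qed.

Lemma Cmod2 (w : C) : Cmod w * Cmod w = Re w * Re w + Im w * Im w.
Proof. have := Cmod2_alt w. nra. Qed.

Lemma Log_eta z : Log z = (ln (Cmod z), 2 * atan (Im z / (Cmod z + Re z))).
Proof. by []. Qed.

Lemma Im_lt_Cmod w : Re w <> 0 -> - Cmod w < Im w < Cmod w.
Proof.
  move=> h. have m2 := Cmod2 w. have m0 := Cmod_ge_0 w.
  have : 0 < Re w * Re w by apply: Rsqr_pos_lt. nra.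
Qed.

(** With s = u / (m - v) the two imaginary parts are 2 atan s and - 2 atan (1/s), because u^2 = (m -
    v)(m + v); and atan s + atan (1/s) = PI/2 for s > 0. In the left half-plane s is negative and
    the sign of the jump changes. *)
Lemma Lup_Ldown_right w : 0 < Re w -> (Lup w - Ldown w)%C = (0, PI).
Proof.
  move=> h. rewrite /Lup /Ldown !Log_eta Cmod_iu Cmod_iu'.
  have m2 := Cmod2 w. have hm : - Cmod w < Im w < Cmod w by apply: Im_lt_Cmod; lra.
  apply C_ext; first by Cre; ring.
  rewrite (_ : Im (Ci * w) = Re w); last by Cre; ring. rewrite (_ : Re (Ci * w) = - Im w); last by Cre; ring.
  rewrite (_ : Im (- Ci * w) = - Re w); last by Cre; ring. rewrite (_ : Re (- Ci * w) = Im w); last by Cre; ring.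
  set m := Cmod w in m2 hm *. set u := Re w in h m2 *. set v := Im w in m2 hm *. rewrite /=.
  rewrite (_ : - u / (m + v) = - (u / (m + v))); last by field; lra.
  rewrite atan_opp (_ : u / (m + v) = / (u / (m + - v))).
  - rewrite atan_inv; last by apply: Rdiv_lt_0_compat; lra. field.
  - field_simplify_eq; [nra | repeat split; lra].
Qed.

Lemma Lup_Ldown_left w : Re w < 0 -> (Lup w - Ldown w)%C = (0, - PI).
Proof.
  move=> h. rewrite /Lup /Ldown !Log_eta Cmod_iu Cmod_iu'.
  have m2 := Cmod2 w. have hm : - Cmod w < Im w < Cmod w by apply: Im_lt_Cmod; lra.
  apply C_ext; first by Cre; ring.
  rewrite (_ : Im (Ci * w) = Re w); last by Cre; ring. rewrite (_ : Re (Ci * w) = - Im w); last by Cre; ring.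
  rewrite (_ : Im (- Ci * w) = - Re w); last by Cre; ring. rewrite (_ : Re (- Ci * w) = Im w); last by Cre; ring.
  set m := Cmod w in m2 hm *. set u := Re w in h m2 *. set v := Im w in m2 hm *. rewrite /=.
  rewrite (_ : u / (m + - v) = - (- u / (m + - v))); last by field; lra.
  rewrite atan_opp (_ : - u / (m + v) = / (- u / (m + - v))).
  - rewrite atan_inv; last by apply: Rdiv_lt_0_compat; lra. field.
  - field_simplify_eq; [nra | repeat split; lra].
Qed.

Definition C2pi : C := (0, 2 * PI).

Lemma C2pi_nz : C2pi <> RtoC 0.
Proof. move=> e. have := f_equal Im e. rewrite /=. have := PI_RGT_0. lra. Qed.

Lemma cder_inv_shift a z : z <> a -> cder (fun w => / (w - a))%C z (- 1 / ((z - a) * (z - a)))%C.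
Proof.
  move=> n. apply: (cder_eq _ _ (- (1 - 0) / ((z - a) * (z - a)))%C); last by field; exact: Cminus_nz.
  apply: (cder_inv (fun w => w - a)%C); last exact: Cminus_nz.
  apply: cder_minus; [exact: cder_id | exact: cder_const].
Qed.

Lemma ccont_inv_shift a z : z <> a -> ccont (fun w => / (w - a))%C z.
Proof. move=> n. exact: cder_cont (cder_inv_shift a z n). Qed.

(** The bottom side avoids the cut of [Lup] and the three others avoid that of [Ldown]; only the
    jumps between the branches at the two bottom corners survive, PI - (- PI). *)
Lemma winding_rect x1 x2 y1 y2 z : in_box x1 x2 y1 y2 z -> RectI (fun w => / (w - z))%C x1 x2 y1 y2 = C2pi.
Proof.
  move=> [hx hy].
  have nz : forall w, on_edge x1 x2 y1 y2 w -> w <> z by move=> w hw e; move: hw; rewrite e /on_edge; lra.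
  have cc : forall w, on_edge x1 x2 y1 y2 w -> ccont (fun w => / (w - z))%C w by move=> w hw; apply: ccont_inv_shift; exact: nz.
  have [h1 [h2 [h3 h4]]] := edge_conts _ x1 x2 y1 y2 ltac:(lra) ltac:(lra) cc.
  rewrite /RectI.
  rewrite (HI_prim (fun w => Lup (w - z))%C _ y1) //; last first.
  { move=> s hs. apply: (cder_shift Lup). apply: Lup_cder. left; Cre; lra. }
  rewrite (HI_prim (fun w => Ldown (w - z))%C _ y2) //; last first.
  { move=> s hs. apply: (cder_shift Ldown). apply: Ldown_cder. left; Cre; lra. }
  rewrite (VI_prim (fun w => Ldown (w - z))%C _ x1) //; last first.
  { move=> s hs. apply: (cder_shift Ldown). apply: Ldown_cder. right; Cre; lra. }
  rewrite (VI_prim (fun w => Ldown (w - z))%C _ x2) //; last first.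
  { move=> s hs. apply: (cder_shift Ldown). apply: Ldown_cder. right; Cre; lra. }
  transitivity ((Lup (pt x2 y1 - z) - Ldown (pt x2 y1 - z)) - (Lup (pt x1 y1 - z) - Ldown (pt x1 y1 - z)))%C; first by ring.
  rewrite Lup_Ldown_right; last by Cre; lra. rewrite Lup_Ldown_left; last by Cre; lra.
  apply C_ext; rewrite /=; ring.
Qed.

Lemma continuous_bounded (g : R -> C) a b : a <= b -> (forall s, a <= s <= b -> pcont g s) ->
  exists M, forall s, a <= s <= b -> Cmod (g s) <= M.
Proof.
  move=> ab h.
  have [s [hs _]] := continuity_ab_maj (fun s => Cmod (g s)) a b ab
    (fun c hc => proj2 (continuity_pt_filterlim _ _) (continuous_Cmod _ _ (h c hc))).
  by exists (Cmod (g s)).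
Qed.

Lemma edge_bounded q x1 x2 y1 y2 : x1 <= x2 -> y1 <= y2 ->
  (forall z, on_edge x1 x2 y1 y2 z -> ccont q z) ->
  exists M, 0 <= M /\ forall z, on_edge x1 x2 y1 y2 z -> Cmod (q z) <= M.
Proof.
  move=> hx hy h.
  have [M1 b1] := continuous_bounded (fun s => q (pt s y1)) x1 x2 hx (fun s hs => pcont_h q s y1 (h (pt s y1) ltac:(rewrite /on_edge /=; lra))).
  have [M2 b2] := continuous_bounded (fun s => q (pt s y2)) x1 x2 hx (fun s hs => pcont_h q s y2 (h (pt s y2) ltac:(rewrite /on_edge /=; lra))).
  have [M3 b3] := continuous_bounded (fun s => q (pt x1 s)) y1 y2 hy (fun s hs => pcont_v q x1 s (h (pt x1 s) ltac:(rewrite /on_edge /=; lra))).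
  have [M4 b4] := continuous_bounded (fun s => q (pt x2 s)) y1 y2 hy (fun s hs => pcont_v q x2 s (h (pt x2 s) ltac:(rewrite /on_edge /=; lra))).
  have c1 := Rle_trans _ _ _ (Cmod_ge_0 _) (b1 x1 ltac:(lra)). have c2 := Rle_trans _ _ _ (Cmod_ge_0 _) (b2 x1 ltac:(lra)).
  have c3 := Rle_trans _ _ _ (Cmod_ge_0 _) (b3 y1 ltac:(lra)). have c4 := Rle_trans _ _ _ (Cmod_ge_0 _) (b4 y1 ltac:(lra)).
  exists (M1 + M2 + M3 + M4). split; first lra.
  move=> z. rewrite (C_eta z) /on_edge /= => [[hr [hi]]].
  move=> [e|[e|[e|e]]]; rewrite e.
  - have := b3 _ hi. rewrite /pt. lra.
  - have := b4 _ hi. rewrite /pt. lra.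
  - have := b1 _ hr. rewrite /pt. lra.
  - have := b2 _ hr. rewrite /pt. lra.
Qed.

(** Removable singularity: by [goursat] only the boundary of a square of half-side h around z
    contributes, and there the integral is at most 16 M h. *)
Lemma punctured_rect q x1 x2 y1 y2 z M d : in_box x1 x2 y1 y2 z -> 0 < d ->
  (forall w, in_rect x1 x2 y1 y2 w -> w <> z -> cdiff q w) ->
  (forall w, w <> z -> Cmod (w - z) < d -> Cmod (q w) <= M) -> RectI q x1 x2 y1 y2 = RtoC 0.
Proof.
  move=> [hx hy] d0 hq hM.
  have M0 : 0 <= M.
  { apply: Rle_trans (Cmod_ge_0 (q (z + RtoC (d/2))%C)) (hM _ _ _).
    - move=> e. have := f_equal Re e. Cre. lra.
    - rewrite (_ : z + RtoC (d/2) - z = RtoC (d/2))%C; last by ring. rewrite Cmod_R Rabs_pos_eq; lra. }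
  apply: Cmod_eq_0. apply: Rle_antisym; last exact: Cmod_ge_0.
  apply: le_epsilon => eps e0. rewrite Rplus_0_l.
  have [m [m1 m2]] := box_margin x1 x2 y1 y2 z (conj hx hy).
  set h := Rmin (Rmin (d / 8) (eps / (16 * (M + 1)))) (m / 2).
  have e1 : 0 < eps / (16 * (M + 1)) by apply: Rdiv_lt_0_compat; lra.
  have h0 : 0 < h by rewrite /h; repeat apply: Rmin_glb_lt; lra.
  have hh : h <= d / 8 /\ h <= eps / (16 * (M + 1)) /\ h <= m / 2.
  { have a1 := Rmin_l (Rmin (d / 8) (eps / (16 * (M + 1)))) (m / 2). have a2 := Rmin_r (Rmin (d / 8) (eps / (16 * (M + 1)))) (m / 2).
    have a3 := Rmin_l (d / 8) (eps / (16 * (M + 1))). have a4 := Rmin_r (d / 8) (eps / (16 * (M + 1))). rewrite /h; lra. }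
  set a := Re z - h. set b := Re z + h. set c := Im z - h. set e := Im z + h.
  have qc : forall w, in_rect x1 x2 y1 y2 w -> w <> z -> ccont q w by move=> w h1 h2; apply: cdiff_cont; exact: hq.
  have za : forall w, (Re w <> Re z \/ Im w <> Im z) -> w <> z by move=> w [h1|h1] e'; apply: h1; rewrite e'.
  rewrite (RectI_split_x _ x1 a x2); [|rewrite /a; lra|lra|]; last first.
  { move=> w hw. apply: qc; first exact: in_rect_edge. apply: za. move: hw; rewrite /on_edge. lra. }
  rewrite (RectI_split_x _ a b x2); [|rewrite /a /b; lra|lra|]; last first.
  { move=> w hw. apply: qc; first by move: hw; rewrite /on_edge /in_rect /a /b; lra.
     apply: za. move: hw; rewrite /on_edge /a. lra. }
  rewrite (RectI_split_y _ a b y1 c y2); [|rewrite /a /b; lra|rewrite /c; lra|]; last first.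
  { move=> w hw. apply: qc; first by move: hw; rewrite /on_edge /in_rect /a /b; lra.
     apply: za. move: hw; rewrite /on_edge /a /b. lra. }
  rewrite (RectI_split_y _ a b c e y2); [|rewrite /a /b; lra|rewrite /c /e; lra|]; last first.
  { move=> w hw. apply: qc; first by move: hw; rewrite /on_edge /in_rect /a /b /c; lra.
     apply: za. move: hw; rewrite /on_edge /a /b /c. lra. }
  rewrite (goursat q x1 a y1 y2); [|rewrite /a; lra|lra|]; last first.
  { move=> w hw. apply: hq; first by move: hw; rewrite /in_rect /a; lra. apply: za; move: hw; rewrite /in_rect /a; lra. }
  rewrite (goursat q b x2 y1 y2); [|rewrite /b; lra|lra|]; last first.
  { move=> w hw. apply: hq; first by move: hw; rewrite /in_rect /b; lra. apply: za; move: hw; rewrite /in_rect /b; lra. }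
  rewrite (goursat q a b y1 c); [|rewrite /a /b; lra|rewrite /c; lra|]; last first.
  { move=> w hw. apply: hq; first by move: hw; rewrite /in_rect /a /b /c; lra. apply: za; move: hw; rewrite /in_rect /c; lra. }
  rewrite (goursat q a b e y2); [|rewrite /a /b; lra|rewrite /e; lra|]; last first.
  { move=> w hw. apply: hq; first by move: hw; rewrite /in_rect /a /b /e; lra. apply: za; move: hw; rewrite /in_rect /e; lra. }
  rewrite (_ : (_ + _)%C = RectI q a b c e); last by ring.
  have ab : a <= b by rewrite /a /b; lra. have ce : c <= e by rewrite /c /e; lra.
  apply: Rle_trans (RectI_bound q a b c e M ab ce _ _) _.
  - move=> w hw. apply: qc; first by move: hw; rewrite /on_edge /in_rect /a /b /c /e; lra.
    apply: za. move: hw; rewrite /on_edge /a /b /c /e. lra.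
  - move=> w hw. apply: hM.
    + apply: za. move: hw; rewrite /on_edge /a /b /c /e. lra.
    + have := Cmod_rect a b c e w z. have : in_rect a b c e z by rewrite /in_rect /a /b /c /e; lra.
      move=> i1 i2. have := i2 (in_rect_edge _ _ _ _ _ hw) i1. rewrite /a /b /c /e; lra.
  - rewrite /a /b /c /e.
    have : h * (16 * (M + 1)) <= eps.
    { have := Rmult_le_compat_r (16 * (M + 1)) _ _ ltac:(lra) (proj1 (proj2 hh)).
      rewrite /Rdiv Rmult_assoc Rinv_l; lra. }
    nra.
Qed.

Lemma slope_cder_off f a d w e : cder f w e -> w <> a -> cdiff (slope f a d) w.
Proof.
  move=> hf n. have nz := Cminus_nz _ _ n.
  have hh : cder (fun w => (f w - f a) * / (w - a))%C w ((e - 0) * / (w - a) + (f w - f a) * (- 1 / ((w - a) * (w - a))))%C.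
  { apply: (cder_mult (fun w => f w - f a)%C (fun w => / (w - a))%C).
    - apply: cder_minus => //. exact: cder_const.
    - exact: cder_inv_shift. }
  eexists. apply: cder_ext_loc hh.
  have hl : clocally w (fun v => v <> a).
  { apply: (filter_imp (fun v : C => (v - a)%C <> RtoC 0)).
    - move=> v hv e'. apply: hv. rewrite e'. Cring.
    - apply: (locally_nz (fun v : C_UniformSpace => (v - a)%C)) => //. apply: continuous_Cplus; [exact: continuous_id | exact: continuous_const]. }
  apply: filter_imp hl => v hv. rewrite /slope. by case: Ceq_dec.
Qed.

(** f w / (w - z) is the slope of f at z, which is bounded near z and so has integral 0, plus f z /
    (w - z). *)
Theorem cauchy_formula f x1 x2 y1 y2 z : in_box x1 x2 y1 y2 z ->
  (forall w, in_rect x1 x2 y1 y2 w -> cdiff f w) ->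
  RectI (fun w => f w * / (w - z))%C x1 x2 y1 y2 = (C2pi * f z)%C.
Proof.
  move=> hz hf. have [hx hy] := hz.
  have [d hd] : cdiff f z by apply: hf; rewrite /in_rect; lra.
  have hl := cder_eps_inv _ _ _ hd 1 Rlt_0_1.
  have /locally_Cmod [del [del0 hdel]] := hl.
  have nz : forall w, on_edge x1 x2 y1 y2 w -> w <> z by move=> w hw e; move: hw; rewrite e /on_edge; lra.
  have k := punctured_rect (slope f z d) x1 x2 y1 y2 z (1 + Cmod d) del hz del0.
  have {}k : RectI (slope f z d) x1 x2 y1 y2 = RtoC 0.
  { apply: k.
    - move=> w hw n. have [e he] := hf w hw. exact: slope_cder_off he n.
    - move=> w n hw. have := hdel w hw.
      rewrite (_ : f w - f z - d * (w - z) = (slope f z d w - d) * (w - z))%C; last by rewrite {1}(slope_eq f z d w); ring.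
      rewrite Cmod_mult => hm. have p0 := proj1 (Cmod_gt_0 _) (Cminus_nz _ _ n).
      have {}hm := Rmult_le_reg_r _ _ _ p0 hm.
      rewrite (_ : slope f z d w = (slope f z d w - d) + d)%C; last by ring.
      have := Cmod_triangle (slope f z d w - d) d. lra. }
  rewrite -(Cplus_0_r (RectI _ _ _ _ _)) -(Copp_0) -k.
  have c1 : forall w, on_edge x1 x2 y1 y2 w -> ccont (slope f z d) w.
  { move=> w hw. have [e he] := hf w (in_rect_edge _ _ _ _ _ hw). apply: cdiff_cont. exact: slope_cder_off he (nz w hw). }
  have c2 : forall w, on_edge x1 x2 y1 y2 w -> ccont (fun w => / (w - z))%C w.
  { move=> w hw. apply: ccont_inv_shift. exact: nz. }
  rewrite -(winding_rect _ _ _ _ _ hz) Cmult_comm -RectI_scal //; try lra.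
  rewrite (RectI_ext (fun w => f w * / (w - z))%C (fun w => slope f z d w + f z * / (w - z))%C); try lra.
  - rewrite RectI_plus //; try lra; first by ring.
    move=> w hw. apply: continuous_Cmult; [exact: continuous_const | exact: c2].
  - move=> w hw. rewrite {1}(slope_eq f z d w). field. apply: Cminus_nz. exact: nz.
Qed.

Lemma edge_dist x1 x2 y1 y2 z : in_box x1 x2 y1 y2 z ->
  exists d, 0 < d /\ forall w, on_edge x1 x2 y1 y2 w -> d <= Cmod (w - z).
Proof.
  move=> [hx hy].
  have [m [m1 m2]] := box_margin x1 x2 y1 y2 z (conj hx hy).
  exists m. split => // w [h1 [h2 h3]].
  have b1 := re_bounds (w - z). have b2 := im_bounds (w - z).
  have e1 : Re (w - z) = Re w - Re z by Cre; ring. have e2 : Im (w - z) = Im w - Im z by Cre; ring.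
  rewrite e1 in b1. rewrite e2 in b2.
  case: h3 => [e|[e|[e|e]]]; lra.
Qed.

Lemma RectI_kernel_cont (K : C -> C -> C) x1 x2 y1 y2 z del M : x1 <= x2 -> y1 <= y2 -> 0 < del -> 0 <= M ->
  (forall w u, Cmod (w - z) < del -> on_edge x1 x2 y1 y2 u -> ccont (K w) u) ->
  (forall w u, Cmod (w - z) < del -> on_edge x1 x2 y1 y2 u -> Cmod (K w u - K z u) <= M * Cmod (w - z)) ->
  ccont (fun w => RectI (K w) x1 x2 y1 y2) z.
Proof.
  move=> hx hy d0 M0 hc hM. apply/filterlim_locally => eps.
  set S := 4 * M * (x2 - x1 + (y2 - y1)).
  have S0 : 0 <= S by rewrite /S; nra.
  have e0 : 0 < eps by case: eps.
  have h0 : 0 < Rmin del (eps / (S + 1)) by apply: Rmin_glb_lt => //; apply: Rdiv_lt_0_compat; lra.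
  apply/locally_Cmod. exists (Rmin del (eps / (S + 1))). split => // w hw.
  have w1 : Cmod (w - z) < del by have := Rmin_l del (eps / (S + 1)); lra.
  have w2 : Cmod (w - z) < eps / (S + 1) by have := Rmin_r del (eps / (S + 1)); lra.
  apply: C_NormedModule_mixin_compat1. rewrite /minus /plus /opp /=.
  have zz : Cmod (z - z) < del by rewrite (_ : z - z = 0)%C ?Cmod_0 //; ring.
  have -> : (RectI (K w) x1 x2 y1 y2 + - RectI (K z) x1 x2 y1 y2)%C = RectI (fun u => K w u + (-1) * K z u)%C x1 x2 y1 y2.
  { rewrite RectI_plus //; first last.
    - move=> u hu. apply: continuous_Cmult; [exact: continuous_const | exact: hc].
    - move=> u hu. exact: hc.
    - rewrite RectI_scal //; first by ring. move=> u hu. exact: hc. }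
  have hle : Cmod (RectI (fun u => K w u + (-1) * K z u)%C x1 x2 y1 y2) <= 4 * (M * Cmod (w - z)) * (x2 - x1 + (y2 - y1)).
  { apply: RectI_bound => // u hu.
    - apply: continuous_Cplus; first exact: hc. apply: continuous_Cmult; [exact: continuous_const | exact: hc].
    - rewrite (_ : (K w u + (-1) * K z u = K w u - K z u)%C); last by ring. exact: hM. }
  apply: Rle_lt_trans hle _.
  rewrite (_ : 4 * (M * Cmod (w - z)) * (x2 - x1 + (y2 - y1)) = S * Cmod (w - z)); last by rewrite /S; ring.
  have : (S + 1) * Cmod (w - z) < eps.
  { have := Rmult_lt_compat_r (S + 1) _ _ ltac:(lra) w2. rewrite /Rdiv Rmult_assoc Rinv_l; lra. }
  have := Cmod_ge_0 (w - z). lra.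
Qed.

(** * Cauchy transforms of continuous functions on the boundary of a rectangle *)

Section CauchyTransform.
Variables x1 x2 y1 y2 : R.
Notation edge := (on_edge x1 x2 y1 y2).
Notation box := (in_box x1 x2 y1 y2).
Notation I q := (RectI q x1 x2 y1 y2).

Lemma box_le z : box z -> x1 <= x2 /\ y1 <= y2.
Proof. rewrite /in_box; lra. Qed.

Lemma edge_ne z w : box z -> edge w -> w <> z.
Proof. move=> h1 h2 e. move: h1 h2. rewrite e /in_box /on_edge. lra. Qed.

Lemma near_edge z : box z -> exists d, 0 < d /\
  (forall w, Cmod (w - z) < d -> box w) /\
  (forall w u, Cmod (w - z) < d -> edge u -> Cmod (/ (u - w)) <= / d /\
     Cmod (/ (u - w) - / (u - z)) <= / d * / d * Cmod (w - z)).
Proof.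
  move=> hz. have [d [d0 hd]] := edge_dist _ _ _ _ _ hz.
  have /locally_Cmod [e [e0 he]] := in_box_locally _ _ _ _ _ hz.
  have m0 : 0 < Rmin (d / 2) e by apply: Rmin_glb_lt; lra.
  have m1 := Rmin_l (d / 2) e. have m2 := Rmin_r (d / 2) e.
  exists (Rmin (d / 2) e). set m := Rmin (d / 2) e in m0 m1 m2 *. split => //.
  have inb : forall w, Cmod (w - z) < m -> box w by move=> w hw; apply: he; lra.
  split => // w u hw hu.
  have lb : forall w, Cmod (w - z) < m -> Cmod (/ (u - w)) <= / m.
  { move=> {hw}w hw. rewrite Cmod_inv; last by apply: Cminus_nz; apply: edge_ne => //; exact: inb.
    apply: Rinv_le_contravar => //.
    have := hd u hu. have := Cmod_triangle (u - w) (w - z). rewrite (_ : u - w + (w - z) = u - z)%C; last by ring. lra. }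
  have zz : Cmod (z - z) < m by rewrite (_ : z - z = 0)%C ?Cmod_0 //; ring.
  split; first exact: lb.
  have n1 : (u - w)%C <> 0 by apply: Cminus_nz; apply: edge_ne => //; exact: inb.
  have n2 : (u - z)%C <> 0 by apply: Cminus_nz; apply: edge_ne.
  rewrite (_ : / (u - w) - / (u - z) = / (u - w) * / (u - z) * (w - z))%C; last by field.
  rewrite !Cmod_mult. apply: Rmult_le_compat_r; first exact: Cmod_ge_0.
  apply: Rmult_le_compat; try exact: Cmod_ge_0; exact: lb.
Qed.

Variable psi : C -> C.
Hypothesis psi_cont : forall u, edge u -> ccont psi u.

Lemma ker_cont w u : box w -> edge u -> ccont (fun u => / (u - w))%C u.
Proof. move=> hw hu. apply: ccont_inv_shift. exact: edge_ne. Qed.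

Lemma cauchy1_cont z : box z -> ccont (fun w => I (fun u => psi u * / (u - w))%C) z.
Proof.
  move=> hz. have [hx hy] := box_le _ hz. have [d [d0 [hd1 hd2]]] := near_edge z hz.
  have [M [M0 hM]] := edge_bounded psi _ _ _ _ hx hy psi_cont.
  have di : 0 <= / d by left; apply: Rinv_0_lt_compat.
  apply: (RectI_kernel_cont (fun w u => psi u * / (u - w))%C _ _ _ _ z d (M * (/ d * / d))) => //.
  - by repeat apply: Rmult_le_pos.
  - move=> w u hw hu. apply: continuous_Cmult; first exact: psi_cont. apply: ker_cont => //; exact: hd1.
  - move=> w u hw hu. rewrite (_ : psi u * / (u - w) - psi u * / (u - z) = psi u * (/ (u - w) - / (u - z)))%C; last by ring.
    rewrite Cmod_mult Rmult_assoc. apply: Rmult_le_compat; try exact: Cmod_ge_0; first exact: hM. exact: (proj2 (hd2 w u hw hu)).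
Qed.

Lemma cauchy2_cont z : box z -> ccont (fun w => I (fun u => psi u * (/ (u - w) * / (u - w)))%C) z.
Proof.
  move=> hz. have [hx hy] := box_le _ hz. have [d [d0 [hd1 hd2]]] := near_edge z hz.
  have [M [M0 hM]] := edge_bounded psi _ _ _ _ hx hy psi_cont.
  have di : 0 <= / d by left; apply: Rinv_0_lt_compat.
  have zz : Cmod (z - z) < d by rewrite (_ : z - z = 0)%C ?Cmod_0 //; ring.
  apply: (RectI_kernel_cont (fun w u => psi u * (/ (u - w) * / (u - w)))%C _ _ _ _ z d (M * ((/ d * / d) * (/ d + / d)))) => //.
  - repeat apply: Rmult_le_pos => //; lra.
  - move=> w u hw hu. apply: continuous_Cmult; first exact: psi_cont. apply: continuous_Cmult; apply: ker_cont => //; exact: hd1.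
  - move=> w u hw hu.
    rewrite (_ : psi u * (/ (u - w) * / (u - w)) - psi u * (/ (u - z) * / (u - z)) =
       psi u * ((/ (u - w) - / (u - z)) * (/ (u - w) + / (u - z))))%C; last by ring.
    rewrite Cmod_mult Rmult_assoc. apply: Rmult_le_compat; try exact: Cmod_ge_0; first exact: hM.
    rewrite Cmod_mult Rmult_assoc (Rmult_comm (/ d + / d)) -Rmult_assoc. apply: Rmult_le_compat; try exact: Cmod_ge_0; first exact: (proj2 (hd2 w u hw hu)).
    apply: Rle_trans (Cmod_triangle _ _) _. have := proj1 (hd2 w u hw hu). have := proj1 (hd2 z u zz hu). lra.
Qed.

End CauchyTransform.

Section CauchyTransform2.
Variables x1 x2 y1 y2 : R.
Notation edge := (on_edge x1 x2 y1 y2).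
Notation box := (in_box x1 x2 y1 y2).
Notation I q := (RectI q x1 x2 y1 y2).
Variable psi : C -> C.
Hypothesis psi_cont : forall u, edge u -> ccont psi u.

Lemma psi1_cont z : box z -> forall u, edge u -> ccont (fun u => psi u * / (u - z))%C u.
Proof. move=> hz u hu. apply: continuous_Cmult; [exact: psi_cont | exact: (ker_cont _ _ _ _ _ _ hz hu)]. Qed.

(** The slope at z of the transform of psi is the transform of psi / (u - z), hence continuous. The
    density is an arbitrary continuous function precisely so that this one is covered as well. *)
Lemma cauchy1_cder z : box z ->
  cder (fun w => I (fun u => psi u * / (u - w))%C) z (I (fun u => psi u * (/ (u - z) * / (u - z)))%C).
Proof.
  move=> hz. have [hx hy] := box_le _ _ _ _ _ hz.
  apply: (cder_intro _ (fun w => I (fun u => (psi u * / (u - z)) * / (u - w))%C)).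
  - apply: cauchy1_cont => // u hu. exact: psi1_cont.
  - apply: RectI_ext => // u hu. ring.
  - apply: filter_imp (in_box_locally _ _ _ _ _ hz) => w hw.
    rewrite Cmult_comm -RectI_scal // -?RectI_plus //.
    + apply: RectI_ext => // u hu. field. split; apply: Cminus_nz; exact: (edge_ne _ _ _ _ _ _ _ hu).
    + move=> u hu. exact: psi1_cont.
    + move=> u hu. apply: continuous_Cmult; first exact: continuous_const.
      apply: continuous_Cmult; [exact: psi1_cont | exact: (ker_cont _ _ _ _ _ _ hw hu)].
    + move=> u hu. apply: continuous_Cmult; [exact: psi1_cont | exact: (ker_cont _ _ _ _ _ _ hw hu)].
Qed.

Lemma cauchy2_cdiff z : box z -> cdiff (fun w => I (fun u => psi u * (/ (u - w) * / (u - w)))%C) z.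
Proof.
  move=> hz. have [hx hy] := box_le _ _ _ _ _ hz.
  have p2 : forall u, edge u -> ccont (fun u => psi u * (/ (u - z) * / (u - z)))%C u.
  { move=> u hu. apply: continuous_Cmult; first exact: psi_cont. apply: continuous_Cmult; exact: (ker_cont _ _ _ _ _ _ hz hu). }
  eexists. apply: (cder_intro _ (fun w => I (fun u => (psi u * / (u - z)) * (/ (u - w) * / (u - w)))%C +
      I (fun u => (psi u * (/ (u - z) * / (u - z))) * / (u - w))%C)%C); [|reflexivity|].
  - apply: continuous_Cplus; [apply: cauchy2_cont => // u hu; exact: psi1_cont | exact: cauchy1_cont].
  - apply: filter_imp (in_box_locally _ _ _ _ _ hz) => w hw.
    have k : forall u, edge u -> ccont (fun u => / (u - w))%C u by move=> u hu; exact: (ker_cont _ _ _ _ _ _ hw hu).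
    have k2 : forall u, edge u -> ccont (fun u => / (u - w) * / (u - w))%C u by move=> u hu; apply: continuous_Cmult; exact: k.
    have A : forall u, edge u -> ccont (fun u => (psi u * / (u - z)) * (/ (u - w) * / (u - w)))%C u.
    { move=> u hu. apply: continuous_Cmult; [exact: psi1_cont | exact: k2]. }
    have B : forall u, edge u -> ccont (fun u => (psi u * (/ (u - z) * / (u - z))) * / (u - w))%C u.
    { move=> u hu. apply: continuous_Cmult; [exact: p2 | exact: k]. }
    have AB : forall u, edge u -> ccont (fun u => (psi u * / (u - z)) * (/ (u - w) * / (u - w)) + (psi u * (/ (u - z) * / (u - z))) * / (u - w))%C u.
    { move=> u hu. apply: continuous_Cplus; [exact: A | exact: B]. }
    rewrite -RectI_plus // Cmult_comm -RectI_scal // -?RectI_plus //.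
    + apply: RectI_ext => // u hu. field. split; apply: Cminus_nz; exact: (edge_ne _ _ _ _ _ _ _ hu).
    + move=> u hu. apply: continuous_Cmult; [exact: continuous_const | exact: AB].
Qed.

End CauchyTransform2.

(** * Holomorphy of derivatives and difference quotients *)

Definition cdiff_near (f : C -> C) (z : C) := clocally z (cdiff f).

Lemma good_rect (f : C -> C) z : cdiff_near f z -> exists x1 x2 y1 y2, in_box x1 x2 y1 y2 z /\ forall w, in_rect x1 x2 y1 y2 w -> cdiff f w.
Proof.
  move=> /locally_Cmod [d [d0 hd]].
  exists (Re z - d/4), (Re z + d/4), (Im z - d/4), (Im z + d/4). split; first by rewrite /in_box; lra.
  move=> w [h1 h2]. apply: hd. apply: Rle_lt_trans (Cmod_ReIm _) _.
  have : Rabs (Re (w - z)) <= d/4 by apply: Rabs_le; Cre; lra.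
  have : Rabs (Im (w - z)) <= d/4 by apply: Rabs_le; Cre; lra. lra.
Qed.

Lemma cauchy_formula' f x1 x2 y1 y2 z : in_box x1 x2 y1 y2 z ->
  (forall w, in_rect x1 x2 y1 y2 w -> cdiff f w) ->
  f z = (/ C2pi * RectI (fun w => f w * / (w - z))%C x1 x2 y1 y2)%C.
Proof. move=> hz hf. rewrite cauchy_formula //. field. exact: C2pi_nz. Qed.

Theorem derive_cdiff f z : cdiff_near f z -> cdiff (C_derive f) z.
Proof.
  move=> /good_rect [x1 [x2 [y1 [y2 [hz hf]]]]].
  have fc : forall u, on_edge x1 x2 y1 y2 u -> ccont f u by move=> u hu; apply: cdiff_cont; apply: hf; exact: in_rect_edge.
  have [d hd] := cauchy2_cdiff _ _ _ _ f fc z hz.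
  exists (/ C2pi * d)%C. apply: (cder_ext_loc (fun w => / C2pi * RectI (fun u => f u * (/ (u - w) * / (u - w)))%C x1 x2 y1 y2)%C).
  - apply: filter_imp (in_box_locally _ _ _ _ _ hz) => w hw. symmetry. apply: cder_C_derive.
    apply: (cder_ext_loc (fun w => / C2pi * RectI (fun u => f u * / (u - w))%C x1 x2 y1 y2)%C).
    + apply: filter_imp (in_box_locally _ _ _ _ _ hw) => v hv. symmetry. exact: cauchy_formula'.
    + apply: cder_scal. exact: cauchy1_cder.
  - exact: cder_scal.
Qed.

(** By Cauchy's formula the difference quotient is the Cauchy transform of f u / (u - z), at w = z
    as well, where the transform is the derivative. This avoids power series: zeros are divided out
    with it, and [oint_inv] applies it to the slope of W. *)
Theorem slope_cdiff f z d : cdiff_near f z -> cder f z d -> cdiff (slope f z d) z.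
Proof.
  move=> /good_rect [x1 [x2 [y1 [y2 [hz hf]]]]] hd. have [hx hy] := box_le _ _ _ _ _ hz.
  have fc : forall u, on_edge x1 x2 y1 y2 u -> ccont f u by move=> u hu; apply: cdiff_cont; apply: hf; exact: in_rect_edge.
  have fc1 := psi1_cont _ _ _ _ f fc z hz.
  have hd' : cder f z (/ C2pi * RectI (fun u => f u * (/ (u - z) * / (u - z)))%C x1 x2 y1 y2)%C.
  { apply: (cder_ext_loc (fun w => / C2pi * RectI (fun u => f u * / (u - w))%C x1 x2 y1 y2)%C).
    + apply: filter_imp (in_box_locally _ _ _ _ _ hz) => v hv. symmetry. exact: cauchy_formula'.
    + apply: cder_scal. exact: cauchy1_cder. }
  have ed := cder_unique _ _ _ _ hd hd'.
  exists (/ C2pi * RectI (fun u => (f u * / (u - z)) * (/ (u - z) * / (u - z)))%C x1 x2 y1 y2)%C.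
  apply: (cder_ext_loc (fun w => / C2pi * RectI (fun u => (f u * / (u - z)) * / (u - w))%C x1 x2 y1 y2)%C).
  - apply: filter_imp (in_box_locally _ _ _ _ _ hz) => w hw. rewrite /slope. case: Ceq_dec => [->|n].
    + rewrite ed. congr (_ * _)%C. apply: RectI_ext => // u hu. ring.
    + rewrite (cauchy_formula' f x1 x2 y1 y2 w) // (cauchy_formula' f x1 x2 y1 y2 z) //.
      have -> : RectI (fun u => f u * / (u - w))%C x1 x2 y1 y2 = (RectI (fun u => f u * / (u - z))%C x1 x2 y1 y2 + (w - z) * RectI (fun u => f u * / (u - z) * / (u - w))%C x1 x2 y1 y2)%C.
      { rewrite -RectI_scal // -?RectI_plus //.
        + apply: RectI_ext => // u hu. field. split; apply: Cminus_nz; exact: (edge_ne _ _ _ _ _ _ _ hu).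
        + move=> u hu. apply: continuous_Cmult; first exact: continuous_const.
          apply: continuous_Cmult; [exact: fc1 | exact: (ker_cont _ _ _ _ _ _ hw hu)].
        + move=> u hu. apply: continuous_Cmult; [exact: fc1 | exact: (ker_cont _ _ _ _ _ _ hw hu)]. }
      field. repeat split; first [exact: C2pi_nz | exact: Cminus_nz].
  - apply: cder_scal. exact: cauchy1_cder.
Qed.

(** * The identity theorem *)

Lemma box_near f x1 x2 y1 y2 z : (forall z, in_box x1 x2 y1 y2 z -> cdiff f z) -> in_box x1 x2 y1 y2 z -> cdiff_near f z.
Proof. move=> hf hz. apply: filter_imp (in_box_locally _ _ _ _ _ hz) => w hw. exact: hf. Qed.

Lemma cdiff_mult f g z : cdiff f z -> cdiff g z -> cdiff (fun w => f w * g w)%C z.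
Proof. move=> [a ha] [b hb]. eexists. apply: cder_mult; eassumption. Qed.
Lemma cdiff_plus f g z : cdiff f z -> cdiff g z -> cdiff (fun w => f w + g w)%C z.
Proof. move=> [a ha] [b hb]. eexists. apply: cder_plus; eassumption. Qed.
Lemma cdiff_inv f z : cdiff f z -> f z <> RtoC 0 -> cdiff (fun w => / f w)%C z.
Proof. move=> [a ha] nz. eexists. apply: cder_inv; eassumption. Qed.
Lemma cdiff_const c z : cdiff (fun _ => c) z.
Proof. eexists. exact: cder_const. Qed.
Lemma cdiff_id z : cdiff (fun w => w) z.
Proof. eexists. exact: cder_id. Qed.
Lemma cdiff_shift a z : cdiff (fun w => w - a)%C z.
Proof. eexists. apply: cder_minus; [exact: cder_id | exact: cder_const]. Qed.
Lemma cdiff_pow f n z : cdiff f z -> cdiff (fun w => f w ^ n)%C z.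
Proof.
  move=> h. elim: n => [|n IH]; first exact: cdiff_const. exact: cdiff_mult.
Qed.
Lemma cdiff_ext_loc f g z : clocally z (fun w => f w = g w) -> cdiff f z -> cdiff g z.
Proof. move=> h [d hd]. exists d. exact: cder_ext_loc hd. Qed.

Section Factor.
Variables X1 X2 Y1 Y2 : R.
Notation Om := (in_box X1 X2 Y1 Y2).
Definition holo (f : C -> C) := forall z, Om z -> cdiff f z.

Lemma holo_slope f a : holo f -> Om a -> holo (slope f a (C_derive f a)).
Proof.
  move=> hf ha z hz. case: (Ceq_dec z a) => [->|n].
  - have [d hd] := hf a ha. rewrite (cder_C_derive _ _ _ hd). apply: slope_cdiff => //. exact: box_near hf ha.
  - have [e he] := hf z hz. exact: slope_cder_off he n.
Qed.

Lemma divide_root f a : holo f -> Om a -> f a = RtoC 0 -> exists g, holo g /\ forall z, f z = ((z - a) * g z)%C.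
Proof.
  move=> hf ha h0. exists (slope f a (C_derive f a)). split; first exact: holo_slope.
  move=> z. rewrite {1}(slope_eq f a (C_derive f a) z) h0. ring.
Qed.

Definition ord_fin f a := exists k g, holo g /\ g a <> RtoC 0 /\ forall z, f z = ((z - a) ^ k * g z)%C.
Definition flat f a := forall N, exists g, holo g /\ forall z, f z = ((z - a) ^ N * g z)%C.

(** If the order is not finite, each quotient by (z - a)^N vanishes at a and can be divided once
    more. Divisibility by all powers plays the role of the vanishing of all Taylor coefficients. *)
Lemma ord_or_flat f a : holo f -> Om a -> ord_fin f a \/ flat f a.
Proof.
  move=> hf ha. case: (classic (ord_fin f a)) => ho; [by left | right].
  elim => [|N [g [hg eg]]]; first by exists f; split => // z; rewrite /=; ring.
  case: (classic (g a = RtoC 0)) => g0.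
  - have [g' [hg' eg']] := divide_root g a hg ha g0. exists g'. split => // z. rewrite eg eg' /=. ring.
  - exfalso. apply: ho. by exists N, g.
Qed.

(** If |f| <= M on the boundary of the square of half-side s around a, the quotient by (z - a)^N is
    at most M / s^N there. Cauchy's formula carries this to |z - a| < s/2 up to a constant factor,
    so that |f z| is at most a constant times 2^-N for every N. *)
Lemma flat_zero f a s : holo f -> 0 < s -> X1 < Re a - s -> Re a + s < X2 -> Y1 < Im a - s -> Im a + s < Y2 ->
  flat f a -> forall z, Cmod (z - a) < s / 2 -> f z = RtoC 0.
Proof.
  move=> hf s0 b1 b2 b3 b4 hflat z hz.
  set x1 := Re a - s. set x2 := Re a + s. set y1 := Im a - s. set y2 := Im a + s.
  have inO : forall w, in_rect x1 x2 y1 y2 w -> Om w by move=> w; rewrite /in_rect /in_box /x1 /x2 /y1 /y2; lra.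
  have hx : x1 <= x2 by rewrite /x1 /x2; lra. have hy : y1 <= y2 by rewrite /y1 /y2; lra.
  have fc : forall u, on_edge x1 x2 y1 y2 u -> ccont f u by move=> u hu; apply: cdiff_cont; apply: hf; apply: inO; exact: in_rect_edge.
  have [M [M0 hM]] := edge_bounded f _ _ _ _ hx hy fc.
  have hz1 := re_bounds (z - a). have hz2 := im_bounds (z - a).
  have inz : in_box x1 x2 y1 y2 z.
  { rewrite /in_box /x1 /x2 /y1 /y2. Cre. lra. }
  have ed : forall u, on_edge x1 x2 y1 y2 u -> s <= Cmod (u - a).
  { move=> u [_ [_ h]]. have k1 := re_bounds (u - a). have k2 := im_bounds (u - a).
    have e1 : Re (u - a) = Re u - Re a by Cre; ring. have e2 : Im (u - a) = Im u - Im a by Cre; ring.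
    rewrite e1 in k1. rewrite e2 in k2. rewrite /x1 /x2 /y1 /y2 in h.
    case: h => [e|[e|[e|e]]]; lra. }
  set K := Cmod (/ C2pi) * (4 * (M * (2 / s)) * (4 * s)).
  have key : forall N, Cmod (f z) <= K * (1 / 2) ^ N.
  { move=> N. have [g [hg eg]] := hflat N.
    have hgR : forall w, in_rect x1 x2 y1 y2 w -> cdiff g w by move=> w hw; apply: hg; exact: inO.
    have sN : 0 < s ^ N by apply: pow_lt.
    have g1 : Cmod (g z) <= Cmod (/ C2pi) * (4 * (M / s ^ N * (2 / s)) * (4 * s)).
    { rewrite (cauchy_formula' g x1 x2 y1 y2 z inz hgR) Cmod_mult. apply: Rmult_le_compat_l; first exact: Cmod_ge_0.
      rewrite (_ : 4 * s = x2 - x1 + (y2 - y1)); last by rewrite /x1 /x2 /y1 /y2; ring.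
      apply: RectI_bound => // u hu.
      - apply: continuous_Cmult; first by apply: cdiff_cont; apply: hgR; exact: in_rect_edge.
        exact: (ker_cont _ _ _ _ _ _ inz hu).
      - rewrite Cmod_mult. have hu' := ed u hu. apply: Rmult_le_compat; try exact: Cmod_ge_0.
        + have := hM u hu. rewrite eg Cmod_mult Cmod_pow => h.
          apply: (Rmult_le_reg_l (s ^ N)) => //. rewrite (_ : s ^ N * (M / s ^ N) = M); last by field; lra.
          apply: Rle_trans h. apply: Rmult_le_compat_r; first exact: Cmod_ge_0. apply: pow_incr. lra.
        + rewrite Cmod_inv; last by apply: Cminus_nz; exact: (edge_ne _ _ _ _ _ _ inz hu).
          rewrite (_ : 2 / s = / (s / 2)); last by field; lra.
          apply: Rinv_le_contravar; first lra.
          have := Cmod_triangle (u - z) (z - a). rewrite (_ : u - z + (z - a) = u - a)%C; last by ring. lra. }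
    rewrite eg Cmod_mult Cmod_pow.
    have zp : Cmod (z - a) ^ N <= (s / 2) ^ N by apply: pow_incr; split; [exact: Cmod_ge_0 | lra].
    apply: Rle_trans (Rmult_le_compat _ _ _ _ (pow_le _ _ (Cmod_ge_0 _)) (Cmod_ge_0 _) zp g1) _.
    right. rewrite /K (_ : (s / 2) ^ N = s ^ N * (1 / 2) ^ N); last by rewrite -Rpow_mult_distr; congr pow; field.
    field. lra. }
  have K0 : 0 <= K by have := key O; rewrite /= Rmult_1_r; have := Cmod_ge_0 (f z); lra.
  apply: Cmod_eq_0. apply: Rle_antisym; last exact: Cmod_ge_0.
  apply: le_epsilon => eps e0. rewrite Rplus_0_l.
  have e1 : 0 < eps / (K + 1) by apply: Rdiv_lt_0_compat; lra.
  have [N hN] := halving_small 1 _ e1.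
  apply: Rle_trans (key N) _.
  rewrite (_ : (1 / 2) ^ N = 1 / 2 ^ N); last by rewrite /Rdiv !Rmult_1_l pow_inv.
  have e3 : eps / (K + 1) * (K + 1) = eps by field; lra.
  have p1 : 0 <= 1 / 2 ^ N by apply: Rmult_le_pos; [lra | left; apply: Rinv_0_lt_compat; apply: pow_lt; lra].
  nra.
Qed.

Lemma zero_flat f a r : holo f -> 0 < r -> (forall z, Cmod (z - a) < r -> f z = RtoC 0) -> flat f a.
Proof.
  move=> hf r0 h0 N. exists (fun z => f z * / (z - a) ^ N)%C. split.
  - move=> z hz. case: (Ceq_dec z a) => [->|n].
    + apply: (cdiff_ext_loc (fun _ => RtoC 0)); last exact: cdiff_const.
      apply/locally_Cmod. exists r. split => // w hw. rewrite h0 //. Cring.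
    + apply: cdiff_mult; first exact: hf. apply: cdiff_inv; last by apply: Cpow_nz; exact: Cminus_nz.
      apply: cdiff_pow. exact: cdiff_shift.
  - move=> z. case: (Ceq_dec z a) => [->|n].
    + rewrite h0; first ring. rewrite (_ : a - a = 0)%C ?Cmod_0 //; ring.
    + field. apply: Cpow_nz. exact: Cminus_nz.
Qed.

(** Continuation along the segment from a to b: by convexity a square of half-side s around each of
    its points fits into the box, and flatness passes from [p j] to [p (S j)], whose distance is
    less than s/2. *)
Lemma identity_theorem f a b : holo f -> Om a -> Om b -> flat f a -> f b = RtoC 0.
Proof.
  move=> hf [a1 a2] [b1 b2] hfl.
  have [ma [ma0 hma]] := box_margin X1 X2 Y1 Y2 a (conj a1 a2).
  have [mb [mb0 hmb]] := box_margin X1 X2 Y1 Y2 b (conj b1 b2).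
  set s := Rmin ma mb / 2.
  have [s0 hs] : 0 < s /\ (s < Re a - X1 /\ s < X2 - Re a /\ s < Im a - Y1 /\ s < Y2 - Im a) /\
     (s < Re b - X1 /\ s < X2 - Re b /\ s < Im b - Y1 /\ s < Y2 - Im b).
  { have k1 := Rmin_l ma mb. have k2 := Rmin_r ma mb. have k3 := Rmin_glb_lt _ _ _ ma0 mb0. rewrite /s; lra. }
  have [n hn] := INR_unbounded (Cmod (b - a) / (s / 2)).
  have n0 : 0 < INR n.
  { apply: Rle_lt_trans hn. apply: Rmult_le_pos; first exact: Cmod_ge_0. left; apply: Rinv_0_lt_compat; lra. }
  set p := fun j : nat => (a + RtoC (INR j / INR n) * (b - a))%C.
  have hp : forall j, (j <= n)%nat -> flat f (p j).
  { elim => [|j IH] hj.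
    - rewrite /p (_ : a + RtoC (INR 0 / INR n) * (b - a) = a)%C //. rewrite /= /Rdiv Rmult_0_l. ring.
    - have hj' : (j <= n)%nat by lia. have {}IH := IH hj'.
      have t0 : 0 <= INR j / INR n <= 1.
      { have := pos_INR j. have := le_INR _ _ hj'. move=> h1 h2. split; first by apply: Rmult_le_pos => //; left; exact: Rinv_0_lt_compat.
        apply: (Rmult_le_reg_r (INR n)) => //. rewrite /Rdiv Rmult_assoc Rinv_l; lra. }
      have rp : Re (p j) = Re a + INR j / INR n * (Re b - Re a) by rewrite /p; Cre; ring.
      have ip : Im (p j) = Im a + INR j / INR n * (Im b - Im a) by rewrite /p; Cre; ring.
      have z := flat_zero f (p j) s hf s0.
      have {}z : forall z, Cmod (z - p j) < s / 2 -> f z = RtoC 0.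
      { have cv : forall t u v L, 0 <= t <= 1 -> L < u -> L < v -> L < u + t * (v - u).
        { move=> t u v L [t1 t2] h1 h2. rewrite (_ : u + t * (v - u) = (1 - t) * u + t * v); last by ring.
          have q1 : (1 - t) * L <= (1 - t) * u by apply: Rmult_le_compat_l; lra.
          have q2 : t * L <= t * v by apply: Rmult_le_compat_l; lra.
          case: (Req_dec t 0) => [->|tn]; first lra.
          have : t * L < t * v by apply: Rmult_lt_compat_l; lra. lra. }
        have c1 := cv _ (Re a) (Re b) (X1 + s) t0 ltac:(lra) ltac:(lra). have c2 := cv _ (- Re a) (- Re b) (s - X2) t0 ltac:(lra) ltac:(lra).
        have c3 := cv _ (Im a) (Im b) (Y1 + s) t0 ltac:(lra) ltac:(lra). have c4 := cv _ (- Im a) (- Im b) (s - Y2) t0 ltac:(lra) ltac:(lra).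
        apply: z => //; rewrite ?rp ?ip; lra. }
      have hd : Cmod (p (S j) - p j) < s / 2.
      { rewrite (_ : p (S j) - p j = RtoC (/ INR n) * (b - a))%C.
        - rewrite Cmod_mult Cmod_R Rabs_pos_eq; last by left; exact: Rinv_0_lt_compat.
          apply: (Rmult_lt_reg_l (INR n)) => //. rewrite -Rmult_assoc Rinv_r; last lra.
          have := Rmult_lt_compat_r (s / 2) _ _ ltac:(lra) hn. rewrite /Rdiv Rmult_assoc Rinv_l; lra.
        - rewrite /p S_INR (_ : (INR j + 1) / INR n = INR j / INR n + / INR n); last by field; lra.
          rewrite RtoC_plus. ring. }
      apply: (zero_flat f _ (s / 2 - Cmod (p (S j) - p j))) => //; first lra.
      move=> w hw. apply: z. have := Cmod_triangle (w - p (S j)) (p (S j) - p j).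
      rewrite (_ : w - p (S j) + (p (S j) - p j) = w - p j)%C; last by ring. lra. }
  have pe : p n = b.
  { rewrite /p (_ : INR n / INR n = 1); [ring | field; lra]. }
  have h := hp n (le_n _). rewrite pe in h.
  have [g [_ eg]] := h 1%nat. rewrite eg. rewrite /=. ring.
Qed.
End Factor.

(** * Zeros in a rectangle and their number *)

Definition prodl (l : list C) (z : C) : C := fold_right (fun a acc => ((z - a) * acc)%C) (RtoC 1) l.

Lemma prodl_app l1 l2 z : prodl (l1 ++ l2) z = (prodl l1 z * prodl l2 z)%C.
Proof. elim: l1 => [|a l1 IH] /=; [ring | rewrite IH; ring]. Qed.

Lemma prodl_repeat a k z : prodl (repeat a k) z = ((z - a) ^ k)%C.
Proof. elim: k => [|k IH] //=. by rewrite IH. Qed.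

Lemma prodl_neq0 l z : ~ In z l -> prodl l z <> RtoC 0.
Proof.
  elim: l => [|a l IH] h /=; first by move=> e; have := f_equal Re e; rewrite /=; lra.
  apply: Cmult_neq_0.
  - apply: Cminus_nz => e. apply: h. by left.
  - apply: IH => hi. apply: h. by right.
Qed.

Lemma isolated_zero X1 X2 Y1 Y2 f a b : holo X1 X2 Y1 Y2 f -> in_box X1 X2 Y1 Y2 a -> in_box X1 X2 Y1 Y2 b -> f b <> RtoC 0 ->
  exists d, 0 < d /\ forall z, Cmod (z - a) < d -> f z = RtoC 0 -> z = a.
Proof.
  move=> hf ha hb fb.
  case: (ord_or_flat _ _ _ _ f a hf ha) => [[k [g [hg [ga eg]]]]|hfl]; last by case: fb; exact: (identity_theorem _ _ _ _ f a b hf ha hb hfl).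
  have /locally_Cmod [d [d0 hd]] := locally_nz _ _ (cdiff_cont _ _ (hg a ha)) ga.
  exists d. split => // z hz. rewrite eg => h. apply NNPP => n.
  apply: (Cmult_neq_0 _ _ _ (hd z hz)) h. apply: Cpow_nz. exact: Cminus_nz.
Qed.

(** Compactness by [bisection]: since zeros are isolated, a small rectangle around a point contains
    at most that point as a zero. *)
Lemma finite_zeros X1 X2 Y1 Y2 f b x1 x2 y1 y2 : holo X1 X2 Y1 Y2 f -> in_box X1 X2 Y1 Y2 b -> f b <> RtoC 0 ->
  X1 < x1 -> x1 <= x2 -> x2 < X2 -> Y1 < y1 -> y1 <= y2 -> y2 < Y2 ->
  exists l, forall z, in_rect x1 x2 y1 y2 z -> f z = RtoC 0 -> In z l.
Proof.
  move=> hf hb fb h1 h2 h3 h4 h5 h6.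
  have := bisection (fun x y w h => exists l, forall z, in_rect x (x + w) y (y + h) z -> f z = RtoC 0 -> In z l) x1 y1 (x2 - x1) (y2 - y1).
  have -> : x1 + (x2 - x1) = x2 by ring. have -> : y1 + (y2 - y1) = y2 by ring.
  apply; try lra.
  - move=> x y w h w0 hh _ _ _ _ [l1 k1] [l2 k2] [l3 k3] [l4 k4].
    exists (l1 ++ l2 ++ l3 ++ l4) => z [z1 z2] fz. rewrite !in_app_iff.
    case: (Rle_dec (Re z) (x + w/2)) => c1; case: (Rle_dec (Im z) (y + h/2)) => c2.
    + left; apply: k1 => //; rewrite /in_rect; lra.
    + right; right; left; apply: k3 => //; rewrite /in_rect; lra.
    + right; left; apply: k2 => //; rewrite /in_rect; lra.
    + right; right; right; apply: k4 => //; rewrite /in_rect; lra.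
  - move=> p q hp hq.
    have [d [d0 hd]] := isolated_zero _ _ _ _ f (pt p q) b hf ltac:(rewrite /in_box /=; lra) hb fb.
    exists (d / 2). split; first lra.
    move=> x y w h hw hh hx hy _ _ _ _. exists (pt p q :: nil) => z hz fz. left. symmetry. apply: hd => //.
    have := Cmod_rect x (x+w) y (y+h) z (pt p q) hz ltac:(rewrite /in_rect /=; lra). lra.
Qed.

(** Induction on a list of candidates: each one in the rectangle is divided out to its full order,
    so that it is no zero of the cofactor. Infinite order is excluded because f does not vanish at
    b. *)
Lemma factor_list X1 X2 Y1 Y2 x1 x2 y1 y2 b l : in_box X1 X2 Y1 Y2 b ->
  (forall z, in_rect x1 x2 y1 y2 z -> in_box X1 X2 Y1 Y2 z) ->
  forall f, holo X1 X2 Y1 Y2 f -> f b <> RtoC 0 ->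
  (forall z, in_rect x1 x2 y1 y2 z -> f z = RtoC 0 -> In z l) ->
  exists m h, holo X1 X2 Y1 Y2 h /\ (forall z, f z = (prodl m z * h z)%C) /\
    (forall z, in_rect x1 x2 y1 y2 z -> h z <> RtoC 0) /\ (forall a, In a m -> in_rect x1 x2 y1 y2 a).
Proof.
  move=> hb hsub. elim: l => [|a l IH] f hf fb hz.
  - exists nil, f. split => //. split; first by move=> z /=; ring. split; last by move=> a [].
    move=> z hz1 hz2. exact: (hz z).
  - case: (classic (in_rect x1 x2 y1 y2 a)) => ha; last first.
    { apply: IH => // z hz1 hz2. case: (hz z hz1 hz2) => // e. case: ha. by rewrite e. }
    have haO := hsub a ha.
    case: (ord_or_flat _ _ _ _ f a hf haO) => [[k [g [hg [ga eg]]]]|hfl]; last by case: fb; exact: (identity_theorem _ _ _ _ f a b hf haO hb hfl).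
    have gb : g b <> RtoC 0 by move=> e; apply: fb; rewrite eg e; ring.
    have [z hz1 hz2|m [h [hh [eh [nzh inm]]]]] := IH g hg gb.
    + have := hz z hz1. rewrite eg hz2 => hh. case: hh => //; first ring.
      move=> e. case: ga. by rewrite e.
    + exists (repeat a k ++ m), h. split => //. split; last split => //.
      * move=> z. rewrite prodl_app prodl_repeat eg eh. ring.
      * move=> c /in_app_iff [/(repeat_spec _ _ _) ->|]; [done | exact: inm].
Qed.

Lemma holo_at_near f z : holomorphic_at f z -> cdiff_near f z.
Proof. by move/holo_iff. Qed.

(** [holomorphic_at] gives a neighbourhood of each real point, of a size depending on the point;
    over a bounded segment compactness gives a common height. This puts the real axis, one side of
    the contour, into the interior of the domain. *)
Lemma real_strip rho f x1 x2 : class_F rho f -> x1 <= x2 -> exists e, 0 < e /\ forall z, x1 <= Re z <= x2 -> 0 <= Im z < e -> cdiff f z /\ f z <> RtoC 0.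
Proof.
  move=> hF hx.
  (* The segment is treated as a rectangle of height 0. *)
  have := bisection (fun x y w h => exists e, 0 < e /\ forall z, x <= Re z <= x + w -> 0 <= Im z < e -> cdiff f z /\ f z <> RtoC 0) x1 0 (x2 - x1) 0.
  have -> : x1 + (x2 - x1) = x2 by ring.
  apply; try lra.
  - move=> x y w h w0 h0 _ _ _ _ [e1 [e10 k1]] [e2 [e20 k2]] _ _.
    exists (Rmin e1 e2). split; first exact: Rmin_glb_lt. move=> z hz hi.
    have m1 := Rmin_l e1 e2. have m2 := Rmin_r e1 e2.
    case: (Rle_dec (Re z) (x + w/2)) => c; [apply: k1 | apply: k2]; lra.
  - move=> p q hp hq. have hn := F_holomorphic _ _ hF (RtoC p) ltac:(rewrite /=; lra).
    move/holo_at_near: hn => hn.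
    have fc : ccont f (RtoC p) by apply: cdiff_cont; exact: locally_singleton hn.
    have hl : clocally (RtoC p) (fun z => cdiff f z /\ f z <> RtoC 0).
    { apply: filter_and => //. exact: (locally_nz _ _ fc (F_nonzero _ _ hF p)). }
    move/locally_Cmod: hl => [d [d0 hd]].
    exists (d / 2). split; first lra.
    move=> x y w h hw hh hpx hy _ _ _ _. exists (d / 2). split; first lra.
    move=> z hz hi. apply: hd. apply: Rle_lt_trans (Cmod_ReIm _) _.
    have : Rabs (Re (z - RtoC p)) < d / 2 by apply: Rabs_def1; Cre; lra.
    have : Rabs (Im (z - RtoC p)) < d / 2 by apply: Rabs_def1; Cre; lra. lra.
Qed.

Lemma box_factor rho f x1 x2 H : class_F rho f -> x1 < x2 -> 0 < H ->
  exists e m h, 0 < e /\ (forall z, in_rect x1 x2 (- H) e z -> cdiff_near f z /\ cdiff_near h z /\ h z <> RtoC 0) /\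
    (forall z, f z = (prodl m z * h z)%C) /\ (forall a, In a m -> in_rect x1 x2 (- H) 0 a /\ Im a < 0 /\ f a = RtoC 0).
Proof.
  move=> hF hx hH.
  have [e [e0 he]] := real_strip rho f (x1 - 1) (x2 + 1) hF ltac:(lra).
  have hol : holo (x1 - 1) (x2 + 1) (- H - 1) e f.
  { move=> z [z1 z2]. case: (Rle_dec (Im z) 0) => c.
    - exact: locally_singleton (holo_at_near _ _ (F_holomorphic _ _ hF z c)).
    - apply: (proj1 (he z _ _)); lra. }
  have hb : in_box (x1 - 1) (x2 + 1) (- H - 1) e (RtoC x1) by rewrite /in_box /=; lra.
  have hsub : forall z, in_rect x1 x2 (- H) (e / 2) z -> in_box (x1 - 1) (x2 + 1) (- H - 1) e z by move=> z; rewrite /in_rect /in_box; lra.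
  have fb := F_nonzero _ _ hF x1.
  have [l hl] := finite_zeros _ _ _ _ f _ x1 x2 (- H) (e / 2) hol hb fb ltac:(lra) ltac:(lra) ltac:(lra) ltac:(lra) ltac:(lra) ltac:(lra).
  have [m [h [hh [eh [nzh inm]]]]] := factor_list _ _ _ _ _ _ _ _ _ l hb hsub f hol fb hl.
  exists (e / 2), m, h. split; first lra. split; last split => //.
  - move=> z hz. have hzO := hsub z hz. split; first exact: box_near hol hzO. split; last exact: nzh. exact: box_near hh hzO.
  - move=> a ha. have har := inm a ha. have fa : f a = RtoC 0.
    { rewrite eh. have -> : prodl m a = RtoC 0; last by ring.
      elim: m ha {eh inm} => [|c m IH] //= [->|hi]; first ring. rewrite IH //. ring. }
    have ia : Im a < 0.
    { apply: Rnot_le_lt => c. move: har; rewrite /in_rect => har. apply: (proj2 (he a _ _)) => //; lra. }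
    split => //. move: har; rewrite /in_rect. lra.
Qed.

(** If k < m, then g w - (w - z)^(m-k) g' w is continuous with the value g z at z, hence nonzero
    near z; but the two factorizations force it to vanish at every w near z other than z. *)
Lemma zero_order_unique f z k m : zero_order f z k -> zero_order f z m -> k = m.
Proof.
  have aux : forall k m, zero_order f z k -> zero_order f z m -> (k < m)%nat -> False.
  { move=> {}k {}m [g [hg [gz eg]]] [g' [hg' [_ eg']]] km.
    have cg := cdiff_cont _ _ (locally_singleton _ _ (holo_at_near _ _ hg)).
    have cg' := cdiff_cont _ _ (locally_singleton _ _ (holo_at_near _ _ hg')).
    have c1 : ccont (fun w => g w - (w - z) ^ (m - k) * g' w)%C z.
    { apply: continuous_Cplus => //. apply: continuous_Copp. apply: continuous_Cmult => //.
      apply: cdiff_cont. apply: cdiff_pow. exact: cdiff_shift. }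
    have nz : (g z - (z - z) ^ (m - k) * g' z)%C <> RtoC 0.
    { rewrite (_ : z - z = 0)%C; last by ring. have -> : (m - k = S (m - k - 1))%nat by lia.
      rewrite /=. rewrite (_ : (g z - 0 * 0 ^ (m - k - 1) * g' z)%C = g z) //. ring. }
    have hl : clocally z (fun w => (g w - (w - z) ^ (m - k) * g' w)%C <> RtoC 0 /\ f w = ((w - z) ^ k * g w)%C /\ f w = ((w - z) ^ m * g' w)%C).
    { apply: filter_and; first exact: (locally_nz _ _ c1 nz). exact: filter_and. }
    move/locally_Cmod: hl => [d [d0 hd]].
    set w := (z + RtoC (d / 2))%C.
    have hw : Cmod (w - z) < d.
    { rewrite /w (_ : z + RtoC (d/2) - z = RtoC (d/2))%C; last by ring. rewrite Cmod_R Rabs_pos_eq; lra. }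
    have wz : w <> z by move=> e; have := f_equal Re e; rewrite /w; Cre; lra.
    have [h1 [h2 h3]] := hd w hw. apply: h1.
    have n1 : ((w - z) ^ k)%C <> RtoC 0 by apply: Cpow_nz; exact: Cminus_nz.
    have : ((w - z) ^ k * (g w - (w - z) ^ (m - k) * g' w))%C = RtoC 0.
    { rewrite (_ : ((w - z) ^ k * (g w - (w - z) ^ (m - k) * g' w))%C = ((w - z) ^ k * g w - (w - z) ^ k * (w - z) ^ (m - k) * g' w)%C); last by ring.
      rewrite -Cpow_add_r (_ : (k + (m - k))%nat = m); last by lia. rewrite -h2 -h3. ring. }
    move=> h. apply NNPP => hn. exact: (Cmult_neq_0 _ _ n1 hn h). }
  move=> h1 h2. case: (Nat.lt_trichotomy k m) => [c|[//|c]]; [case: (aux k m) | case: (aux m k)] => //.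
Qed.

Lemma count_occ_notIn_prod l z : exists g, (forall w, cdiff g w) /\ g z <> RtoC 0 /\ forall w, prodl l w = ((w - z) ^ (count_occ Ceq_dec l z) * g w)%C.
Proof.
  elim: l => [|a l [g [hg [gz eg]]]].
  - exists (fun _ => RtoC 1). split; first by move=> w; exact: cdiff_const.
    split; first by move=> e; have := f_equal Re e; rewrite /=; lra. move=> w /=. ring.
  - rewrite /=. case: Ceq_dec => [->|n].
    + exists g. do 2 split => //. move=> w. rewrite eg /=. ring.
    + exists (fun w => (w - a) * g w)%C. split; last split.
      * move=> w. apply: cdiff_mult => //. exact: cdiff_shift.
      * apply: Cmult_neq_0 => //. apply: Cminus_nz. exact: not_eq_sym.
      * move=> w. rewrite eg. ring.
Qed.

Lemma zero_order_factor f m h z : (forall w, f w = (prodl m w * h w)%C) -> cdiff_near h z -> h z <> RtoC 0 ->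
  zero_order f z (count_occ Ceq_dec m z).
Proof.
  move=> ef hh hz. have [g [hg [gz eg]]] := count_occ_notIn_prod m z.
  exists (fun w => g w * h w)%C. split; last split.
  - apply/holo_iff. apply: filter_imp hh => w hw. exact: cdiff_mult.
  - exact: Cmult_neq_0.
  - apply: filter_forall => w. rewrite ef eg. Cring.
Qed.

Lemma lists_zeros_filter f m h (A : C -> Prop) (decA : C -> bool) :
  (forall z, A z <-> decA z = true) -> (forall w, f w = (prodl m w * h w)%C) ->
  (forall z, A z -> cdiff_near h z /\ h z <> RtoC 0) -> lists_zeros f A (filter decA m).
Proof.
  move=> hA ef hh z. split.
  - move=> az. have [h1 h2] := hh z az. have := zero_order_factor f m h z ef h1 h2.
    have -> // : count_occ Ceq_dec m z = count_occ Ceq_dec (filter decA m) z.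
    elim: m {ef hh} => [|a m IH] //=. case e : (decA a) => /=; case: Ceq_dec => [ea|na] //; rewrite IH //.
    exfalso. move/hA: az. by rewrite -ea e.
  - move=> naz /filter_In [_ d]. apply: naz. exact/hA.
Qed.

Lemma lists_zeros_length f A l1 l2 : lists_zeros f A l1 -> lists_zeros f A l2 -> length l1 = length l2.
Proof.
  move=> h1 h2. apply: Permutation_length. apply/(Permutation_count_occ Ceq_dec) => z.
  case: (classic (A z)) => az.
  - exact: zero_order_unique (proj1 (h1 z) az) (proj1 (h2 z) az).
  - rewrite (proj1 (count_occ_not_In Ceq_dec l1 z) (proj2 (h1 z) az)).
    by rewrite (proj1 (count_occ_not_In Ceq_dec l2 z) (proj2 (h2 z) az)).
Qed.

Lemma zero_count_eq f A l : lists_zeros f A l -> zero_count f A = length l.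
Proof.
  move=> h. have [l' [h' <-]] : exists l', lists_zeros f A l' /\ length l' = zero_count f A.
  { apply: (epsilon_spec (inhabits 0%nat) (fun N => exists l, lists_zeros f A l /\ length l = N)). by exists (length l), l. }
  exact: lists_zeros_length h' h.
Qed.

(** * The map W(z) = z + i t Log z *)

Lemma ln_le_sub1 x : 0 < x -> ln x <= x - 1.
Proof. move=> h. have := exp_ineq1_le (ln x). rewrite exp_ln //. lra. Qed.

Lemma ln_le_mono x y : 0 < x -> x <= y -> ln x <= ln y.
Proof. move=> x0 [h|->]; [left; exact: ln_increasing | exact: Rle_refl]. Qed.

Lemma exp_le_mono x y : x <= y -> exp x <= exp y.
Proof. move=> [h|->]; [left; exact: exp_increasing | exact: Rle_refl]. Qed.

Lemma atan_le_mono x y : x <= y -> atan x <= atan y.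
Proof. move=> [h|->]; [left; exact: atan_increasing | exact: Rle_refl]. Qed.

Lemma ln_ge1 x : 3 <= x -> 1 <= ln x.
Proof. move=> h. rewrite -(ln_exp 1). apply: ln_le_mono; [exact: exp_pos | have := exp_le_3; lra]. Qed.

(** With q the fourth root of r, ln r = 4 ln q <= 4 q, hence (ln r)^2 <= 16 sqrt r; the threshold
    256 c^2 ensures sqrt r >= 16 c. *)
Lemma ln_sq_small c : 0 < c -> exists R0, 3 <= R0 /\ forall r, R0 <= r -> c * ln r ^ 2 <= r /\ c * ln r <= r /\ 1 <= ln r.
Proof.
  move=> c0. exists (3 + 256 * c ^ 2). split; first by nra.
  move=> r hr. have r0 : 3 <= r by nra.
  have l1 := ln_ge1 r r0.
  set s := sqrt r. have s2 : s * s = r by apply: sqrt_sqrt; lra. have s0 : 0 < s by apply: sqrt_lt_R0; lra.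
  set q := sqrt s. have q2 : q * q = s by apply: sqrt_sqrt; lra. have q0 : 0 < q by apply: sqrt_lt_R0; lra.
  have lr : ln r = 4 * ln q.
  { rewrite -s2 -q2 !ln_mult //; try nra; ring. }
  have lq : ln q <= q by have := ln_le_sub1 q q0; lra.
  have l0 : 0 <= ln q by lra.
  have h2 : ln r ^ 2 <= 16 * s by rewrite lr -q2; nra.
  have sc : 16 * c <= s.
  { apply: Rnot_lt_le => hlt. have : s * s < (16 * c) * (16 * c) by nra. nra. }
  have k : c * ln r ^ 2 <= r.
  { apply: Rle_trans (Rmult_le_compat_l c _ _ ltac:(lra) h2) _. nra. }
  split => //. split => //. apply: Rle_trans k. apply: Rmult_le_compat_l; nra.
Qed.

Lemma cder_W_aux t z : 0 < Re z -> cder (fun z => z + Ci * RtoC t * Log z)%C z (1 + Ci * RtoC t * / z)%C.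
Proof.
  move=> h. apply: cder_plus; first exact: cder_id. apply: cder_scal. apply: Log_cder. by left.
Qed.

Lemma Log_lip x0 z w : 0 < x0 -> x0 <= Re z -> x0 <= Re w -> Cmod (Log z - Log w) <= 2 / x0 * Cmod (z - w).
Proof.
  move=> x00 hz hw.
  have hs : forall s, 0 <= s <= 1 -> x0 <= Re (w + RtoC s * (z - w)).
  { move=> s hs. rewrite (_ : Re _ = (1 - s) * Re w + s * Re z); last by Cre; ring. nra. }
  have nz : forall u, x0 <= Re u -> u <> RtoC 0 by move=> u hu e; move: hu; rewrite e /=; lra.
  have e : (Log z - Log w)%C = CI (fun s => / (w + RtoC s * (z - w)) * (z - w))%C 0 1.
  { rewrite (CI_prim_line Log Cinv w (z - w) 0 1).
    - congr Cminus; congr Log; ring.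
    - move=> s. rewrite Rmin_left ?Rmax_right; try lra. move=> h. apply: Log_cder. left. have := hs s h. lra.
    - move=> s. rewrite Rmin_left ?Rmax_right; try lra. move=> h. apply: (continuous_Cinv (fun z => z)); first exact: continuous_id.
      apply: nz. exact: hs. }
  rewrite e. apply: Rle_trans (CI_bound _ 0 1 (/ x0 * Cmod (z - w)) ltac:(lra) _ _) _.
  - move=> s. rewrite Rmin_left ?Rmax_right; try lra. move=> h.
    apply: continuous_Cmult; last exact: continuous_const.
    apply: (pcont_line Cinv). apply: (continuous_Cinv (fun z => z)); first exact: continuous_id. apply: nz. exact: hs.
  - move=> s h. rewrite Cmod_mult. apply: Rmult_le_compat_r; first exact: Cmod_ge_0.
    rewrite Cmod_inv; last by apply: nz; exact: hs. apply: Rinv_le_contravar => //.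
    apply: Rle_trans (re_le_Cmod _). apply: Rle_trans (Rle_abs _). exact: hs.
  - right. field. lra.
Qed.

Section Wmap.
Variable t : R.
Hypothesis t0 : 0 < t.

Definition Wm (z : C) : C := (z + Ci * RtoC t * Log z)%C.
Definition Wd (z : C) : C := (1 + Ci * RtoC t * / z)%C.

Lemma Re_W z : Re (Wm z) = Re z - t * (2 * atan (Im z / (Cmod z + Re z))).
Proof. rewrite /Wm Log_eta. Cre. ring. Qed.
Lemma Im_W z : Im (Wm z) = Im z + t * ln (Cmod z).
Proof. rewrite /Wm Log_eta. Cre. ring. Qed.

Lemma W_cder z : 0 < Re z -> cder Wm z (Wd z).
Proof. exact: cder_W_aux. Qed.

(** For real parts at least 4t the function t Log has Lipschitz constant 2t / (4t) = 1/2, so W is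
    the identity plus a map of constant 1/2. The bound 4t on real parts, used from here on, has this
    origin. *)
Lemma W_expand z w : 4 * t <= Re z -> 4 * t <= Re w -> Cmod (z - w) <= 2 * Cmod (Wm z - Wm w).
Proof.
  move=> hz hw. have := Log_lip (4 * t) z w ltac:(lra) hz hw. set d := Cmod (z - w) => hl.
  have : Cmod (Wm z - Wm w - (z - w)) <= d / 2.
  { rewrite (_ : Wm z - Wm w - (z - w) = Ci * RtoC t * (Log z - Log w))%C; last by rewrite /Wm; ring.
    rewrite !Cmod_mult Cmod_Ci Cmod_R Rabs_pos_eq; last lra. rewrite Rmult_1_l.
    apply: Rle_trans (Rmult_le_compat_l t _ _ ltac:(lra) hl) _. right. field. lra. }
  have := Cmod_triangle (Wm z - Wm w) (- (Wm z - Wm w - (z - w))).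
  rewrite Cmod_opp (_ : Wm z - Wm w + - (Wm z - Wm w - (z - w)) = z - w)%C; last by ring. rewrite -/d. lra.
Qed.

Lemma W_inj z w : 4 * t <= Re z -> 4 * t <= Re w -> Wm z = Wm w -> z = w.
Proof.
  move=> hz hw e. have := W_expand z w hz hw. rewrite e (_ : Wm w - Wm w = 0)%C; last by ring.
  rewrite Cmod_0 => h. have h0 : Cmod (z - w) = 0 by have := Cmod_ge_0 (z - w); lra.
  have := Cmod_eq_0 _ h0 => h1. rewrite -(Cplus_0_r w) -h1. ring.
Qed.

Lemma Wd_bound z : 4 * t <= Re z -> / 2 <= Cmod (Wd z) /\ Cmod (Wd z) <= 2.
Proof.
  move=> hz. have nz : z <> RtoC 0 by move=> e; move: hz; rewrite e /=; lra.
  have k : Cmod (Ci * RtoC t * / z) <= / 4.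
  { rewrite !Cmod_mult Cmod_Ci Cmod_R Rabs_pos_eq; last lra. rewrite Rmult_1_l Cmod_inv //.
    have m : 4 * t <= Cmod z by have := re_le_Cmod z; have := Rle_abs (Re z); lra.
    apply: Rle_trans (Rmult_le_compat_l t _ _ ltac:(lra) (Rinv_le_contravar _ _ _ m)) _; first lra.
    right. field. lra. }
  have k1 := Cmod_triangle 1 (Ci * RtoC t * / z). rewrite Cmod_1 -/(Wd z) in k1.
  have k2 := Cmod_triangle (Wd z) (- (Ci * RtoC t * / z)). rewrite Cmod_opp in k2.
  rewrite (_ : Wd z + - (Ci * RtoC t * / z) = 1)%C in k2; last by rewrite /Wd; ring. rewrite Cmod_1 in k2. lra.
Qed.

Lemma atan_abs1 s : -1 <= s <= 1 -> -2 <= 2 * atan s <= 2.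
Proof.
  move=> [h1 h2]. have p4 := PI_4. have e1 := atan_1. have e2 : atan (-1) = - (PI / 4) by rewrite -e1 -atan_opp.
  have a1 : atan s <= PI / 4.
  { rewrite -e1. exact: atan_le_mono. }
  have a2 : - (PI / 4) <= atan s.
  { rewrite -e2. exact: atan_le_mono. }
  lra.
Qed.

(* The curve [Re (Wm z) = X], parametrised by s = tan (arg z / 2). *)
Definition sx (X s : R) := X + t * (2 * atan s).
Definition sz (X s : R) : C := (sx X s, 2 * s * sx X s / (1 - s ^ 2)).

Lemma sz_mod X s : -1 < s < 1 -> 0 < sx X s -> Cmod (sz X s) = sx X s * ((1 + s ^ 2) / (1 - s ^ 2)).
Proof.
  move=> hs hx. have p : 0 < 1 - s ^ 2 by nra.
  rewrite /Cmod /sz /=. set x := sx X s in hx *.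
  rewrite (_ : _ + _ = Rsqr (x * ((1 + s ^ 2) / (1 - s ^ 2)))).
  - apply: sqrt_Rsqr. apply: Rmult_le_pos; first lra. apply: Rmult_le_pos; first nra. left; exact: Rinv_0_lt_compat.
  - rewrite /Rsqr. field. simpl in p. lra.
Qed.

Lemma sz_W X s : -1 < s < 1 -> 0 < sx X s ->
  Re (Wm (sz X s)) = X /\ Im (Wm (sz X s)) = 2 * s * sx X s / (1 - s ^ 2) + t * ln (sx X s * ((1 + s ^ 2) / (1 - s ^ 2))).
Proof.
  move=> hs hx. have p : 0 < 1 - s ^ 2 by nra.
  rewrite Re_W Im_W sz_mod //. split; last by [].
  rewrite (_ : Im (sz X s) / (sx X s * ((1 + s ^ 2) / (1 - s ^ 2)) + Re (sz X s)) = s); first by rewrite /sz /sx /=; ring.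
  rewrite /sz /=. simpl in p. field. repeat split; lra.
Qed.

(** Intermediate value theorem along the curve [sz X] for s between -1/2 and 1/2: Im W equals t ln X
    at s = 0, the real point X, and lies below -1 at the left end and above t ln X + 1 at the right
    end. The unit margins make the domain of the inverse a neighbourhood of the region. Im z has the
    sign of s. *)
Lemma sz_exists : exists X0, 3 <= X0 /\ 6 * t <= X0 /\ forall X Y, X0 <= X -> -1 <= Y <= t * ln X + 1 ->
  exists z, X - 2 * t <= Re z /\ Wm z = (X, Y) /\ (Y <= t * ln X -> Im z <= 0).
Proof.
  have [R0 [R03 hR0]] := ln_sq_small (3 * t + 3) ltac:(lra).
  exists (R0 + 6 * t + 3). split; first lra. split; first lra.
  move=> X Y hX hY.
  have at2 := fun s hs => atan_abs1 s hs.
  have sxb : forall s, -1 <= s <= 1 -> X - 2 * t <= sx X s <= X + 2 * t.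
  { move=> s hs. have := at2 s hs. rewrite /sx. nra. }
  set F := fun s => 2 * s * sx X s / (1 - s ^ 2) + t * ln (sx X s * ((1 + s ^ 2) / (1 - s ^ 2))).
  have cF : forall s, -/2 <= s <= /2 -> continuity_pt F s.
  { move=> s hs. have p : 0 < 1 - s ^ 2 by nra. have hx := sxb s ltac:(lra).
    apply/continuity_pt_filterlim. apply: ex_derive_continuousR.
    rewrite /F /sx. simpl in p. auto_derive. rewrite /sx in hx. repeat split; try lra.
    apply: Rmult_lt_0_compat; first lra. apply: Rmult_lt_0_compat; first nra. apply: Rinv_0_lt_compat. lra. }
  have cG : forall s, -/2 <= s <= /2 -> continuity_pt (fun s => F s - Y) s.
  { move=> s hs. apply: continuity_pt_minus; first exact: cF. exact: continuity_pt_const. }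
  have lnX0 : 0 < ln X by rewrite -ln_1; apply: ln_increasing; lra.
  have Fm : F (-/2) < -1.
  { rewrite /F. have hx := sxb (-/2) ltac:(lra). set x := sx X (-/2) in hx *.
    rewrite (_ : 2 * -/2 * x / (1 - (-/2)^2) = - (4 * x / 3)); last by field.
    rewrite (_ : x * ((1 + (-/2)^2) / (1 - (-/2)^2)) = 5 * x / 3); last by field.
    have [_ [h _]] := hR0 (5 * x / 3) ltac:(lra).
    have : 0 <= ln (5 * x / 3) by rewrite -ln_1; left; apply: ln_increasing; lra. nra. }
  have fin : forall s, -/2 <= s <= /2 -> F s = Y -> X - 2 * t <= Re (sz X s) /\ Wm (sz X s) = (X, Y).
  { move=> s hs e. have hx := sxb s ltac:(lra). split; first by rewrite /sz /=; lra.
    have [h1 h2] := sz_W X s ltac:(lra) ltac:(lra). apply C_ext => //. by rewrite h2 -/(F s). }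
  case: (Rle_dec Y (t * ln X)) => c.
  - case: (Req_dec Y (t * ln X)) => [e|ne].
    + have F0 : F 0 = Y.
      { rewrite /F /sx atan_0 e. rewrite (_ : (X + t * (2 * 0)) * ((1 + 0 ^ 2) / (1 - 0 ^ 2)) = X); last by field. field. }
      have [h1 h2] := fin 0 ltac:(lra) F0. exists (sz X 0). split => //. split => // _. rewrite /sz /=. lra.
    + have [s [hs fs]] := IVT_interv (fun s => F s - Y) (-/2) 0
        (fun a ha => cG a ltac:(lra)) ltac:(lra) ltac:(lra)
        ltac:(rewrite /F /sx atan_0 (_ : (X + t * (2 * 0)) * ((1 + 0 ^ 2) / (1 - 0 ^ 2)) = X); [rewrite /Rdiv !Rmult_0_r !Rmult_0_l; lra | field]).
      have [h1 h2] := fin s ltac:(lra) ltac:(lra). exists (sz X s). split => //. split => // _. rewrite /sz /=.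
      have hx := sxb s ltac:(lra). have p : 0 < 1 - s ^ 2 by nra. simpl in p.
      have ip := Rinv_0_lt_compat _ p. have : 2 * s * sx X s <= 0 by nra. rewrite /Rdiv. nra.
  - have Fp : t * ln X + 1 < F (/2).
    { rewrite /F. have hx := sxb (/2) ltac:(lra). set x := sx X (/2) in hx *.
      rewrite (_ : 2 * /2 * x / (1 - (/2)^2) = 4 * x / 3); last by field.
      rewrite (_ : x * ((1 + (/2)^2) / (1 - (/2)^2)) = 5 * x / 3); last by field.
      have : ln X < ln (5 * x / 3) by apply: ln_increasing; lra. nra. }
    have [s [hs fs]] := IVT_interv (fun s => F s - Y) (-/2) (/2)
        cG ltac:(lra) ltac:(lra) ltac:(lra).
    have [h1 h2] := fin s ltac:(lra) ltac:(lra). exists (sz X s). split => //.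
Qed.

(** In this region |Im z| <= t ln |z|, so that |z| - Re z = O((ln |z|)^2 / |z|) and arg z = O(ln |z|
    / |z|). Thus Re W - |z| even tends to 0; 1 is a convenient margin. *)
Lemma Re_W_near : exists R0, 3 <= R0 /\ forall z, 0 < Re z -> R0 <= Cmod z -> - t * ln (Cmod z) <= Im z <= 0 ->
  Cmod z - 1 <= Re (Wm z) <= Cmod z + 1 /\ Cmod z - 1 <= Re z.
Proof.
  have [R0 [R03 hR0]] := ln_sq_small (4 * t ^ 2 + 1) ltac:(nra).
  exists R0. split => // z hx hm hy. have [l1 [l2 l3]] := hR0 _ hm.
  set m := Cmod z in hm hy l1 l2 l3 *. set x := Re z in hx *. set y := Im z in hy *.
  have m2 : m * m = x * x + y * y by exact: Cmod2.
  have xm : x <= m by apply: Rle_trans (re_le_Cmod z); exact: Rle_abs.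
  set L := ln m in hy l1 l2 l3 *.
  have y2 : y * y <= t ^ 2 * L ^ 2.
  { have := Rmult_le_pos (t * L + y) (t * L - y) ltac:(lra) ltac:(nra). nra. }
  have y2' : 4 * (y * y) <= m by nra.
  have d1 : (m - x) * m <= y * y by nra.
  have d2 : m - x <= / 4 by nra.
  rewrite Re_W -/m -/x -/y.
  set q := y / (m + x).
  have q0 : q <= 0.
  { have : 0 < / (m + x) by apply: Rinv_0_lt_compat; lra. rewrite /q /Rdiv. nra. }
  have qm : q * (m + x) = y by rewrite /q; field; lra.
  have aq : q <= atan q <= 0.
  { split.
    - case: (Req_dec q 0) => [->|n]; first by rewrite atan_0; lra.
      have [c [hc _]] := MVT_cor2 atan (fun u => / (1 + u ^ 2)) q 0 ltac:(lra) (fun c _ => derivable_pt_lim_atan c).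
      rewrite atan_0 in hc.
      have : 0 < / (1 + c ^ 2) by apply: Rinv_0_lt_compat; nra.
      have : / (1 + c ^ 2) <= 1 by rewrite -{2}Rinv_1; apply: Rinv_le_contravar; nra.
      nra.
    - rewrite -atan_0. apply: atan_le_mono. lra. }
  have tq : - (t * (2 * atan q)) <= / 2.
  { have h1 : - (t * (2 * atan q)) <= - (2 * t * q) by nra.
    have k : - (m * q) <= - y by nra.
    have h2 : m * (- (2 * t * q)) <= 2 * t * - y.
    { have := Rmult_le_compat_l (2 * t) _ _ ltac:(lra) k. lra. }
    have h3 : 2 * t * - y <= 2 * (t ^ 2 * L) by nra.
    have h4 : 2 * (t ^ 2 * L) <= m / 2 by nra.
    nra. }
  split; nra.
Qed.
End Wmap.

(** * The inverse of W *)

Section Zmap.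
Variables t X0 : R.
Hypothesis t0 : 0 < t.
Hypothesis X03 : 3 <= X0.
Hypothesis X06 : 6 * t <= X0.
Hypothesis Zex : forall X Y, X0 <= X -> -1 <= Y <= t * ln X + 1 ->
  exists z, X - 2 * t <= Re z /\ Wm t z = (X, Y) /\ (Y <= t * ln X -> Im z <= 0).

(** An open neighbourhood of the region 0 <= Im w <= t ln (Re w), Re w > X0, since the inverse has
    to be holomorphic up to the contour. *)
Definition Dm (w : C) : Prop := X0 < Re w /\ -1 < Im w < t * ln (Re w) + 1.
(** The lower bound on the real part makes the preimage unique: X0 - 2t >= 4t, where [W_inj]
    applies. *)
Definition Zm (w : C) : C := epsilon (inhabits (RtoC 0)) (fun z => X0 - 2 * t <= Re z /\ Wm t z = w).

Lemma Zm_spec w : Dm w -> X0 - 2 * t <= Re (Zm w) /\ Wm t (Zm w) = w.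
Proof.
  move=> [h1 h2]. apply: (epsilon_spec (inhabits (RtoC 0)) (fun z => X0 - 2 * t <= Re z /\ Wm t z = w)).
  have [z [z1 [z2 _]]] := Zex (Re w) (Im w) ltac:(lra) ltac:(lra).
  exists z. split; first lra. by rewrite z2 -C_eta.
Qed.

Lemma Zm_half w : Dm w -> 4 * t <= Re (Zm w).
Proof. move=> /Zm_spec [h _]. lra. Qed.

Lemma Zm_unique w z : Dm w -> 4 * t <= Re z -> Wm t z = w -> Zm w = z.
Proof. move=> hw hz e. apply: (W_inj t t0) => //; first exact: Zm_half. by rewrite e (proj2 (Zm_spec w hw)). Qed.

Lemma Zm_region w : Dm w -> Im w <= t * ln (Re w) -> Re w - 2 * t <= Re (Zm w) /\ Im (Zm w) <= 0.
Proof.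
  move=> hw hi. have [h1 h2] := hw.
  have [z [z1 [z2 z3]]] := Zex (Re w) (Im w) ltac:(lra) ltac:(lra).
  have -> : Zm w = z by apply: Zm_unique => //; [lra | rewrite z2 -C_eta].
  split => //. exact: z3.
Qed.

Lemma Zm_lip w v : Dm w -> Dm v -> Cmod (Zm w - Zm v) <= 2 * Cmod (w - v).
Proof.
  move=> hw hv. have := W_expand t t0 _ _ (Zm_half w hw) (Zm_half v hv).
  by rewrite (proj2 (Zm_spec w hw)) (proj2 (Zm_spec v hv)).
Qed.

Lemma Dm_open w : Dm w -> clocally w Dm.
Proof.
  move=> [h1 h2].
  have p : 0 < Re w by lra.
  have c1 : continuous (T:=C_UniformSpace) (U:=R_UniformSpace) (fun w => t * ln (Re w) + 1 - Im w) w.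
  { apply: continuous_minusR; last by apply: (continuous_Im (fun w => w)); exact: continuous_id.
    apply: continuous_plusR; last exact: continuous_const.
    apply: continuous_multR; first exact: continuous_const.
    apply: (continuous_comp (fun w : C => Re w) ln); first by apply: (continuous_Re (fun w => w)); exact: continuous_id.
    exact: continuous_ln. }
  have l1 : clocally w (fun w => 0 < t * ln (Re w) + 1 - Im w).
  { apply (c1 (fun y => 0 < y)). have q : 0 < t * ln (Re w) + 1 - Im w by lra.
    exists (mkposreal _ q) => y. rewrite /ball /= /AbsRing_ball /abs /minus /plus /opp /=. move/Rabs_def2. rewrite /Re /Im. lra. }
  have q : 0 < Rmin (Re w - X0) (Im w + 1) by apply: Rmin_glb_lt; lra.
  have l2 : clocally w (fun w => X0 < Re w /\ -1 < Im w).
  { apply/locally_Cmod. exists (Rmin (Re w - X0) (Im w + 1)). split => // v hv.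
    have m1 := Rmin_l (Re w - X0) (Im w + 1). have m2 := Rmin_r (Re w - X0) (Im w + 1).
    have k1 : Rabs (Re (v - w)) < Rmin (Re w - X0) (Im w + 1) by apply: Rle_lt_trans hv; exact: re_le_Cmod.
    have k2 : Rabs (Im (v - w)) < Rmin (Re w - X0) (Im w + 1) by apply: Rle_lt_trans hv; exact: im_le_Cmod.
    move/Rabs_def2: k1. move/Rabs_def2: k2. Cre. lra. }
  have h : clocally w (fun w => 0 < t * ln (Re w) + 1 - Im w /\ (X0 < Re w /\ -1 < Im w)) by exact: filter_and.
  apply: filter_imp h => v [a [b c]]. rewrite /Dm. lra.
Qed.

Lemma Zm_cont w : Dm w -> ccont Zm w.
Proof.
  move=> hw. apply/filterlim_locally => eps. have /locally_Cmod [d [d0 hd]] := Dm_open w hw.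
  have e0 : 0 < eps by case: eps.
  have m0 : 0 < Rmin d (eps / 2) by apply: Rmin_glb_lt; lra.
  apply/locally_Cmod. exists (Rmin d (eps / 2)). split => // v hv.
  have m1 := Rmin_l d (eps / 2). have m2 := Rmin_r d (eps / 2).
  apply: C_NormedModule_mixin_compat1. rewrite /minus /plus /opp /=.
  have hv' : Dm v by apply: hd; lra. have := Zm_lip v w hv' hw. rewrite /Cminus in hv *. lra.
Qed.

Lemma Wd_nz z : 4 * t <= Re z -> Wd t z <> RtoC 0.
Proof. move=> h e. have := proj1 (Wd_bound t t0 z h). rewrite e Cmod_0. lra. Qed.

Lemma Wslope_nz a z : 4 * t <= Re a -> 4 * t <= Re z -> slope (Wm t) a (Wd t a) z <> RtoC 0.
Proof.
  move=> ha hz. rewrite /slope. case: Ceq_dec => [e|n]; first exact: Wd_nz.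
  rewrite /Cdiv. apply: Cmult_neq_0.
  - apply: Cminus_nz => e. apply: n. exact: (W_inj t t0).
  - move=> e. have := Cinv_r (z - a) (Cminus_nz _ _ n). rewrite e Cmult_0_r => k. have := f_equal Re k. rewrite /=. lra.
Qed.

(** In Caratheodory's form the inverse function rule is a division: the slope of the inverse is the
    reciprocal of the slope of W, which has no zeros by injectivity of W and [Wd_nz]. *)
Lemma Zm_cder w : Dm w -> cder Zm w (/ Wd t (Zm w))%C.
Proof.
  move=> hw. have hz := Zm_half w hw.
  have cs : ccont (slope (Wm t) (Zm w) (Wd t (Zm w))) (Zm w) by apply: (W_cder t); lra.
  apply: (cder_intro _ (fun v => / slope (Wm t) (Zm w) (Wd t (Zm w)) (Zm v))%C).
  - apply: continuous_Cinv; last by apply: Wslope_nz.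
    apply: (continuous_comp Zm (slope (Wm t) (Zm w) (Wd t (Zm w)))) => //. exact: Zm_cont.
  - by rewrite slope_at.
  - apply: filter_imp (Dm_open w hw) => v hv.
    have e := slope_eq (Wm t) (Zm w) (Wd t (Zm w)) (Zm v).
    rewrite (proj2 (Zm_spec w hw)) (proj2 (Zm_spec v hv)) in e.
    have nz := Wslope_nz (Zm w) (Zm v) hz (Zm_half v hv).
    set s := slope _ _ _ _ in e nz *.
    have -> : (v - w)%C = (s * (Zm v - Zm w))%C by rewrite {1}e; Cring.
    Cfield. exact: nz.
Qed.

Lemma W_real x : 0 < x -> Wm t (RtoC x) = (x, t * ln x).
Proof.
  move=> hx. apply C_ext.
  - rewrite Re_W /=. rewrite (_ : 0 / _ = 0); last by rewrite /Rdiv Rmult_0_l. rewrite atan_0. ring.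
  - rewrite Im_W Cmod_R Rabs_pos_eq /=; lra.
Qed.

Lemma Dm_real x : X0 < x -> Dm (x, t * ln x).
Proof. move=> hx. rewrite /Dm /=. have : 0 < ln x by rewrite -ln_1; apply: ln_increasing; lra. nra. Qed.

Lemma Zm_real x : X0 < x -> Zm (x, t * ln x) = RtoC x.
Proof. move=> hx. apply: Zm_unique; [exact: Dm_real | rewrite /=; lra | apply: W_real; lra]. Qed.

Lemma Zm_W z : 4 * t <= Re z -> Dm (Wm t z) -> Zm (Wm t z) = z.
Proof. move=> h1 h2. exact: Zm_unique. Qed.

(* t ln X is the imaginary part of Wm t at the real point X. *)
Lemma W_below z : 4 * t <= Re z -> Im z < 0 -> Im (Wm t z) < t * ln (Re (Wm t z)).
Proof.
  move=> hx hy. rewrite Im_W Re_W.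
  have x0 : 0 < Re z by lra.
  have m2 := Cmod2 z. have m0 := Cmod_ge_0 z. set m := Cmod z in m2 m0 *. set x := Re z in hx x0 m2 *. set y := Im z in hy m2 *.
  have mx : x < m by nra.
  have mxy : m <= x - y by nra.
  have at0 : atan (y / (m + x)) < 0.
  { rewrite -atan_0. apply: atan_increasing. have : 0 < / (m + x) by apply: Rinv_0_lt_compat; lra. rewrite /Rdiv. nra. }
  have l1 : ln x < ln (x - t * (2 * atan (y / (m + x)))) by apply: ln_increasing; nra.
  have l2 : ln m - ln x <= - y / x.
  { rewrite -ln_div; try lra. apply: Rle_trans (ln_le_sub1 _ _) _; first by apply: Rdiv_lt_0_compat; lra.
    apply: (Rmult_le_reg_r x) => //. rewrite /Rdiv Rmult_minus_distr_r !Rmult_assoc Rinv_l; lra. }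
  have l3 : t * (- y / x) <= - y.
  { apply: (Rmult_le_reg_r x) => //. rewrite (_ : t * (- y / x) * x = t * - y); last by field; lra. nra. }
  have l4 := Rmult_le_compat_l t _ _ ltac:(lra) l2. have l5 := Rmult_lt_compat_l t _ _ t0 l1. lra.
Qed.
End Zmap.

(** * The contour *)

Section Contour.
Variables t X0 : R.
Hypothesis t0 : 0 < t.
Hypothesis X03 : 3 <= X0.
Hypothesis X06 : 6 * t <= X0.
Hypothesis Zex : forall X Y, X0 <= X -> -1 <= Y <= t * ln X + 1 ->
  exists z, X - 2 * t <= Re z /\ Wm t z = (X, Y) /\ (Y <= t * ln X -> Im z <= 0).
Variables A B dl : R.
Hypothesis XA : X0 < A.
Hypothesis AB : A < B.
Hypothesis dl0 : 0 < dl.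
Hypothesis dlA : dl < t * ln A.

Notation Z := (Zm t X0).
Notation W := (Wm t).
Notation TA := (t * ln A).
Notation TB := (t * ln B).

(** The differential q dz in the coordinate w = W z; the factor is the derivative of the inverse of
    W. *)
Definition pullback (q : C -> C) (w : C) : C := (q (Z w) * / Wd t (Z w))%C.

(* The integral along the boundary of the region A <= X <= B, dl <= Y, Im z <= 0,
   taken counterclockwise; three sides are parametrised in the W-plane. *)
Definition oint (q : C -> C) : C :=
  (HI (pullback q) dl A B + VI (pullback q) B dl TB - HI q 0 A B - VI (pullback q) A dl TA)%C.

(** The last clause is the image of the real segment from A to B, the curved top side of the region
    in the W-plane. *)
Definition cw (w : C) : Prop :=
  (Im w = dl /\ A <= Re w <= B) \/ (Re w = B /\ dl <= Im w <= TB) \/ (Re w = A /\ dl <= Im w <= TA) \/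
  (A <= Re w <= B /\ Im w = t * ln (Re w)).
Definition cz (z : C) : Prop := exists w, cw w /\ z = Z w.

Lemma lnA_le x : A <= x -> TA <= t * ln x.
Proof.
  move=> h. apply: Rmult_le_compat_l; first lra. case: (Req_dec A x) => [->|n]; first lra.
  left. apply: ln_increasing; lra.
Qed.

Lemma ABT : TA <= TB.
Proof. apply: lnA_le. lra. Qed.

Lemma cw_D w : cw w -> Dm t X0 w /\ dl <= Im w <= t * ln (Re w).
Proof.
  have h1 := ABT. have h2 := lnA_le (Re w).
  rewrite /cw /Dm. case=> [[e [l1 l2]]|[[e l]|[[e l]|[[l1 l2] e]]]]; rewrite ?e; try (rewrite e in h2); have := h2; intuition lra.
Qed.

Lemma cz_half z : cz z -> 4 * t <= Re z /\ Im z <= 0 /\ cw (W z) /\ Z (W z) = z /\ A - 2 * t <= Re z.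
Proof.
  move=> [w [hw ->]]. have [hD hI] := cw_D w hw.
  have [s1 s2] := Zm_spec t X0 Zex w hD. have [r1 r2] := Zm_region t X0 t0 X06 Zex w hD ltac:(lra).
  rewrite s2. split; first lra. split => //. split => //. split => //.
  have : A <= Re w by move: hw; rewrite /cw; lra. lra.
Qed.

Lemma pull_cont q w : Dm t X0 w -> ccont q (Z w) -> ccont (pullback q) w.
Proof.
  move=> hD hq. have hc := Zm_cont t X0 t0 X06 Zex w hD. have hh := Zm_half t X0 X06 Zex w hD.
  apply: continuous_Cmult; first exact: (continuous_comp Z q).
  apply: continuous_Cinv; last exact: (Wd_nz t t0).
  apply: continuous_Cplus; first exact: continuous_const.
  apply: continuous_Cmult; first exact: continuous_const.
  apply: continuous_Cinv => // e. move: hh. rewrite e /=. lra.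
Qed.

Lemma bottom_cw x : Rmin A B <= x <= Rmax A B -> cw (pt x dl).
Proof. rewrite Rmin_left ?Rmax_right; try lra. move=> h. left. rewrite /=. lra. Qed.
Lemma right_cw y : Rmin dl TB <= y <= Rmax dl TB -> cw (pt B y).
Proof. have := ABT. move=> h. rewrite Rmin_left ?Rmax_right; try lra. move=> h'. right. left. rewrite /=. lra. Qed.
Lemma left_cw y : Rmin dl TA <= y <= Rmax dl TA -> cw (pt A y).
Proof. rewrite Rmin_left ?Rmax_right; try lra. move=> h'. right. right. left. rewrite /=. lra. Qed.
Lemma top_cw x : Rmin A B <= x <= Rmax A B -> cw (pt x (t * ln x)) /\ Z (pt x (t * ln x)) = RtoC x.
Proof.
  rewrite Rmin_left ?Rmax_right; try lra. move=> h'. split; first by right; right; right; rewrite /=; lra.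
  apply: (Zm_real t X0 t0 X03 X06 Zex); lra.
Qed.
Lemma top_cz x : Rmin A B <= x <= Rmax A B -> cz (pt x 0).
Proof. move=> h. have [h1 h2] := top_cw x h. exists (pt x (t * ln x)). by rewrite h2. Qed.

Lemma oint_conts q : (forall z, cz z -> ccont q z) ->
  hcont (pullback q) dl A B /\ vcont (pullback q) B dl TB /\ hcont q 0 A B /\ vcont (pullback q) A dl TA.
Proof.
  move=> hq. have hp : forall w, cw w -> ccont (pullback q) w.
  { move=> w hw. apply: pull_cont; first exact: (proj1 (cw_D w hw)). apply: hq. by exists w. }
  split; [|split; [|split]].
  - move=> x hx. apply: hp. exact: bottom_cw.
  - move=> x hx. apply: hp. exact: right_cw.
  - move=> x hx. apply: hq. exact: top_cz.
  - move=> x hx. apply: hp. exact: left_cw.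
Qed.

Lemma oint_ext q1 q2 : (forall z, cz z -> q1 z = q2 z) -> oint q1 = oint q2.
Proof.
  move=> h. have hp : forall w, cw w -> pullback q1 w = pullback q2 w by move=> w hw; rewrite /pullback h //; exists w.
  rewrite /oint. congr (_ + _ - _ - _)%C.
  - apply: HI_ext => x hx. apply: hp. apply: bottom_cw. lra.
  - apply: VI_ext => x hx. apply: hp. apply: right_cw. lra.
  - apply: HI_ext => x hx. apply: h. apply: top_cz. lra.
  - apply: VI_ext => x hx. apply: hp. apply: left_cw. lra.
Qed.

Lemma oint_plus q1 q2 : (forall z, cz z -> ccont q1 z) -> (forall z, cz z -> ccont q2 z) ->
  oint (fun z => q1 z + q2 z)%C = (oint q1 + oint q2)%C.
Proof.
  move=> h1 h2. have [a1 [a2 [a3 a4]]] := oint_conts q1 h1. have [b1 [b2 [b3 b4]]] := oint_conts q2 h2.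
  rewrite /oint (HI_ext (pullback (fun z => q1 z + q2 z)%C) (fun w => pullback q1 w + pullback q2 w)%C).
  2: by move=> s _; rewrite /pullback; ring.
  rewrite !(VI_ext (pullback (fun z => q1 z + q2 z)%C) (fun w => pullback q1 w + pullback q2 w)%C).
  2,3: by move=> s _; rewrite /pullback; ring.
  rewrite !HI_plus // !VI_plus //. ring.
Qed.

Lemma oint_scal c q : (forall z, cz z -> ccont q z) -> oint (fun z => c * q z)%C = (c * oint q)%C.
Proof.
  move=> h1. have [a1 [a2 [a3 a4]]] := oint_conts q h1.
  rewrite /oint (HI_ext (pullback (fun z => c * q z)%C) (fun w => c * pullback q w)%C).
  2: by move=> s _; rewrite /pullback; ring.
  rewrite !(VI_ext (pullback (fun z => c * q z)%C) (fun w => c * pullback q w)%C).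
  2,3: by move=> s _; rewrite /pullback; ring.
  rewrite !HI_scal // !VI_scal //. ring.
Qed.

Lemma pull_prim G q w : Dm t X0 w -> cder G (Z w) (q (Z w)) -> cder (fun w => G (Z w)) w (pullback q w).
Proof. move=> hD hG. apply: (cder_comp G Z) => //. exact: (Zm_cder t X0 t0 X06 Zex). Qed.

(** Two primitives, [Gb] on the bottom and [Gr] on the three other sides, leave only their
    differences at the two bottom corners. With two branches of log (W - W a) this produces the
    winding number about W a. *)
Lemma oint_prim2 Gb Gr q : (forall z, cz z -> ccont q z) ->
  (forall z, cz z -> Im (W z) = dl -> cder Gb z (q z)) ->
  (forall z, cz z -> (Re (W z) = B \/ Re (W z) = A \/ Im (W z) = t * ln (Re (W z))) -> cder Gr z (q z)) ->
  oint q = ((Gb (Z (pt B dl)) - Gr (Z (pt B dl))) - (Gb (Z (pt A dl)) - Gr (Z (pt A dl))))%C.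
Proof.
  move=> hq hb hr. have [a1 [a2 [a3 a4]]] := oint_conts q hq.
  have WZ : forall w, cw w -> W (Z w) = w by move=> w hw; exact: (proj2 (Zm_spec t X0 Zex w (proj1 (cw_D w hw)))).
  rewrite /oint (HI_prim (fun w => Gb (Z w)) (pullback q)) //; last first.
  { move=> x hx. have c := bottom_cw x hx. apply: pull_prim; first exact: (proj1 (cw_D _ c)).
    apply: hb; [by exists (pt x dl) | by rewrite WZ]. }
  rewrite (VI_prim (fun w => Gr (Z w)) (pullback q)) //; last first.
  { move=> x hx. have c := right_cw x hx. apply: pull_prim; first exact: (proj1 (cw_D _ c)).
    apply: hr; [by exists (pt B x) | rewrite WZ //; by left]. }
  rewrite (VI_prim (fun w => Gr (Z w)) (pullback q)) //; last first.
  { move=> x hx. have c := left_cw x hx. apply: pull_prim; first exact: (proj1 (cw_D _ c)).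
    apply: hr; [by exists (pt A x) | rewrite WZ //; by right; left]. }
  rewrite (HI_prim Gr q) //; last first.
  { move=> x hx. have [c zc] := top_cw x hx. have e : pt x 0 = Z (pt x (t * ln x)) by rewrite zc.
    rewrite e. apply: hr; [by exists (pt x (t * ln x)) | rewrite WZ //; by right; right]. }
  have zB := proj2 (top_cw B ltac:(rewrite Rmin_left ?Rmax_right; lra)).
  have zA := proj2 (top_cw A ltac:(rewrite Rmin_left ?Rmax_right; lra)).
  rewrite zA zB /pt -/(RtoC A) -/(RtoC B). ring.
Qed.

Lemma oint_prim G q : (forall z, cz z -> ccont q z) -> (forall z, cz z -> cder G z (q z)) -> oint q = RtoC 0.
Proof. move=> hq hG. rewrite (oint_prim2 G G) //; first ring; move=> z hz _; exact: hG. Qed.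

(* Its imaginary part (B - X)(Y - dl) is a positive harmonic function inside the region; it
   vanishes on the bottom and on the right side, so that after an integration by parts only
   upper bounds of ln |f| are needed there. *)
Definition weight (w : C) : C := (- RtoC (/ 2) * ((w - (B, dl)) * (w - (B, dl))))%C.

Lemma Im_Phi w : Im (weight w) = (B - Re w) * (Im w - dl).
Proof. rewrite /weight. Cre. field. Qed.
Lemma Re_Phi w : Re (weight w) = ((Im w - dl) ^ 2 - (B - Re w) ^ 2) / 2.
Proof. rewrite /weight. Cre. field. Qed.

Lemma Phi_cder w : cder weight w ((B, dl) - w)%C.
Proof.
  apply: (cder_eq _ _ (- RtoC (/2) * ((1 - 0) * (w - (B, dl)) + (w - (B, dl)) * (1 - 0)))%C).
  - apply: cder_scal. apply: (cder_mult (fun w => w - (B, dl))%C (fun w => w - (B, dl))%C);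
      apply: cder_minus; first [exact: cder_id | exact: cder_const].
  - rewrite (_ : (_ + _)%C = RtoC 2 * (w - (B, dl)))%C; last by ring.
    rewrite Cmult_assoc (_ : (- RtoC (/2) * RtoC 2 = -1)%C); first ring. apply C_ext => /=; field.
Qed.

Lemma W_cdiff z : 0 < Re z -> cdiff W z.
Proof. move=> h. exists (Wd t z). exact: W_cder. Qed.

Lemma PhiW_cdiff z : 0 < Re z -> cdiff (fun z => weight (W z)) z.
Proof. move=> h. have [d hd] := W_cdiff z h. eexists. apply: (cder_comp weight W); [exact hd | exact: Phi_cder]. Qed.

Lemma Wd_cdiff z : 0 < Re z -> cdiff (Wd t) z.
Proof.
  move=> h. have nz : z <> RtoC 0 by move=> e; move: h; rewrite e /=; lra.
  apply: (cdiff_plus (fun _ => RtoC 1)); first exact: cdiff_const.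
  apply: (cdiff_mult (fun _ => Ci * RtoC t)%C); first exact: cdiff_const. apply: (cdiff_inv (fun z => z)) => //. exact: cdiff_id.
Qed.

Definition inside (a : C) : Prop := A < Re (W a) < B /\ dl < Im (W a).

(** The weight at W z minus the weight at W a is divisible by W z - W a, with a quotient affine in W
    whose product with W' has a primitive; so the weight may be frozen at W a. There remains the
    winding number, computed with [Lup] on the bottom and [Ldown] elsewhere if a is inside, and with
    [Ldown] throughout if not. By [W_below] the top side lies strictly above W a, hence off the cut
    of [Ldown]. *)
Lemma oint_log_W a : 4 * t <= Re a -> Im a < 0 -> (Re (W a) = A -> Im (W a) < dl) -> Re (W a) <> B -> Im (W a) <> dl ->
  (inside a -> oint (fun z => Wd t z * / (W z - W a) * weight (W z))%C = (C2pi * weight (W a))%C) /\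
  (~ inside a -> oint (fun z => Wd t z * / (W z - W a) * weight (W z))%C = RtoC 0).
Proof.
  move=> ha ia nA nB nd. have bel := W_below t t0 a ha ia.
  have ne : forall z, cz z -> W z <> W a.
  { move=> z hz e. have [_ [_ [c _]]] := cz_half z hz. rewrite e /cw in c. intuition lra. }
  have pos : forall z, cz z -> 0 < Re z by move=> z hz; have := proj1 (cz_half z hz); lra.
  set c0 := ((B, dl) : C). set wa := W a.
  set q1 := fun z => (weight wa * (Wd t z * / (W z - wa)))%C.
  set q2 := fun z => (- RtoC (/2) * (Wd t z * (W z + (wa - c0 - c0))))%C.
  have invc : forall z, cz z -> cdiff (fun z => / (W z - wa))%C z.
  { move=> z hz. apply: (cdiff_inv (fun z => W z - wa)%C).
    - apply: (cdiff_plus W (fun _ => - wa)%C); [apply: W_cdiff; exact: pos | exact: cdiff_const].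
    - apply: Cminus_nz. exact: ne. }
  have c1' : forall z, cz z -> ccont (fun z => Wd t z * / (W z - wa))%C z.
  { move=> z hz. apply: cdiff_cont. apply: (cdiff_mult (Wd t)); [apply: Wd_cdiff; exact: pos | exact: invc]. }
  have c1 : forall z, cz z -> ccont q1 z.
  { move=> z hz. apply: continuous_Cmult; [exact: continuous_const | exact: c1']. }
  have c2' : forall z, cz z -> ccont (fun z => Wd t z * (W z + (wa - c0 - c0)))%C z.
  { move=> z hz. apply: cdiff_cont. apply: (cdiff_mult (Wd t)); first by apply: Wd_cdiff; exact: pos.
    apply: (cdiff_plus W (fun _ => wa - c0 - c0)%C); [apply: W_cdiff; exact: pos | exact: cdiff_const]. }
  have c2 : forall z, cz z -> ccont q2 z.
  { move=> z hz. apply: continuous_Cmult; [exact: continuous_const | exact: c2']. }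
  have -> : oint (fun z => Wd t z * / (W z - wa) * weight (W z))%C = (oint q1 + oint q2)%C.
  { rewrite -oint_plus //. apply: oint_ext => z hz. rewrite /q1 /q2 /weight -/c0. field. apply: Cminus_nz. exact: ne. }
  have -> : oint q2 = RtoC 0.
  { rewrite oint_scal // (oint_prim (fun z => RtoC (/2) * (W z * W z) + (wa - c0 - c0) * W z)%C) //; first ring.
    move=> z hz. have hW := W_cder t z (pos z hz).
    apply: (cder_eq _ _ (RtoC (/2) * (Wd t z * W z + W z * Wd t z) + (wa - c0 - c0) * Wd t z)%C).
    - apply: cder_plus; apply: cder_scal => //. exact: cder_mult.
    - have h2 : (RtoC (/2) * RtoC 2 = 1)%C by apply C_ext => /=; field.
      transitivity ((RtoC (/2) * RtoC 2) * (Wd t z * W z) + (wa - c0 - c0) * Wd t z)%C; first ring. rewrite h2. ring. }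
  rewrite oint_scal // Cplus_0_r.
  have hdown : forall z, cz z -> (Re (W z) <> Re wa \/ Im wa < Im (W z)) -> cder (fun z => Ldown (W z - wa))%C z (Wd t z * / (W z - wa))%C.
  { move=> z hz h. apply: (cder_eq _ _ (/ (W z - wa) * (Wd t z - 0))%C); last by ring.
    apply: (cder_comp Ldown (fun z => W z - wa)%C).
    - apply: cder_minus; [exact: (W_cder t z (pos z hz)) | exact: cder_const].
    - apply: Ldown_cder. Cre; lra. }
  split => h.
  - have [[i1 i2] i3] := h.
    rewrite (oint_prim2 (fun z => Lup (W z - wa))%C (fun z => Ldown (W z - wa))%C) //.
    + have DB := bottom_cw B ltac:(rewrite Rmin_left ?Rmax_right; lra). have DA := bottom_cw A ltac:(rewrite Rmin_left ?Rmax_right; lra).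
      rewrite (proj2 (Zm_spec t X0 Zex _ (proj1 (cw_D _ DB)))) (proj2 (Zm_spec t X0 Zex _ (proj1 (cw_D _ DA)))).
      rewrite Lup_Ldown_right; last by rewrite /wa; Cre; lra. rewrite Lup_Ldown_left; last by rewrite /wa; Cre; lra.
      rewrite Cmult_comm. congr Cmult. apply C_ext => /=; ring.
    + move=> z hz e. apply: (cder_eq _ _ (/ (W z - wa) * (Wd t z - 0))%C); last by ring.
      apply: (cder_comp Lup (fun z => W z - wa)%C).
      * apply: cder_minus; [exact: (W_cder t z (pos z hz)) | exact: cder_const].
      * apply: Lup_cder. left. rewrite -/wa in i3. Cre; lra.
    + move=> z hz hs. apply: hdown => //. rewrite -/wa in i1 i2 bel. case: (Req_dec (Re (W z)) (Re wa)) => e; last by left.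
      right. case: hs => [e'|[e'|e']]; try lra. rewrite e' e. lra.
  - rewrite (oint_prim (fun z => Ldown (W z - wa))%C) //; first ring.
    move=> z hz. apply: hdown => //. have [_ [_ [c _]]] := cz_half z hz. have [_ c'] := cw_D _ c.
    rewrite -/wa in nA nB nd. case: (Req_dec (Re (W z)) (Re wa)) => e; last by left. right.
    have cr : A <= Re (W z) <= B by move: c; rewrite /cw; lra.
    apply: Rnot_le_lt => hle. apply: h. rewrite /inside -/wa. lra.
Qed.
End Contour.

(** * The residue sum *)

Definition logder (f : C -> C) (z : C) : C := (C_derive f z * / f z)%C.
Definition ldsum (m : list C) (z : C) : C := fold_right (fun a acc => (/ (z - a) + acc)%C) (RtoC 0) m.
Definition Rsum (F : C -> R) (m : list C) : R := fold_right (fun a acc => F a + acc) 0 m.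
Definition Pdec (P : Prop) : {P} + {~ P} := excluded_middle_informative P.

Lemma C_derive_spec f z : cdiff f z -> cder f z (C_derive f z).
Proof. move=> [d hd]. by rewrite (cder_C_derive _ _ _ hd). Qed.

Lemma logder_prodl m z : ~ In z m -> cder (prodl m) z (prodl m z * ldsum m z)%C.
Proof.
  elim: m => [|a m IH] h.
  - apply: (cder_eq _ _ 0%C); last by rewrite /=; ring. exact: cder_const.
  - have {}IH := IH (fun hi => h (or_intror hi)).
    have n : (z - a)%C <> RtoC 0 by apply: Cminus_nz => e; apply: h; left.
    apply: (cder_eq _ _ ((1 - 0) * prodl m z + (z - a) * (prodl m z * ldsum m z))%C).
    + apply: (cder_mult (fun z => z - a)%C (prodl m)) => //. apply: cder_minus; [exact: cder_id | exact: cder_const].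
    + rewrite /=. field. exact: n.
Qed.

Lemma logder_factor f m h z : (forall w, f w = (prodl m w * h w)%C) -> cdiff h z -> h z <> RtoC 0 -> ~ In z m ->
  logder f z = (ldsum m z + logder h z)%C.
Proof.
  move=> ef hh nz ni. have np := prodl_neq0 m z ni.
  have hd : cder f z (prodl m z * ldsum m z * h z + prodl m z * C_derive h z)%C.
  { apply: (cder_ext_loc (fun w => prodl m w * h w)%C).
    - apply: filter_forall => w. by rewrite ef.
    - apply: cder_mult; [exact: logder_prodl | exact: C_derive_spec]. }
  rewrite /logder (cder_C_derive _ _ _ hd) ef. field. by split.
Qed.

Section Residue.
Variables t X0 : R.
Hypothesis t0 : 0 < t.
Hypothesis X03 : 3 <= X0.
Hypothesis X06 : 6 * t <= X0.
Hypothesis Zex : forall X Y, X0 <= X -> -1 <= Y <= t * ln X + 1 ->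
  exists z, X - 2 * t <= Re z /\ Wm t z = (X, Y) /\ (Y <= t * ln X -> Im z <= 0).
Variables A B dl : R.
Hypothesis XA : X0 < A.
Hypothesis AB : A < B.
Hypothesis dl0 : 0 < dl.
Hypothesis dlA : dl < t * ln A.
Variables xl xr yl yr : R.
Hypothesis xl4 : 4 * t <= xl.
Notation Bx := (in_box xl xr yl yr).
Hypothesis contour_box : forall z, cz t X0 A B dl z -> Bx z.

Notation W := (Wm t).
Notation oint := (oint t X0 A B dl).
Notation cz := (cz t X0 A B dl).
Notation Phi := (weight B dl).
Notation inside := (inside t A B dl).

Lemma oint_hol q : (forall z, Bx z -> cdiff q z) -> oint q = RtoC 0.
Proof.
  move=> hq. have [G hG] := primitive_box q xl xr yl yr hq.
  apply: (oint_prim t X0 t0 X03 X06 Zex A B dl XA AB dl0 dlA G) => z hz.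
  - apply: cdiff_cont. apply: hq. exact: contour_box.
  - apply: hG. exact: contour_box.
Qed.

Lemma Bx_pos z : Bx z -> 4 * t <= Re z /\ 0 < Re z.
Proof. rewrite /in_box. lra. Qed.

Lemma logder_cdiff k z : (forall z, Bx z -> cdiff k z) -> (forall z, Bx z -> k z <> RtoC 0) -> Bx z -> cdiff (logder k) z.
Proof.
  move=> hk nk hz. apply: (cdiff_mult (C_derive k) (fun z => / k z)%C).
  - apply: derive_cdiff. exact: box_near hk hz.
  - apply: cdiff_inv; [exact: hk | exact: nk].
Qed.

Lemma oint_logder_hol k : (forall z, Bx z -> cdiff k z) -> (forall z, Bx z -> k z <> RtoC 0) ->
  oint (fun z => logder k z * Phi (W z))%C = RtoC 0.
Proof.
  move=> hk nk. apply: oint_hol => z hz. apply: cdiff_mult; first exact: logder_cdiff.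
  apply: PhiW_cdiff => //. exact: (proj2 (Bx_pos z hz)).
Qed.

Definition generic a := Im a < 0 /\ (Bx a -> (Re (W a) = A -> Im (W a) < dl) /\ Re (W a) <> B /\ Im (W a) <> dl).

Lemma generic_off a z : generic a -> cz z -> z <> a.
Proof.
  move=> [ia g] hz e. have hb := contour_box z hz. rewrite e in hb. have {g}[g1 [g2 g3]] := g hb.
  have bel := W_below t t0 a (proj1 (Bx_pos _ hb)) ia.
  have [_ [_ [c _]]] := cz_half t X0 t0 X06 Zex A B dl XA AB dl0 dlA z hz. rewrite e /cw in c. intuition lra.
Qed.

(** W z - W a = k z (z - a) with k the slope of W at a, which is holomorphic and without zeros in
    the box. Hence W' / (W - W a) = 1 / (z - a) + k' / k, and the last term contributes nothing: the
    winding number computed in the W-plane is transferred to the z-plane. *)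
Lemma oint_inv a : generic a ->
  (Bx a /\ inside a -> oint (fun z => / (z - a) * Phi (W z))%C = (C2pi * Phi (W a))%C) /\
  (~ (Bx a /\ inside a) -> oint (fun z => / (z - a) * Phi (W z))%C = RtoC 0).
Proof.
  move=> ga. have off := fun z => generic_off a z ga.
  case: (classic (Bx a)) => ba; last first.
  { split => [[]//|_]. apply: oint_hol => z hz. apply: cdiff_mult.
    - apply: (cdiff_inv (fun z => z - a)%C); first exact: cdiff_shift. apply: Cminus_nz => e. apply: ba. by rewrite -e.
    - apply: PhiW_cdiff => //. exact: (proj2 (Bx_pos z hz)). }
  have [ia g] := ga. have {g}[g1 [g2 g3]] := g ba. have [pa1 pa2] := Bx_pos a ba.
  set k := slope W a (Wd t a).
  have Wc : forall z, Bx z -> cder W z (Wd t z) by move=> z hz; apply: W_cder => //; exact: (proj2 (Bx_pos z hz)).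
  have kc : forall z, Bx z -> cdiff k z.
  { move=> z hz. case: (Ceq_dec z a) => [->|n].
    - apply: slope_cdiff; last exact: Wc. apply: filter_imp (in_box_locally _ _ _ _ _ ba) => w hw. exists (Wd t w). exact: Wc.
    - apply: slope_cder_off n. exact: Wc. }
  have kn : forall z, Bx z -> k z <> RtoC 0.
  { move=> z hz. apply: (Wslope_nz t t0) => //. exact: (proj1 (Bx_pos z hz)). }
  have e0 : oint (fun z => / (z - a) * Phi (W z))%C = oint (fun z => Wd t z * / (W z - W a) * Phi (W z))%C.
  { transitivity (oint (fun z => / (z - a) * Phi (W z) + logder k z * Phi (W z))%C).
    - rewrite (oint_plus t X0 t0 X03 X06 Zex A B dl XA AB dl0 dlA).
      + rewrite (oint_logder_hol k kc kn). ring.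
      + move=> z hz. apply: continuous_Cmult.
        * apply: ccont_inv_shift. exact: off.
        * apply: cdiff_cont. apply: PhiW_cdiff => //. exact: (proj2 (Bx_pos _ (contour_box z hz))).
      + move=> z hz. have hb := contour_box z hz. apply: continuous_Cmult; apply: cdiff_cont; first exact: logder_cdiff.
        apply: PhiW_cdiff => //. exact: (proj2 (Bx_pos _ hb)).
    - apply: (oint_ext t X0 t0 X03 X06 Zex A B dl XA AB dlA) => z hz. have hb := contour_box z hz.
      have n := Cminus_nz _ _ (off z hz). have nk := kn z hb.
      have eW : (W z - W a)%C = (k z * (z - a))%C by rewrite /k {1}(slope_eq W a (Wd t a) z); ring.
      have eD : Wd t z = (C_derive k z * (z - a) + k z)%C.
      { apply: (cder_unique W z); first exact: Wc.
        apply: (cder_ext_loc (fun w => W a + k w * (w - a))%C).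
        - apply: filter_forall => w. symmetry. exact: slope_eq.
        - apply: (cder_eq _ _ (0 + (C_derive k z * (z - a) + k z * (1 - 0)))%C); last by ring.
          apply: cder_plus; first exact: cder_const. apply: (cder_mult k (fun w => w - a)%C).
          + apply: C_derive_spec. exact: kc.
          + apply: cder_minus; [exact: cder_id | exact: cder_const]. }
      rewrite eW eD /logder. field. by split. }
  rewrite e0.
  have [r1 r2] := oint_log_W t X0 t0 X03 X06 Zex A B dl XA AB dl0 dlA a pa1 ia g1 g2 g3.
  split => [[_ h]|h]; first exact: r1. apply: r2 => hi. by apply: h.
Qed.

Definition resid (m : list C) : C :=
  fold_right (fun a acc => ((if Pdec (Bx a /\ inside a) then Phi (W a) else RtoC 0) + acc)%C) (RtoC 0) m.

Lemma ldsum_cdiff m z : ~ In z m -> cdiff (ldsum m) z.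
Proof.
  elim: m => [|a m IH] h; first exact: cdiff_const.
  apply: (cdiff_plus (fun z => / (z - a))%C).
  - apply: (cdiff_inv (fun z => z - a)%C); first exact: cdiff_shift. apply: Cminus_nz => e. apply: h. by left.
  - apply: IH => hi. apply: h. by right.
Qed.

Lemma oint_ldsum m : (forall a, In a m -> generic a) ->
  oint (fun z => ldsum m z * Phi (W z))%C = (C2pi * resid m)%C.
Proof.
  have Pc : forall z, cz z -> ccont (fun z => Phi (W z)) z.
  { move=> z hz. apply: cdiff_cont. apply: PhiW_cdiff => //. exact: (proj2 (Bx_pos _ (contour_box z hz))). }
  elim: m => [|a m IH] hg.
  - rewrite (oint_hol _) /=; first ring. move=> z hz. apply: (cdiff_ext_loc (fun _ => RtoC 0)); last exact: cdiff_const.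
    apply: filter_forall => w /=. Cring.
  - have ga := hg a (or_introl eq_refl). have [r1 r2] := oint_inv a ga.
    have {}IH := IH (fun b hb => hg b (or_intror hb)).
    transitivity (oint (fun z => / (z - a) * Phi (W z) + ldsum m z * Phi (W z))%C).
    + apply: (oint_ext t X0 t0 X03 X06 Zex A B dl XA AB dlA) => z hz /=. ring.
    + rewrite (oint_plus t X0 t0 X03 X06 Zex A B dl XA AB dl0 dlA).
      * rewrite IH /=. case: Pdec => h; [rewrite r1 // | rewrite r2 //]; ring.
      * move=> z hz. apply: continuous_Cmult; last exact: Pc. apply: ccont_inv_shift. exact: generic_off.
      * move=> z hz. apply: continuous_Cmult; last exact: Pc. apply: cdiff_cont. apply: ldsum_cdiff => hi.
        by apply: (generic_off z z (hg z (or_intror hi)) hz).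
Qed.

(** The real part is the one in which ln |f| appears on the straight sides where the weight is real;
    and Re (2 pi i c) = - 2 pi Im c turns the weights at the zeros into the positive numbers (B -
    X)(Y - dl). *)
Theorem residue_sum f m h : (forall w, f w = (prodl m w * h w)%C) ->
  (forall z, Bx z -> cdiff h z) -> (forall z, Bx z -> h z <> RtoC 0) -> (forall a, In a m -> generic a) ->
  Re (oint (fun z => logder f z * Phi (W z))%C) =
  - (2 * PI) * Rsum (fun a => if Pdec (Bx a /\ inside a) then (B - Re (W a)) * (Im (W a) - dl) else 0) m.
Proof.
  move=> ef hh nh hg.
  have ni : forall z, cz z -> ~ In z m by move=> z hz hi; apply: (generic_off z z (hg z hi) hz).
  have Pc : forall z, cz z -> ccont (fun z => Phi (W z)) z.
  { move=> z hz. apply: cdiff_cont. apply: PhiW_cdiff => //. exact: (proj2 (Bx_pos _ (contour_box z hz))). }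
  have -> : oint (fun z => logder f z * Phi (W z))%C = (C2pi * resid m)%C.
  { transitivity (oint (fun z => logder h z * Phi (W z) + ldsum m z * Phi (W z))%C).
    - apply: (oint_ext t X0 t0 X03 X06 Zex A B dl XA AB dlA) => z hz.
      have hb := contour_box z hz. rewrite (logder_factor f m h z ef (hh z hb) (nh z hb) (ni z hz)). ring.
    - rewrite (oint_plus t X0 t0 X03 X06 Zex A B dl XA AB dl0 dlA).
      + rewrite (oint_logder_hol h hh nh) (oint_ldsum m hg). ring.
      + move=> z hz. apply: continuous_Cmult; last exact: Pc. apply: cdiff_cont. apply: logder_cdiff => //. exact: contour_box.
      + move=> z hz. apply: continuous_Cmult; last exact: Pc. apply: cdiff_cont. apply: ldsum_cdiff. exact: ni. }
  have -> : Re (C2pi * resid m) = - (2 * PI) * Im (resid m) by rewrite /C2pi; Cre; ring.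
  congr Rmult. elim: m {ef hg ni} => [|a m IH] //=. rewrite -IH. case: Pdec => _; [rewrite -(Im_Phi B dl (W a)) | ]; reflexivity.
Qed.
End Residue.

(** * Bounds on the four sides *)

Lemma re_div (c w : C) : w <> RtoC 0 -> Re (c * / w) = (Re c * Re w + Im c * Im w) / (Re w ^ 2 + Im w ^ 2).
Proof. move=> /Csq_nz h. rewrite re_mult /Cinv. rewrite /Re /Im /= in h *. field. lra. Qed.

Lemma ln_Cmod_derive (F : C -> C) (p e d : C) s : cder F (p + RtoC s * e)%C d -> F (p + RtoC s * e)%C <> RtoC 0 ->
  is_derive (fun s => ln (Cmod (F (p + RtoC s * e)%C))) s (Re (d * / F (p + RtoC s * e) * e)%C).
Proof.
  move=> h nz. have [h1 h2] := cder_line _ _ _ _ _ h.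
  set u := fun s : R => Re (F (p + RtoC s * e)%C) in h1. set v := fun s : R => Im (F (p + RtoC s * e)%C) in h2.
  have m0 := proj1 (Cmod_gt_0 _) nz.
  have e2 : (u s ^ 2 + v s ^ 2) = Cmod (F (p + RtoC s * e)%C) ^ 2 by rewrite Cmod2_alt.
  have p2 : 0 < u s ^ 2 + v s ^ 2 by rewrite e2; apply: pow_lt.
  have eq : forall s, ln (Cmod (F (p + RtoC s * e)%C)) = ln (sqrt (u s ^ 2 + v s ^ 2)) by [].
  apply: (is_derive_ext (fun s => ln (sqrt (u s ^ 2 + v s ^ 2)))); first by move=> r.
  have s0 := sqrt_lt_R0 _ p2. have s2 := sqrt_sqrt _ (Rlt_le _ _ p2).
  have x1 : ex_derive u s by eexists; exact: h1. have x2 : ex_derive v s by eexists; exact: h2.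
  have D1 : Derive u s = Re (d * e) by exact: is_derive_unique. have D2 : Derive v s = Im (d * e) by exact: is_derive_unique.
  simpl in p2, s0, s2. auto_derive; first by repeat split => //; lra.
  rewrite D1 D2. set r := sqrt _ in s0 s2 *.
  have er : (d * / F (p + RtoC s * e) * e)%C = (d * e * / F (p + RtoC s * e))%C by ring.
  rewrite er. rewrite (_ : Re (d * e * / F (p + RtoC s * e)%C)%C = (Re (d * e) * u s + Im (d * e) * v s) / (u s ^ 2 + v s ^ 2)).
  - rewrite (_ : u s ^ 2 + v s ^ 2 = r * r); last by rewrite s2. field. lra.
  - exact: re_div.
Qed.

Lemma RInt_parts (u u' v v' : R -> R) a b : a <= b ->
  (forall x, a <= x <= b -> is_derive u x (u' x)) -> (forall x, a <= x <= b -> is_derive v x (v' x)) ->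
  (forall x, a <= x <= b -> continuous u' x) -> (forall x, a <= x <= b -> continuous v' x) ->
  RInt (fun x => u' x * v x) a b = u b * v b - u a * v a - RInt (fun x => u x * v' x) a b.
Proof.
  move=> ab hu hv cu cv.
  have cu0 : forall x, a <= x <= b -> continuous u x by move=> x hx; apply: ex_derive_continuousR; eexists; exact: hu.
  have cv0 : forall x, a <= x <= b -> continuous v x by move=> x hx; apply: ex_derive_continuousR; eexists; exact: hv.
  have c1 : forall x, a <= x <= b -> continuous (fun x => u' x * v x) x.
  { move=> x hx. apply: continuous_multR; [exact: cu | exact: cv0]. }
  have c2 : forall x, a <= x <= b -> continuous (fun x => u x * v' x) x.
  { move=> x hx. apply: continuous_multR; [exact: cu0 | exact: cv]. }
  have x1 : ex_RInt (fun x => u' x * v x) a b by apply: ex_RInt_continuousR => // x hx; exact: c1.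
  have x2 : ex_RInt (fun x => u x * v' x) a b by apply: ex_RInt_continuousR => // x hx; exact: c2.
  have e : RInt (fun x => u' x * v x + u x * v' x) a b = u b * v b - u a * v a.
  { apply: is_RInt_unique. apply: (is_RInt_derive (V:=R_CompleteNormedModule) (fun x => u x * v x)) => x; rewrite Rmin_left // Rmax_right // => hx.
    - have := is_derive_mult (K:=R_AbsRing) u v x _ _ (hu x hx) (hv x hx). apply. exact: Rmult_comm.
    - apply: continuous_plusR; [exact: c1 | exact: c2]. }
  have h : u b * v b - u a * v a = RInt (fun x => u' x * v x) a b + RInt (fun x => u x * v' x) a b.
  { rewrite -e. exact: (RInt_plus (V:=R_CompleteNormedModule) _ _ a b x1 x2). }
  lra.
Qed.

Lemma RInt_parts_bound (u u' v v' : R -> R) a b U V V' : a <= b ->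
  (forall x, a <= x <= b -> is_derive u x (u' x)) -> (forall x, a <= x <= b -> is_derive v x (v' x)) ->
  (forall x, a <= x <= b -> continuous u' x) -> (forall x, a <= x <= b -> continuous v' x) ->
  (forall x, a <= x <= b -> Rabs (u x) <= U /\ Rabs (v x) <= V /\ Rabs (v' x) <= V') ->
  Rabs (RInt (fun x => u' x * v x) a b) <= U * (2 * V + (b - a) * V').
Proof.
  move=> ab hu hv cu cv hb. rewrite (RInt_parts u u' v v') //.
  have [a1 [a2 a3]] := hb a ltac:(lra). have [b1 [b2 b3]] := hb b ltac:(lra).
  have U0 : 0 <= U by have := Rabs_pos (u a); lra.
  have k1 : Rabs (u b * v b) <= U * V by rewrite Rabs_mult; apply: Rmult_le_compat => //; exact: Rabs_pos.
  have k2 : Rabs (u a * v a) <= U * V by rewrite Rabs_mult; apply: Rmult_le_compat => //; exact: Rabs_pos.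
  have k3 : Rabs (RInt (fun x => u x * v' x) a b) <= (b - a) * (U * V').
  { apply: abs_RInt_le_const => //.
    - apply: ex_RInt_continuousR => // x hx.
      apply: continuous_multR; last exact: cv.
      apply: ex_derive_continuousR; eexists; exact: hu.
    - move=> x hx. have [h1 [h2 h3]] := hb x hx. rewrite Rabs_mult; apply: Rmult_le_compat => //; exact: Rabs_pos. }
  have t1 := Rabs_triang (u b * v b - u a * v a) (- RInt (fun x => u x * v' x) a b). rewrite Rabs_Ropp in t1.
  have t2 := Rabs_triang (u b * v b) (- (u a * v a)). rewrite Rabs_Ropp in t2. rewrite /Rminus in t1 *. lra.
Qed.

(** * The integral of f'/f along the real axis *)

Section RealAxis.
Variables (rho : nat) (f : C -> C).
Hypothesis hF : class_F rho f.

Definition Lg (x : R) : C := CI (fun s => logder f (RtoC s)) 0 x.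

Lemma F_cdiff_near z : Im z <= 0 -> cdiff_near f z.
Proof. move=> h. apply: holo_at_near. exact: F_holomorphic hF z h. Qed.

Lemma F_cdiff z : Im z <= 0 -> cdiff f z.
Proof. move=> h. exact: locally_singleton (F_cdiff_near z h). Qed.

Lemma F_logder_cdiff z : Im z <= 0 -> f z <> RtoC 0 -> cdiff (logder f) z.
Proof.
  move=> h nz. apply: (cdiff_mult (C_derive f) (fun z => / f z)%C).
  - apply: derive_cdiff. exact: F_cdiff_near.
  - apply: cdiff_inv => //. exact: F_cdiff.
Qed.

Lemma real_pcont s : pcont (fun s => logder f (RtoC s)) s.
Proof.
  apply: (continuous_ext (fun x => logder f (pt x 0))); first by [].
  apply: pcont_h. apply: cdiff_cont. apply: F_logder_cdiff; [rewrite /=; lra | exact: F_nonzero hF s].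
Qed.

Lemma Lg_RInt x : RInt (V := C_R_CompleteNormedModule) (fun s : R => Cdiv (C_derive f (RtoC s)) (f (RtoC s))) 0 x = Lg x.
Proof.
  apply: is_RInt_unique. apply: (is_RInt_fct_extend_pair (U:=R_NormedModule) (V:=R_NormedModule)).
  - apply: RInt_correct. apply: (ex_RInt_Re (fun s => logder f (RtoC s))) => s _. exact: real_pcont.
  - apply: RInt_correct. apply: (ex_RInt_Im (fun s => logder f (RtoC s))) => s _. exact: real_pcont.
Qed.

Lemma Lg_Re_derive x : is_derive (fun x => Re (Lg x)) x (Re (logder f (RtoC x))).
Proof.
  apply: (is_derive_RInt (V:=R_NormedModule) (fun s => Re (logder f (RtoC s))) _ 0).
  - apply: filter_forall => b. apply: (RInt_correct (V:=R_CompleteNormedModule)). apply: ex_RInt_Re => s _. exact: real_pcont.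
  - apply: continuous_Re. exact: real_pcont.
Qed.

Lemma Lg_Im_derive x : is_derive (fun x => Im (Lg x)) x (Im (logder f (RtoC x))).
Proof.
  apply: (is_derive_RInt (V:=R_NormedModule) (fun s => Im (logder f (RtoC s))) _ 0).
  - apply: filter_forall => b. apply: (RInt_correct (V:=R_CompleteNormedModule)). apply: ex_RInt_Im => s _. exact: real_pcont.
  - apply: continuous_Im. exact: real_pcont.
Qed.

(** Through this identity the bound on the integral of f'/f becomes a lower bound of |f| at real
    points. It is needed at the upper end of the right side and, for t = 0, along the positive
    axis. *)
Lemma ln_f_real x : 0 <= x -> ln (Cmod (f (RtoC x))) = ln (Cmod (f (RtoC 0))) + Re (Lg x).
Proof.
  move=> hx.
  have hd : forall s, is_derive (fun s => ln (Cmod (f (RtoC s)))) s (Re (logder f (RtoC s))).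
  { move=> s. have e : forall s, RtoC s = (0 + RtoC s * 1)%C by move=> r; ring.
    have hs : cdiff f (0 + RtoC s * 1)%C by rewrite -e; apply: F_cdiff; rewrite /=; lra.
    have := ln_Cmod_derive f 0 1 _ s (C_derive_spec _ _ hs). rewrite -e => h.
    apply: (is_derive_ext (fun s => ln (Cmod (f (0 + RtoC s * 1)%C)))); first by move=> r; rewrite -e.
    have -> : Re (logder f s) = Re (C_derive f s * / f s * 1)%C by congr Re; rewrite /logder; ring.
    apply: h. exact: F_nonzero hF s. }
  have h1 : RInt (fun s => Re (logder f (RtoC s))) 0 x = ln (Cmod (f (RtoC x))) - ln (Cmod (f (RtoC 0))).
  { apply: is_RInt_unique. apply: (is_RInt_derive (V:=R_CompleteNormedModule) (fun s => ln (Cmod (f (RtoC s))))) => s _; first exact: hd.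
    apply: continuous_Re. exact: real_pcont. }
  rewrite /Lg /CI. rewrite [Re _]/= h1. ring.
Qed.
End RealAxis.

(** * Estimates on the individual sides of the contour *)

Section Inequality.
Variables (rho : nat) (f : C -> C).
Hypothesis hF : class_F rho f.
Variables t X0 : R.
Hypothesis t0 : 0 < t.
Hypothesis X03 : 3 <= X0.
Hypothesis X06 : 6 * t <= X0.
Hypothesis Zex : forall X Y, X0 <= X -> -1 <= Y <= t * ln X + 1 ->
  exists z, X - 2 * t <= Re z /\ Wm t z = (X, Y) /\ (Y <= t * ln X -> Im z <= 0).
Hypothesis tln : forall x, X0 <= x -> 0 <= t * ln x <= x /\ (t * ln x) ^ 2 <= x.
Variables A B dl : R.
Hypothesis XA : X0 < A.
Hypothesis AB : A < B.
Hypothesis dl0 : 0 < dl.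
Hypothesis dlA : dl < t * ln A.
Notation Z := (Zm t X0).
Notation W := (Wm t).
Notation TA := (t * ln A).
Notation TB := (t * ln B).
Notation cz := (cz t X0 A B dl).
Notation cw := (cw t A B dl).
Notation Phi := (weight B dl).
Notation pull := (pullback t X0).
Notation lf := (pull (logder f)).
Hypothesis fnz : forall z, cz z -> f z <> RtoC 0.

Lemma pull_mod q w : Dm t X0 w -> Cmod (pull q w) <= 2 * Cmod (q (Z w)).
Proof.
  move=> hD. have hh := Zm_half t X0 X06 Zex w hD.
  rewrite /pullback Cmod_mult Cmod_inv; last exact: (Wd_nz t t0).
  have := proj1 (Wd_bound t t0 _ hh) => h. have h2 : / Cmod (Wd t (Z w)) <= / / 2 by apply: Rinv_le_contravar; lra.
  rewrite Rinv_inv in h2. have := Cmod_ge_0 (q (Z w)). nra.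
Qed.

Lemma lnF_derive w e : Dm t X0 w -> Im (Z w) <= 0 -> f (Z w) <> RtoC 0 -> forall p s, w = (p + RtoC s * e)%C ->
  is_derive (fun s => ln (Cmod (f (Z (p + RtoC s * e)%C)))) s (Re (lf w * e)%C).
Proof.
  move=> hD hi nz p s ew.
  have := ln_Cmod_derive (fun w => f (Z w)) p e (C_derive f (Z w) * / Wd t (Z w))%C s.
  rewrite -ew => h. rewrite (_ : lf w * e = C_derive f (Z w) * / Wd t (Z w) * / f (Z w) * e)%C; last by rewrite /pullback /logder; ring.
  apply: h => //. apply: (pull_prim t X0 t0 X06 Zex) => //. apply: C_derive_spec. exact: (F_cdiff rho f hF).
Qed.

Lemma lnF_h x y : Dm t X0 (pt x y) -> Im (Z (pt x y)) <= 0 -> f (Z (pt x y)) <> RtoC 0 ->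
  is_derive (fun x => ln (Cmod (f (Z (pt x y))))) x (Re (lf (pt x y))).
Proof.
  move=> hD hi nz. have := lnF_derive (pt x y) 1 hD hi nz (pt 0 y) x (pt_h x y).
  rewrite Cmult_1_r => h. apply: is_derive_ext h => s. by rewrite -pt_h.
Qed.

Lemma lnF_v x y : Dm t X0 (pt x y) -> Im (Z (pt x y)) <= 0 -> f (Z (pt x y)) <> RtoC 0 ->
  is_derive (fun y => ln (Cmod (f (Z (pt x y))))) y (- Im (lf (pt x y))).
Proof.
  move=> hD hi nz. have := lnF_derive (pt x y) Ci hD hi nz (pt x 0) y (pt_v x y).
  rewrite re_mult_Ci => h. apply: is_derive_ext h => s. by rewrite -pt_v.
Qed.

Lemma lf_cont w : Dm t X0 w -> Im (Z w) <= 0 -> f (Z w) <> RtoC 0 -> ccont lf w.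
Proof.
  move=> hD hi nz. apply: (pull_cont t X0 t0 X06 Zex) => //. apply: cdiff_cont. exact: (F_logder_cdiff rho f hF).
Qed.

Lemma cw_facts w : cw w -> Dm t X0 w /\ Im (Z w) <= 0 /\ f (Z w) <> RtoC 0 /\ W (Z w) = w.
Proof.
  move=> hw. have [hD hI] := cw_D t X0 t0 X06 A B dl XA AB dl0 dlA w hw.
  have hz : cz (Z w) by exists w.
  split => //. split; first exact: (proj1 (proj2 (cz_half t X0 t0 X06 Zex A B dl XA AB dl0 dlA _ hz))).
  split; first exact: fnz. exact: (proj2 (Zm_spec t X0 Zex w hD)).
Qed.

Lemma pull_q w : cw w -> pull (fun z => logder f z * Phi (W z))%C w = (lf w * Phi w)%C.
Proof. move=> hw. have [_ [_ [_ e]]] := cw_facts w hw. rewrite /pullback e. ring. Qed.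

Lemma cwb x : A <= x <= B -> cw (pt x dl).
Proof. move=> h. apply: bottom_cw => //. by rewrite Rmin_left ?Rmax_right; lra. Qed.
Lemma TAB : TA <= TB.
Proof. exact: (ABT t X0 t0 X06 A B XA AB). Qed.
Lemma cwr y : dl <= y <= TB -> cw (pt B y).
Proof. move=> h. right. left. rewrite /=. lra. Qed.
Lemma cwl y : dl <= y <= TA -> cw (pt A y).
Proof. move=> h. right. right. left. rewrite /=. lra. Qed.

Variables (M : R -> R) (U ML UA K : R).
Hypothesis hMc : forall x, A <= x <= B -> continuous M x.
Hypothesis hM : forall x, A <= x <= B -> ln (Cmod (f (Z (pt x dl)))) <= M x.
Hypothesis U0 : 0 <= U.
Hypothesis hU : forall y, dl <= y <= TB -> ln (Cmod (f (Z (pt B y)))) <= U.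
Hypothesis hML : forall y, dl <= y <= TA -> Cmod (logder f (Z (pt A y))) <= ML.
Hypothesis hUA : - UA <= ln (Cmod (f (Z (pt A dl)))).
Hypothesis UA0 : 0 <= UA.
Hypothesis hK : forall x, A <= x <= B -> Cmod (Lg f x) <= K.

Notation q := (fun z => logder f z * Phi (W z))%C.

(** Integration by parts against - (B - x)^2 / 2, whose derivative B - x is nonnegative, so that the
    upper bound M may be inserted. The boundary term vanishes at B; at A it uses the lower bound -
    UA at the fixed left corner. *)
Lemma bottom_bound : - Re (HI (pull q) dl A B) <= RInt (fun x => M x * (B - x)) A B + UA * B ^ 2 / 2.
Proof.
  have e : Re (HI (pull q) dl A B) = RInt (fun x => Re (lf (pt x dl)) * (- (B - x) ^ 2 / 2)) A B.
  { transitivity (RInt (fun x => Re (pull q (pt x dl))) A B); first by [].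
    apply: RInt_ext => x. rewrite Rmin_left ?Rmax_right; try lra. move=> hx.
    rewrite pull_q; last by apply: cwb; lra. rewrite re_mult Re_Phi Im_Phi. move: (lf _) => c. rewrite /pt. Cre. field. }
  rewrite e (RInt_parts (fun x => ln (Cmod (f (Z (pt x dl))))) _ _ (fun x => B - x)); try lra.
  - have hle : RInt (fun x => ln (Cmod (f (Z (pt x dl)))) * (B - x)) A B <= RInt (fun x => M x * (B - x)) A B.
    { apply: RInt_le; try lra.
      - apply: ex_RInt_continuousR; first lra. move=> x hx.
        have [c1 [c2 [c3 c4]]] := cw_facts _ (cwb x hx).
        apply: continuous_multR.
        + apply: ex_derive_continuousR. eexists. exact: lnF_h.
        + apply: continuous_minusR; [exact: continuous_const | exact: continuous_id].
      - apply: ex_RInt_continuousR; first lra. move=> x hx.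
        apply: continuous_multR; first exact: hMc.
        apply: continuous_minusR; [exact: continuous_const | exact: continuous_id].
      - move=> x hx. apply: Rmult_le_compat_r; first lra. apply: hM. lra. }
    have h0 : UA * (B - A) ^ 2 <= UA * B ^ 2 by apply: Rmult_le_compat_l => //; nra.
    have h1 := Rmult_le_compat_r ((B - A) ^ 2) _ _ ltac:(nra) hUA.
    rewrite (_ : (B - B) = 0); last by ring. nra.
  - move=> x hx. have [c1 [c2 [c3 c4]]] := cw_facts _ (cwb x hx). exact: lnF_h.
  - move=> x hx. auto_derive => //. field.
  - move=> x hx. have [c1 [c2 [c3 c4]]] := cw_facts _ (cwb x hx).
    apply: (continuous_Re (fun x => lf (pt x dl))). apply: pcont_h. exact: lf_cont.
  - move=> x hx. apply: continuous_minusR; [exact: continuous_const | exact: continuous_id].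
Qed.

Lemma real_ge x : A <= x <= B -> - Rabs (ln (Cmod (f (RtoC 0)))) - K <= ln (Cmod (f (RtoC x))).
Proof.
  move=> hx. rewrite (ln_f_real rho f hF x); last by lra.
  have := hK x hx. have := re_le_Cmod (Lg f x). have := Rle_abs (- Re (Lg f x)). rewrite Rabs_Ropp.
  have := Rle_abs (- ln (Cmod (f (RtoC 0)))). rewrite Rabs_Ropp. lra.
Qed.

(** The weight (y - dl)^2 / 2 vanishes at the bottom corner; at the top corner, which is the real
    point B, the lower bound [real_ge] is used. By [tln] the squared length of the side is at most
    B, whence the factor B / 2. *)
Lemma right_bound : - Re (VI (pull q) B dl TB) <= (U + Rabs (ln (Cmod (f (RtoC 0)))) + K) * B / 2.
Proof.
  have hAB := TAB. have dB : dl <= TB by lra.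
  have e : Re (VI (pull q) B dl TB) = RInt (fun y => - Im (lf (pt B y)) * ((y - dl) ^ 2 / 2)) dl TB.
  { rewrite /VI (_ : forall c : C, Re (Ci * c) = - Im c); last by move=> c; Cre; ring.
    transitivity (- RInt (fun y => Im (pull q (pt B y))) dl TB); first by [].
    have exI : ex_RInt (fun y => Im (pull q (pt B y))) dl TB.
    { apply: ex_RInt_Im => y. rewrite Rmin_left ?Rmax_right; try lra. move=> hy.
      have [c1 [c2 [c3 c4]]] := cw_facts _ (cwr y hy).
      apply: pcont_v. apply: (pull_cont t X0 t0 X06 Zex) => //. apply: cdiff_cont. apply: cdiff_mult.
      + exact: (F_logder_cdiff rho f hF).
      + apply: PhiW_cdiff => //. have := Zm_half t X0 X06 Zex _ c1. lra. }
    transitivity (RInt (fun y => - (Im (pull q (pt B y)))) dl TB).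
    { symmetry. exact: (RInt_opp (V:=R_CompleteNormedModule)). }
    apply: RInt_ext => y. rewrite Rmin_left ?Rmax_right; try lra. move=> hy.
    rewrite pull_q; last by apply: cwr; lra.
    rewrite (_ : forall c d : C, Im (c * d) = Re c * Im d + Im c * Re d) //.
    rewrite Re_Phi Im_Phi. move: (lf _) => c. change (- (Re c * ((B - B) * (y - dl)) + Im c * (((y - dl) ^ 2 - (B - B) ^ 2) / 2)) = - Im c * ((y - dl) ^ 2 / 2)). field. }
  have hder : forall y, dl <= y <= TB -> is_derive (fun y => ln (Cmod (f (Z (pt B y))))) y (- Im (lf (pt B y))).
  { move=> y hy. have [c1 [c2 [c3 c4]]] := cw_facts _ (cwr y hy). exact: lnF_v. }
  have cu : forall y, dl <= y <= TB -> continuous (fun y => ln (Cmod (f (Z (pt B y))))) y.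
  { move=> y hy. apply: ex_derive_continuousR. eexists. exact: hder. }
  have cid : forall y, continuous (fun y => y - dl) y.
  { move=> y. apply: continuous_minusR; [exact: continuous_id | exact: continuous_const]. }
  rewrite e (RInt_parts (fun y => ln (Cmod (f (Z (pt B y))))) _ _ (fun y => y - dl)) //.
  - have hle : RInt (fun y => ln (Cmod (f (Z (pt B y)))) * (y - dl)) dl TB <= RInt (fun y => U * (y - dl)) dl TB.
    { apply: RInt_le => //.
      - apply: ex_RInt_continuousR; first lra. move=> x hx.
        apply: continuous_multR; [exact: cu | exact: cid].
      - apply: (ex_RInt_continuous (V:=R_CompleteNormedModule)) => x _.
        apply: continuous_multR; [exact: continuous_const | exact: cid].
      - move=> y hy. apply: Rmult_le_compat_r; first lra. apply: hU. lra. }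
    have hI : RInt (fun y => U * (y - dl)) dl TB = U * (TB - dl) ^ 2 / 2.
    { rewrite (_ : U * (TB - dl) ^ 2 / 2 = U * (TB - dl) ^ 2 / 2 - U * (dl - dl) ^ 2 / 2); last by field.
      apply: is_RInt_unique. apply: (is_RInt_derive (V:=R_CompleteNormedModule) (fun y => U * (y - dl) ^ 2 / 2)) => y _.
      - auto_derive => //. field.
      - apply: continuous_multR; [exact: continuous_const | exact: cid]. }
    rewrite hI in hle.
    have zB : Z (pt B TB) = RtoC B by apply: (Zm_real t X0 t0 X03 X06 Zex); lra.
    rewrite zB. have hr := real_ge B ltac:(lra). have [_ tB] := tln B ltac:(lra).
    have sq : (TB - dl) ^ 2 <= B by nra. have sq0 : 0 <= (TB - dl) ^ 2 by exact: pow2_ge_0.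
    set S := (TB - dl) ^ 2 in hle sq sq0 *.
    have hK0 : 0 <= K by have := hK B ltac:(lra); have := Cmod_ge_0 (Lg f B); lra.
    have ha := Rabs_pos (ln (Cmod (f (RtoC 0)))). set a := Rabs _ in hr ha *.
    have k1 : U * S <= U * B by apply: Rmult_le_compat_l.
    have k2 : - ln (Cmod (f (RtoC B))) * S <= (a + K) * B.
    { apply: Rle_trans (Rmult_le_compat_r S _ (a + K) sq0 _) _; first lra. apply: Rmult_le_compat_l; lra. }
    rewrite (_ : dl - dl = 0); last by ring. lra.
  - move=> y hy. auto_derive => //. field.
  - move=> y hy. have [c1 [c2 [c3 c4]]] := cw_facts _ (cwr y hy).
    apply: continuous_oppR. apply: (continuous_Im (fun y => lf (pt B y))). apply: pcont_v. exact: lf_cont.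
Qed.

(** A trivial estimate with |weight| <= 2 B^2 is enough, because A and ML will not depend on B and
    B^2 <= B^(rho+1). *)
Lemma left_bound : Re (VI (pull q) A dl TA) <= 8 * ML * TA * B ^ 2.
Proof.
  have [h1 h2] := tln A ltac:(lra).
  have ML0 : 0 <= ML by have := hML TA ltac:(lra); have := Cmod_ge_0 (logder f (Z (pt A TA))); lra.
  apply: Rle_trans (Rle_abs _) _. apply: Rle_trans (re_le_Cmod _) _.
  have hc : vcont (pull q) A dl TA.
  { move=> y. rewrite Rmin_left ?Rmax_right; try lra. move=> hy.
    have [c1 [c2 [c3 c4]]] := cw_facts _ (cwl y hy).
    apply: (pull_cont t X0 t0 X06 Zex) => //. apply: cdiff_cont. apply: cdiff_mult.
    - exact: (F_logder_cdiff rho f hF).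
    - apply: PhiW_cdiff => //. have := Zm_half t X0 X06 Zex _ c1. lra. }
  apply: Rle_trans (VI_bound (pull q) A dl TA (2 * ML * (2 * B ^ 2)) ltac:(lra) hc _) _.
  - move=> y hy. have [c1 [c2 [c3 c4]]] := cw_facts _ (cwl y hy). rewrite pull_q; last exact: cwl.
    rewrite Cmod_mult. apply: Rmult_le_compat; try exact: Cmod_ge_0.
    + apply: Rle_trans (pull_mod _ _ c1) _. have := hML y hy. lra.
    + rewrite /weight !Cmod_mult Cmod_opp Cmod_R Rabs_pos_eq; last lra.
      have hb : Cmod (pt A y - (B, dl)) <= 2 * B.
      { apply: Rle_trans (Cmod_ReIm _) _.
        have : Rabs (Re (pt A y - (B, dl))) <= B by apply: Rabs_le; Cre; lra.
        have : Rabs (Im (pt A y - (B, dl))) <= B by apply: Rabs_le; Cre; lra. lra. }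
      have := Cmod_ge_0 (pt A y - (B, dl)). nra.
  - have : 0 <= ML * B ^ 2 by apply: Rmult_le_pos => //; exact: pow2_ge_0. nra.
Qed.

(** On the real axis the weight is not real, so both parts of f'/f enter. Each is integrated by
    parts onto [Lg], with |p1|, |p2| <= B^2 and derivatives at most 2B in absolute value. *)
Lemma top_bound : Re (HI q 0 A B) <= 8 * K * B ^ 2.
Proof.
  have hK0 : 0 <= K by have := hK B ltac:(lra); have := Cmod_ge_0 (Lg f B); lra.
  set p1 := fun x => ((t * ln x - dl) ^ 2 - (B - x) ^ 2) / 2.
  set p2 := fun x => (B - x) * (t * ln x - dl).
  set p1' := fun x => (t * ln x - dl) * (t / x) + (B - x).
  set p2' := fun x => - (t * ln x - dl) + (B - x) * (t / x).
  have x0 : forall x, A <= x <= B -> 0 < x by move=> x hx; lra.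
  have cln : forall x, A <= x <= B -> continuous (fun x => t * ln x - dl) x.
  { move=> x hx. apply: ex_derive_continuousR. auto_derive. exact: x0. }
  have ctx : forall x, A <= x <= B -> continuous (fun x => t / x) x.
  { move=> x hx. apply: ex_derive_continuousR. auto_derive. have := x0 x hx. lra. }
  have cBx : forall x, continuous (fun x => B - x) x.
  { move=> x. apply: continuous_minusR; [exact: continuous_const | exact: continuous_id]. }
  have d1 : forall x, A <= x <= B -> is_derive p1 x (p1' x).
  { move=> x hx. have := x0 x hx => h. rewrite /p1 /p1'. auto_derive; first done. field. lra. }
  have d2 : forall x, A <= x <= B -> is_derive p2 x (p2' x).
  { move=> x hx. have := x0 x hx => h. rewrite /p2 /p2'. auto_derive; first done. field. lra. }
  have c1 : forall x, A <= x <= B -> continuous p1' x.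
  { move=> x hx. apply: continuous_plusR; last exact: cBx.
    apply: continuous_multR; [exact: cln | exact: ctx]. }
  have c2 : forall x, A <= x <= B -> continuous p2' x.
  { move=> x hx. apply: continuous_plusR.
    - apply: continuous_oppR. exact: cln.
    - apply: continuous_multR; [exact: cBx | exact: ctx]. }
  have bd : forall x, A <= x <= B -> 0 <= t * ln x - dl <= B /\ 0 <= t / x <= 1.
  { move=> x hx. have [h1 h2] := tln x ltac:(lra). have := lnA_le t X0 t0 X06 A XA x (proj1 hx).
    have xp := x0 x hx. split; first lra. split; first by apply: Rmult_le_pos; [lra | left; exact: Rinv_0_lt_compat].
    apply: (Rmult_le_reg_r x) => //. rewrite /Rdiv Rmult_assoc Rinv_l; lra. }
  have cR : forall x, A <= x <= B -> continuous (fun x => Re (logder f (RtoC x))) x.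
  { move=> x hx. apply: (continuous_Re (fun x => logder f (RtoC x))). exact: (real_pcont rho f hF). }
  have cI : forall x, A <= x <= B -> continuous (fun x => Im (logder f (RtoC x))) x.
  { move=> x hx. apply: (continuous_Im (fun x => logder f (RtoC x))). exact: (real_pcont rho f hF). }
  have cp1 : forall x, A <= x <= B -> continuous p1 x by move=> x hx; apply: ex_derive_continuousR; eexists; exact: d1.
  have cp2 : forall x, A <= x <= B -> continuous p2 x by move=> x hx; apply: ex_derive_continuousR; eexists; exact: d2.
  have e : Re (HI q 0 A B) = RInt (fun x => Re (logder f (RtoC x)) * p1 x) A B - RInt (fun x => Im (logder f (RtoC x)) * p2 x) A B.
  { have ex1 : ex_RInt (fun x => Re (logder f (RtoC x)) * p1 x) A B.
    { apply: ex_RInt_continuousR; first lra. move=> x hx.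
      apply: continuous_multR; [exact: cR | exact: cp1]. }
    have ex2 : ex_RInt (fun x => Im (logder f (RtoC x)) * p2 x) A B.
    { apply: ex_RInt_continuousR; first lra. move=> x hx.
      apply: continuous_multR; [exact: cI | exact: cp2]. }
    transitivity (RInt (fun x => Re (logder f (RtoC x)) * p1 x - Im (logder f (RtoC x)) * p2 x) A B); last first.
    { exact: (RInt_minus (V:=R_CompleteNormedModule) _ _ A B ex1 ex2). }
    transitivity (RInt (fun x => Re (q (pt x 0))) A B); first by [].
    apply: RInt_ext => x. rewrite Rmin_left ?Rmax_right; try lra. move=> hx.
    rewrite -[pt x 0]/(RtoC x) (W_real t); last by lra. rewrite re_mult Re_Phi Im_Phi. reflexivity. }
  have b1 : Rabs (RInt (fun x => Re (logder f (RtoC x)) * p1 x) A B) <= K * (2 * B ^ 2 + (B - A) * (2 * B)).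
  { apply: (RInt_parts_bound (fun x => Re (Lg f x)) _ p1 p1') => //; first lra.
    - move=> x hx. exact: (Lg_Re_derive rho f hF).
    - move=> x hx. have [h1 h2] := bd x hx. split; first by apply: Rle_trans (re_le_Cmod _) (hK x hx).
      split; apply: Rabs_le; rewrite /p1 /p1'; split; nra. }
  have b2 : Rabs (RInt (fun x => Im (logder f (RtoC x)) * p2 x) A B) <= K * (2 * B ^ 2 + (B - A) * (2 * B)).
  { apply: (RInt_parts_bound (fun x => Im (Lg f x)) _ p2 p2') => //; first lra.
    - move=> x hx. exact: (Lg_Im_derive rho f hF).
    - move=> x hx. have [h1 h2] := bd x hx. split; first by apply: Rle_trans (im_le_Cmod _) (hK x hx).
      split; apply: Rabs_le; rewrite /p2 /p2'; split; nra. }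
  rewrite e. set I1 := RInt _ _ _ in b1 *. set I2 := RInt _ _ _ in b2 *.
  have := Rle_abs I1. have := Rle_abs (- I2). rewrite Rabs_Ropp.
  have : K * ((B - A) * (2 * B)) <= K * (2 * B ^ 2) by apply: Rmult_le_compat_l => //; nra. lra.
Qed.

Lemma contour_bound : - Re (oint t X0 A B dl q) <= RInt (fun x => M x * (B - x)) A B + UA * B ^ 2 / 2 +
  (U + Rabs (ln (Cmod (f (RtoC 0)))) + K) * B / 2 + 8 * K * B ^ 2 + 8 * ML * TA * B ^ 2.
Proof.
  have b1 := bottom_bound. have b2 := right_bound. have b3 := top_bound. have b4 := left_bound.
  rewrite (_ : Re (oint t X0 A B dl q) = Re (HI (pull q) dl A B) + Re (VI (pull q) B dl TB) - Re (HI q 0 A B) - Re (VI (pull q) A dl TA)); first lra.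
  rewrite /oint. move: (HI _ _ _ _) (VI _ _ _ _) (HI _ _ _ _) (VI _ _ _ _) => c1 c2 c3 c4. Cre. ring.
Qed.
End Inequality.

(** * Jensen's inequality for the region above the curve *)

Lemma avoid_finite (l : list R) (a b : R) : a < b -> exists x, a < x < b /\ ~ In x l.
Proof.
  elim: l a b => [|c l IH] a b ab; first by exists ((a + b) / 2); split; [lra | move=> []].
  case: (Rle_dec c ((a + b) / 2)) => h.
  - have [x [hx nx]] := IH ((a + b) / 2) b ltac:(lra). exists x. split; first lra. move=> [e|//]. lra.
  - have [x [hx nx]] := IH a ((a + b) / 2) ltac:(lra). exists x. split; first lra. move=> [e|//]. lra.
Qed.

Lemma Rsum_le F G m : (forall a, In a m -> F a <= G a) -> Rsum F m <= Rsum G m.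
Proof.
  elim: m => [|a m IH] h /=; first lra.
  have h1 := h a (or_introl eq_refl). have h2 := IH (fun b hb => h b (or_intror hb)). lra.
Qed.

Lemma Rsum_plus_const F c m : Rsum (fun a => F a + c) m = Rsum F m + INR (length m) * c.
Proof. elim: m => [|a m IH]; first by rewrite /=; ring. rewrite [length _]/= S_INR /= IH. ring. Qed.

(* m lists the zeros of f in the rectangle, with multiplicity: f has none on the real axis,
   hence none slightly above it either. *)
Definition factored (f : C -> C) (x1 x2 H : R) (m : list C) : Prop :=
  exists e h, 0 < e /\ (forall z, in_rect x1 x2 (- H) e z -> cdiff_near f z /\ cdiff_near h z /\ h z <> RtoC 0) /\
    (forall z, f z = (prodl m z * h z)%C) /\ (forall a, In a m -> in_rect x1 x2 (- H) 0 a /\ Im a < 0 /\ f a = RtoC 0).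

Lemma factored_zero f x1 x2 H m z : factored f x1 x2 H m -> in_rect x1 x2 (- H) 0 z -> f z = RtoC 0 -> In z m.
Proof.
  move=> [e [h [e0 [hg [ef _]]]]] hz fz. apply NNPP => hn.
  have [_ [_ nh]] := hg z ltac:(move: hz; rewrite /in_rect; lra).
  exact: (Cmult_neq_0 _ _ (prodl_neq0 _ _ hn) nh (eq_trans (eq_sym (ef z)) fz)).
Qed.

(* The height of a above the curve Im z = - t ln |z|, which is Im (Wm t a); 0 below it. *)
Definition depth (t R1 : R) (a : C) : R :=
  if Pdec (R1 <= Cmod a /\ 0 < Re a /\ - t * ln (Cmod a) <= Im a) then Im a + t * ln (Cmod a) else 0.

(** [A], [A1] and [K] are chosen before B. The abscissa Re (W z) equals |z| only up to 1: hence M is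
    required to bound f at all z with | |z| - X | <= 1, and B' exceeds B by more than 1, which gives
    B - |a| <= B' - Re (W a). *)
Theorem jensen_curve rho f t M R1 : class_F rho f -> 0 < t ->
  (forall x, 2 < x -> continuous M x) ->
  (forall z X, log_curve t z -> R1 <= Cmod z -> Rabs (Cmod z - X) <= 1 -> Cmod (f z) <= exp (M X)) ->
  exists A A1 K, 3 <= A /\ A + 1 <= A1 /\ 0 <= K /\ forall B, A1 <= B -> forall x1 x2 H m, x1 <= 0 -> B + 5 <= x2 -> B + 5 <= H -> factored f x1 x2 H m ->
    exists B', B + 1 < B' < B + 2 /\
    2 * PI * Rsum (fun a => depth t A1 a * Rmax 0 (B - Cmod a)) m <= RInt (fun x => M x * (B' - x)) A B' + K * B ^ (rho + 1).
Proof.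
  move=> hF t0 hMc hMv.
  have [Xs [Xs3 [Xs6 Zex0]]] := sz_exists t t0.
  have [Rn [Rn3 near]] := Re_W_near t t0.
  have [Rl [Rl3 hRl]] := ln_sq_small (t ^ 2 + t + 1) ltac:(nra).
  have [cg [Kg [Rg hg]]] := F_growth _ _ hF.
  have [Kd [Rd hd]] := F_logder _ _ hF.
  have rho1 := F_rho _ _ hF.
  (* A sum instead of a maximum, so that X0 - 2t, the lower bound for |z| on the contour, still
     exceeds the other thresholds. *)
  set X0 := Xs + 2 * t + Rn + Rl + Rabs Rg + Rabs Rd + Rabs R1.
  have aRg := Rabs_pos Rg. have aRd := Rabs_pos Rd. have aR1 := Rabs_pos R1.
  have bRg := Rle_abs Rg. have bRd := Rle_abs Rd. have bR1 := Rle_abs R1.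
  have X03 : 3 <= X0 by rewrite /X0; lra.
  have X06 : 6 * t <= X0 by rewrite /X0; lra.
  have Zex : forall X Y, X0 <= X -> -1 <= Y <= t * ln X + 1 ->
    exists z, X - 2 * t <= Re z /\ Wm t z = (X, Y) /\ (Y <= t * ln X -> Im z <= 0).
  { move=> X Y hX hY. apply: Zex0 => //. move: hX; rewrite /X0; lra. }
  have tln : forall x, X0 <= x -> 0 <= t * ln x <= x /\ (t * ln x) ^ 2 <= x.
  { move=> x hx. have [l1 [l2 l3]] := hRl x ltac:(move: hx; rewrite /X0; lra). set L := ln x in l1 l2 l3 *.
    have q : 0 <= t * L by nra. split; first by split => //; nra. nra. }
  set Z := Zm t X0.
  have reg : forall x y, X0 < x -> 0 <= y <= t * ln x ->
     Dm t X0 (pt x y) /\ Wm t (Z (pt x y)) = pt x y /\ Im (Z (pt x y)) <= 0 /\ x - 2 * t <= Re (Z (pt x y)) /\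
     Cmod (Z (pt x y)) - 1 <= x <= Cmod (Z (pt x y)) + 1 /\ X0 - 2 * t <= Cmod (Z (pt x y)) /\ Im (Z (pt x y)) = y - t * ln (Cmod (Z (pt x y))).
  { move=> x y hx hy. have hD : Dm t X0 (pt x y) by rewrite /Dm /=; have := tln x ltac:(lra); lra.
    have [s1 s2] := Zm_spec t X0 Zex _ hD. have [r1 r2] := Zm_region t X0 t0 X06 Zex _ hD (proj2 hy).
    rewrite -/Z in s1 s2 r1 r2 *. rewrite [Re (pt x y)]/= in r1.
    have mz : X0 - 2 * t <= Cmod (Z (pt x y)) by apply: Rle_trans (re_le_Cmod _); apply: Rle_trans (Rle_abs _).
    have eI : Im (Z (pt x y)) = y - t * ln (Cmod (Z (pt x y))).
    { have := Im_W t (Z (pt x y)). rewrite s2 [Im (pt x y)]/=. lra. }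
    have [n1 n2] := near (Z (pt x y)) ltac:(lra) ltac:(move: mz; rewrite /X0; lra) ltac:(lra).
    rewrite s2 [Re (pt x y)]/= in n1. repeat split => //; lra. }
  (* A has to avoid the zeros on its side and yet be independent of B, since ML and N depend on it;
     so it is chosen with the zeros of one fixed rectangle, before m is given. *)
  have [A [XA [A2 hA]]] : exists A, X0 < A /\ A < X0 + 1 /\ forall y, 0 <= y <= t * ln A -> f (Z (pt A y)) <> RtoC 0.
  { have [e [m0 [h0 fac]]] := box_factor rho f 0 (X0 + 5) (X0 + 5) hF ltac:(lra) ltac:(lra).
    have fac0 : factored f 0 (X0 + 5) (X0 + 5) m0 by exists e, h0.
    have [A [hA nA]] := avoid_finite (map (fun a => Re (Wm t a)) m0) X0 (X0 + 1) ltac:(lra).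
    exists A. split; first lra. split; first lra. move=> y hy fz.
    have [g1 [g2 [g3 [g4 [g5 [g6 g7]]]]]] := reg A y ltac:(lra) hy.
    apply: nA. rewrite -[A]/(Re (pt A y)) -g2. apply: (in_map (fun a => Re (Wm t a))).
    apply: (factored_zero _ _ _ _ _ _ fac0) => //.
    have k1 := re_bounds (Z (pt A y)). have k2 := im_bounds (Z (pt A y)).
    rewrite /in_rect. split; [split; lra | lra]. }
  have lcont : forall q, (forall z, Im z <= 0 -> f z <> RtoC 0 -> cdiff q z) ->
    exists N, forall y, 0 <= y <= t * ln A -> Cmod (q (Z (pt A y))) <= N.
  { move=> q hq. apply: (continuous_bounded (fun y => q (Z (pt A y)))); first exact: (proj1 (proj1 (tln A ltac:(lra)))).
    move=> y hy. have [g1 [g2 [g3 _]]] := reg A y XA hy.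
    apply: (pcont_v (fun w => q (Z w))). apply: (continuous_comp Z q); first exact: (Zm_cont t X0 t0 X06 Zex).
    apply: cdiff_cont. apply: hq => //. exact: hA. }
  have [ML hML] := lcont (logder f) (fun z h1 h2 => F_logder_cdiff rho f hF z h1 h2).
  have [N hN] := lcont (fun z => / f z)%C (fun z h1 h2 => cdiff_inv f z (F_cdiff rho f hF z h1) h2).
  have TA0 := proj1 (proj1 (tln A ltac:(lra))).
  have N0 : 0 < N.
  { apply: Rlt_le_trans (hN 0 ltac:(lra)). rewrite Cmod_inv; last by apply: hA; lra. apply: Rinv_0_lt_compat. apply/Cmod_gt_0. apply: hA. lra. }
  have ML0 : 0 <= ML by apply: Rle_trans (Cmod_ge_0 _) (hML 0 _); lra.
  set UA := Rabs (ln N). have UA0 : 0 <= UA by exact: Rabs_pos.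
  have hUA : forall y, 0 <= y <= t * ln A -> - UA <= ln (Cmod (f (Z (pt A y)))).
  { move=> y hy. have nz := hA y hy. have p := proj1 (Cmod_gt_0 _) nz. have := hN y hy. rewrite Cmod_inv // => h.
    have h2 : / N <= Cmod (f (Z (pt A y))) by rewrite -(Rinv_inv (Cmod _)); apply: Rinv_le_contravar => //; exact: Rinv_0_lt_compat.
    have h3 : ln (/ N) <= ln (Cmod (f (Z (pt A y)))).
    { apply: ln_le_mono => //. exact: Rinv_0_lt_compat. }
    rewrite ln_Rinv // in h3. have := Rle_abs (ln N). rewrite /UA. lra. }
  set a0 := Rabs (ln (Cmod (f (RtoC 0)))). have a00 : 0 <= a0 by exact: Rabs_pos.
  set Kg' := Rmax 1 Kg. have Kg1 : 1 <= Kg' by exact: Rmax_l. have Kg2 : Kg <= Kg' by exact: Rmax_r.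
  have lKg : 0 <= ln Kg' by rewrite -ln_1; apply: ln_le_mono; lra.
  set Kd' := Rabs Kd. have Kd0 : 0 <= Kd' by exact: Rabs_pos.
  have cg0 := Rabs_pos cg.
  set TA := t * ln A in TA0 hA hML hN hUA.
  (* 4^(rho+1) absorbs B' <= 4B; the summand 1 pays for M + 1 in place of M, and 8 >= 2 pi for the
     error 1 made in replacing Im W - dl by Im W in the sum over the zeros. *)
  set KK := 4 ^ (rho + 1) * (UA + (ln Kg' + Rabs cg * 2 ^ rho + a0 + Kd') + 8 * Kd' + 8 * ML * TA + 1 + 8).
  have MT : 0 <= ML * TA by apply: Rmult_le_pos.
  have p2r : 0 < 2 ^ rho by apply: pow_lt; lra. have p4r : 0 < 4 ^ (rho + 1) by apply: pow_lt; lra.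
  have cp : 0 <= Rabs cg * 2 ^ rho by apply: Rmult_le_pos; lra.
  exists A, (A + 3), KK. split; first lra. split; first lra. split; first by apply: Rmult_le_pos; lra.
  move=> B hB x1 x2 H m hx1 hx2 hH [e [h [e0 [hgood [ef hm]]]]].
  have [B' [hB' nB]] := avoid_finite (map (fun a => Re (Wm t a)) m) (B + 1) (B + 2) ltac:(lra).
  exists B'. split => //.
  have AB : A < B' by lra.
  have TB0 := tln B' ltac:(lra).
  have lenm : 0 <= INR (length m) by exact: pos_INR.
  (* On the curve |f| <= exp M < 2 exp M; by compactness the bound 2 exp M persists on a thin strip
     above the curve. The factor 2 costs less than 1 in ln |f|. *)
  have [d1 [d10 hd1]] : exists d, 0 < d /\ forall x dl, A <= x <= B' -> 0 <= dl < d -> Cmod (f (Z (pt x dl))) <= 2 * exp (M x).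
  { have := bisection (fun x y w h => exists d, 0 < d /\ forall z dl, x <= z <= x + w -> 0 <= dl < d -> Cmod (f (Z (pt z dl))) <= 2 * exp (M z)) A 0 (B' - A) 0.
    have -> : A + (B' - A) = B' by ring.
    apply; try lra.
    - move=> x y w k w0 k0 _ _ _ _ [e1 [e10 k1]] [e2 [e20 k2]] _ _.
      exists (Rmin e1 e2). split; first exact: Rmin_glb_lt. move=> z dl hz hi.
      have m1 := Rmin_l e1 e2. have m2 := Rmin_r e1 e2.
      case: (Rle_dec z (x + w/2)) => c; [apply: k1 | apply: k2]; lra.
    - move=> p q hp hq.
      have lnp := proj1 (proj1 (tln p ltac:(lra))).
      have [g1 [g2 [g3 [g4 [g5 [g6 g7]]]]]] := reg p 0 ltac:(lra) ltac:(lra).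
      have c1 : ccont (fun w => f (Z w)) (pt p 0).
      { apply: (continuous_comp Z f); first exact: (Zm_cont t X0 t0 X06 Zex). apply: cdiff_cont. exact: (F_cdiff rho f hF). }
      have c2 : continuous (T:=C_UniformSpace) (U:=R_UniformSpace) (fun w => 2 * exp (M (Re w)) - Cmod (f (Z w))) (pt p 0).
      { apply: continuous_minusR; last exact: continuous_Cmod.
        apply: continuous_multR; first exact: continuous_const.
        apply: (continuous_comp (fun w : C => M (Re w)) exp); last exact: continuous_exp.
        apply: (continuous_comp (fun w : C => Re w) M); first by apply: (continuous_Re (fun w => w)); exact: continuous_id.
        apply: hMc. rewrite /=. lra. }
      have pos : 0 < 2 * exp (M (Re (pt p 0))) - Cmod (f (Z (pt p 0))).
      { have ex0 := exp_pos (M p). have : Cmod (f (Z (pt p 0))) <= exp (M p).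
        { apply: hMv.
          - split; [rewrite g7; ring | lra].
          - move: g6; rewrite /X0. lra.
          - apply: Rabs_le. lra. }
        rewrite [Re (pt p 0)]/=. lra. }
      have l1 : clocally (pt p 0) (fun w => 0 < 2 * exp (M (Re w)) - Cmod (f (Z w))).
      { apply (c2 (fun y => 0 < y)). exists (mkposreal _ pos) => y. rewrite /ball /= /AbsRing_ball /abs /minus /plus /opp /=. move/Rabs_def2. rewrite /Re /Im /=. lra. }
      move/locally_Cmod: l1 => [d [d0 hdl]].
      exists (d / 2). split; first lra.
      move=> x y w k hw hk hpx hy _ _ _ _. exists (d / 2). split; first lra.
      move=> z dl hz hi. have := hdl (pt z dl).
      have : Cmod (pt z dl - pt p 0) < d.
      { apply: Rle_lt_trans (Cmod_ReIm _) _.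
        have : Rabs (Re (pt z dl - pt p 0)) < d / 2 by apply: Rabs_def1; Cre; lra.
        have : Rabs (Im (pt z dl - pt p 0)) < d / 2 by apply: Rabs_def1; Cre; lra. lra. }
      move=> i1 i2. have := i2 i1. rewrite [Re (pt z dl)]/=. lra. }
  have TApos : 0 < TA.
  { rewrite /TA. have : 0 < ln A by rewrite -ln_1; apply: ln_increasing; lra. nra. }
  (* The last bound makes the loss dl B' per zero at most 1 in total over m. *)
  set dmax := Rmin (Rmin d1 TA) (/ (B' * (INR (length m) + 1))).
  have den : 0 < B' * (INR (length m) + 1) by apply: Rmult_lt_0_compat; lra.
  have dmax0 : 0 < dmax.
  { rewrite /dmax. apply: Rmin_glb_lt; first exact: Rmin_glb_lt. exact: Rinv_0_lt_compat. }
  have [dl [hdl ndl]] := avoid_finite (map (fun a => Im (Wm t a)) m) 0 dmax dmax0.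
  have dl1 : dl < d1.
  { have := Rmin_l (Rmin d1 TA) (/ (B' * (INR (length m) + 1))). have := Rmin_l d1 TA. rewrite -/dmax. lra. }
  have dlA : dl < TA.
  { have := Rmin_l (Rmin d1 TA) (/ (B' * (INR (length m) + 1))). have := Rmin_r d1 TA. rewrite -/dmax. lra. }
  have dlB : INR (length m) * (dl * B') <= 1.
  { have h1 : dl <= / (B' * (INR (length m) + 1)) by have := Rmin_r (Rmin d1 TA) (/ (B' * (INR (length m) + 1))); rewrite -/dmax; lra.
    have h2 := Rmult_le_compat_r _ _ _ (Rlt_le _ _ den) h1. rewrite Rinv_l in h2; last lra. nra. }
  have dl0 : 0 < dl by lra.
  have reg' : forall w, cw t A B' dl w -> X0 < Re w /\ 0 <= Im w <= t * ln (Re w) /\ A <= Re w <= B'.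
  { move=> w hw. have [_ k] := cw_D t X0 t0 X06 A B' dl XA AB dl0 dlA w hw.
    have : A <= Re w <= B' by move: hw; rewrite /cw; lra. lra. }
  set xl := X0 - 2 * t.
  have cbox : forall z, cz t X0 A B' dl z -> in_box xl (B' + 2) (- H) e z.
  { move=> z [w [hw ->]]. have [w1 [w2 w3]] := reg' w hw. rewrite (C_eta w) -/(pt _ _) -/Z.
    have [g1 [g2 [g3 [g4 [g5 [g6 g7]]]]]] := reg (Re w) (Im w) w1 w2.
    set z' := Z _ in g2 g3 g4 g5 g6 g7 *. have [_ k1] := re_bounds z'.
    have [tl _] := tln (Cmod z' + 2 * t) ltac:(lra).
    have lm : ln (Cmod z') <= ln (B' + 1).
    { apply: ln_le_mono; lra. }
    have [tB _] := tln (B' + 1) ltac:(lra).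
    have k2 : t * ln (Cmod z') <= B' + 1 by apply: Rle_trans (proj2 tB); apply: Rmult_le_compat_l; lra.
    rewrite /in_box /xl. split; lra. }
  have sub : forall z, in_box xl (B' + 2) (- H) e z -> in_rect x1 x2 (- H) e z.
  { move=> z. rewrite /in_box /in_rect /xl. lra. }
  have gen : forall a, In a m -> generic t A B' dl xl (B' + 2) (- H) e a.
  { move=> a ha. have [ra [ia fa]] := hm a ha. split => // ba.
    have pa : 4 * t <= Re a by move: ba; rewrite /in_box /xl; lra.
    split; [|split].
    - move=> eA. apply: Rnot_le_lt => hle.
      have bel := W_below t t0 a pa ia. rewrite eA -/TA in bel.
      apply: (hA (Im (Wm t a))); first lra.
      have [g1 _] := reg A (Im (Wm t a)) XA ltac:(rewrite -/TA; lra).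
      rewrite -{1}eA -[pt _ _]/(Re (Wm t a), Im (Wm t a)) -C_eta /Z (Zm_W t X0 t0 X06 Zex a pa) //.
      rewrite (C_eta (Wm t a)) eA. exact: g1.
    - move=> eB. apply: nB. rewrite -eB. exact: (in_map (fun a => Re (Wm t a))).
    - move=> ed. apply: ndl. rewrite -ed. exact: (in_map (fun a => Im (Wm t a))). }
  have fnz : forall z, cz t X0 A B' dl z -> f z <> RtoC 0.
  { move=> z hz. rewrite ef. apply: Cmult_neq_0.
    - apply: prodl_neq0 => hi. exact: (generic_off t X0 t0 X06 Zex A B' dl XA AB dl0 dlA xl (B' + 2) (- H) e ltac:(rewrite /xl; lra) cbox z z (gen z hi) hz).
    - exact: (proj2 (proj2 (hgood z (sub z (cbox z hz))))). }
  have res := residue_sum t X0 t0 X03 X06 Zex A B' dl XA AB dl0 dlA xl (B' + 2) (- H) e ltac:(rewrite /xl; lra) cbox f m h ef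
    (fun z hz => locally_singleton _ _ (proj1 (proj2 (hgood z (sub z hz))))) (fun z hz => proj2 (proj2 (hgood z (sub z hz)))) gen.
  set U := ln Kg' + Rabs cg * (2 * B') ^ rho.
  have hU : forall y, dl <= y <= t * ln B' -> ln (Cmod (f (Z (pt B' y)))) <= U.
  { move=> y hy. have [g1 [g2 [g3 [g4 [g5 [g6 g7]]]]]] := reg B' y ltac:(lra) ltac:(lra).
    have nz : f (Z (pt B' y)) <> RtoC 0 by apply: fnz; exists (pt B' y); split => //; right; left; rewrite /=; lra.
    have p := proj1 (Cmod_gt_0 _) nz.
    have hgr := hg (Z (pt B' y)) g3 ltac:(move: g6; rewrite /X0; lra).
    set z := Z _ in g5 p hgr *.
    have k1 : Cmod z ^ rho <= (2 * B') ^ rho by apply: pow_incr; split; [exact: Cmod_ge_0 | lra].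
    have k2 : cg * Cmod z ^ rho <= Rabs cg * (2 * B') ^ rho.
    { apply: Rle_trans (Rmult_le_compat_r _ _ _ (pow_le _ _ (Cmod_ge_0 z)) (Rle_abs cg)) _. apply: Rmult_le_compat_l => //. }
    have k3 : Cmod (f z) <= Kg' * exp (Rabs cg * (2 * B') ^ rho).
    { apply: Rle_trans hgr _. have ep := exp_pos (cg * Cmod z ^ rho).
      apply: Rle_trans (Rmult_le_compat_r _ _ _ (Rlt_le _ _ ep) Kg2) _. apply: Rmult_le_compat_l; first lra.
      exact: exp_le_mono. }
    have k4 : ln (Kg' * exp (Rabs cg * (2 * B') ^ rho)) = U by rewrite ln_mult ?ln_exp //; [lra | exact: exp_pos].
    rewrite -k4. exact: ln_le_mono. }
  have U0 : 0 <= U by apply: Rplus_le_le_0_compat => //; apply: Rmult_le_pos => //; apply: pow_le; lra.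
  have hK : forall x, A <= x <= B' -> Cmod (Lg f x) <= Kd' * B' ^ (rho - 1).
  { move=> x hx. rewrite -(Lg_RInt rho f hF). have xp : 0 <= x by lra.
    have h1 := hd x ltac:(rewrite Rabs_pos_eq //; move: hx XA; rewrite /X0; lra). rewrite Rabs_pos_eq // in h1.
    apply: Rle_trans h1 _. have q0 : 0 <= x ^ (rho - 1) by exact: pow_le.
    apply: Rle_trans (Rmult_le_compat_r _ _ _ q0 (Rle_abs Kd)) _. apply: Rmult_le_compat_l => //.
    apply: pow_incr. lra. }
  have hM : forall x, A <= x <= B' -> ln (Cmod (f (Z (pt x dl)))) <= M x + 1.
  { move=> x hx. have h1 := hd1 x dl hx ltac:(lra).
    have nz : f (Z (pt x dl)) <> RtoC 0 by apply: fnz; exists (pt x dl); split => //; left; rewrite /=; lra.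
    have p := proj1 (Cmod_gt_0 _) nz. have ep := exp_pos (M x).
    have k : ln (2 * exp (M x)) <= M x + 1 by rewrite ln_mult ?ln_exp //; try lra; have := ln_le_sub1 2; lra.
    apply: Rle_trans k. apply: ln_le_mono; lra. }
  have cM1 : forall x, A <= x <= B' -> continuous (fun x => M x + 1) x.
  { move=> x hx. apply: continuous_plusR; [apply: hMc; lra | exact: continuous_const]. }
  have fin := contour_bound rho f hF t X0 t0 X03 X06 Zex tln A B' dl XA AB dl0 dlA fnz
    (fun x => M x + 1) U ML UA (Kd' * B' ^ (rho - 1)) cM1 hM U0 hU (fun y hy => hML y ltac:(rewrite -/TA in hy *; lra)) (hUA dl ltac:(lra)) UA0 hK.
  rewrite res -/TA -/a0 in fin.
  (* A zero of positive depth with |a| < B lies in the box and, since |a| >= A + 3, to the right of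
     A, with Re (W a) < B'. If it is not above height dl, its term is at most dl B'. *)
  have cmp : Rsum (fun a => depth t (A + 3) a * Rmax 0 (B - Cmod a)) m <=
    Rsum (fun a => if Pdec (in_box xl (B' + 2) (- H) e a /\ inside t A B' dl a) then (B' - Re (Wm t a)) * (Im (Wm t a) - dl) else 0) m + 1.
  { apply: Rle_trans (_ : _ <= Rsum (fun a => (if Pdec (in_box xl (B' + 2) (- H) e a /\ inside t A B' dl a) then (B' - Re (Wm t a)) * (Im (Wm t a) - dl) else 0) + dl * B') m) _; last first.
    { rewrite Rsum_plus_const. lra. }
    apply: Rsum_le => a ha. have [ra [ia fa]] := hm a ha.
    have dB : 0 <= dl * B' by apply: Rmult_le_pos; lra.
    have tpos : 0 <= (if Pdec (in_box xl (B' + 2) (- H) e a /\ inside t A B' dl a) then (B' - Re (Wm t a)) * (Im (Wm t a) - dl) else 0).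
    { case: Pdec => [[_ [i1 i2]]|_]; last lra. apply: Rmult_le_pos; lra. }
    rewrite /depth. case: Pdec => [[c1 [c2 c3]]|_]; last by rewrite Rmult_0_l; lra.
    case: (Rle_dec B (Cmod a)) => cB; first by rewrite Rmax_left; lra.
    rewrite Rmax_right; last lra. move: tpos.
    have [n1 n2] := near a c2 ltac:(move: c1 XA; rewrite /X0; lra) ltac:(lra).
    have IW := Im_W t a.
    have [tm _] := tln (Cmod a) ltac:(lra).
    have [_ k1] := re_bounds a.
    have Y0 : 0 <= Im (Wm t a) by rewrite IW; lra.
    rewrite -IW.
    have s1 : Im (Wm t a) * (B - Cmod a) <= (B' - Re (Wm t a)) * Im (Wm t a) by nra.
    case: Pdec => hp tp.
    - have : dl * (B' - Re (Wm t a)) <= dl * B' by apply: Rmult_le_compat_l; lra. lra.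
    - have : ~ dl < Im (Wm t a).
      { move=> hlt. apply: hp. split; [rewrite /in_box /xl; lra | rewrite /inside; lra]. }
      move=> hn. have : (B' - Re (Wm t a)) * Im (Wm t a) <= B' * dl by apply: Rmult_le_compat; lra. lra. }
  set S1 := Rsum _ _ in cmp *. set S2 := Rsum _ _ in cmp fin.
  have PI4 := PI_4. have PI0 := PI_RGT_0.
  have jint : RInt (fun x => (M x + 1) * (B' - x)) A B' = RInt (fun x => M x * (B' - x)) A B' + (B' - A) ^ 2 / 2.
  { have cb : forall x, continuous (fun x => B' - x) x by move=> x; apply: continuous_minusR; [exact: continuous_const | exact: continuous_id].
    have e1 : ex_RInt (fun x => M x * (B' - x)) A B'.
    { apply: ex_RInt_continuousR; first lra. move=> x hx.
      apply: continuous_multR; [apply: hMc; lra | exact: cb]. }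
    have i2 : is_RInt (fun x => B' - x) A B' (- (B' - B') ^ 2 / 2 - - (B' - A) ^ 2 / 2).
    { apply: (is_RInt_derive (V:=R_CompleteNormedModule) (fun x => - (B' - x) ^ 2 / 2)) => x _; last exact: cb.
      auto_derive => //. field. }
    have ev : - (B' - B') ^ 2 / 2 - - (B' - A) ^ 2 / 2 = (B' - A) ^ 2 / 2 by field.
    rewrite ev in i2.
    apply: is_RInt_unique. apply: (is_RInt_ext (fun x => M x * (B' - x) + (B' - x))); first by move=> x _; Rring.
    exact: (is_RInt_plus (V:=R_NormedModule) _ _ _ _ _ _ (RInt_correct (V:=R_CompleteNormedModule) _ _ _ e1) i2). }
  rewrite jint in fin.
  set J := RInt _ _ _ in fin *.
  have B'1 : 1 <= B' by lra.
  have Bpos : 0 < B by lra.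
  set P := B' ^ (rho + 1).
  have pw : P <= 4 ^ (rho + 1) * B ^ (rho + 1).
  { rewrite -Rpow_mult_distr. apply: pow_incr. lra. }
  have P1 : 1 <= P by apply: pow_R1_Rle.
  have P2 : B' ^ 2 <= P by apply: Rle_pow => //; lia.
  have P3 : B' ^ (rho - 1) * B' ^ 2 = P by rewrite -pow_add; congr pow; lia.
  have P4 : B' ^ rho * B' = P by rewrite /P pow_add pow_1.
  have P5 : B' ^ (rho - 1) * B' <= P.
  { rewrite -P3. apply: Rmult_le_compat_l; first by apply: pow_le; lra. nra. }
  have P6 : B' <= P by nra.
  have t1 : UA * B' ^ 2 <= UA * P by apply: Rmult_le_compat_l.
  have t2 : U * B' <= (ln Kg' + Rabs cg * 2 ^ rho) * P.
  { rewrite /U Rpow_mult_distr.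
    rewrite (_ : (ln Kg' + Rabs cg * (2 ^ rho * B' ^ rho)) * B' = ln Kg' * B' + Rabs cg * 2 ^ rho * (B' ^ rho * B')); last by ring.
    rewrite P4 Rmult_plus_distr_r. have : ln Kg' * B' <= ln Kg' * P by apply: Rmult_le_compat_l. lra. }
  have t3 : a0 * B' <= a0 * P by apply: Rmult_le_compat_l.
  have t4 : Kd' * B' ^ (rho - 1) * B' <= Kd' * P by rewrite Rmult_assoc; apply: Rmult_le_compat_l.
  have t5 : Kd' * B' ^ (rho - 1) * B' ^ 2 = Kd' * P by rewrite Rmult_assoc P3.
  have t6 : ML * TA * B' ^ 2 <= ML * TA * P by apply: Rmult_le_compat_l.
  have t7 : (B' - A) ^ 2 <= P by apply: Rle_trans P2; nra.
  have fin2 : 2 * PI * S2 <= J + P * (UA + (ln Kg' + Rabs cg * 2 ^ rho + a0 + Kd') + 8 * Kd' + 8 * ML * TA + 1).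
  { have k0 : 0 <= U * B' by apply: Rmult_le_pos; lra. have k1 : 0 <= a0 * B' by apply: Rmult_le_pos; lra.
    have k2 : 0 <= Kd' * B' ^ (rho - 1) * B' by repeat apply: Rmult_le_pos => //; try lra; apply: pow_le; lra.
    have k3 : 0 <= UA * B' ^ 2 by apply: Rmult_le_pos => //; exact: pow2_ge_0.
    have k4 := pow2_ge_0 (B' - A).
    lra. }
  set Q := UA + (ln Kg' + Rabs cg * 2 ^ rho + a0 + Kd') + 8 * Kd' + 8 * ML * TA + 1 in fin2.
  have Q0 : 0 <= Q by rewrite /Q; lra.
  have fin3 : P * (Q + 8) <= 4 ^ (rho + 1) * B ^ (rho + 1) * (Q + 8) by apply: Rmult_le_compat_r; lra.
  rewrite /KK -/Q.
  have : 2 * PI * S1 <= 2 * PI * (S2 + 1) by apply: Rmult_le_compat_l; lra.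
  lra.
Qed.

(** * Asymptotics of powers times logarithms, and the resulting sums over zeros *)

Lemma ln_ge0 x : 1 <= x -> 0 <= ln x.
Proof. move=> h. rewrite -ln_1. apply: ln_le_mono; lra. Qed.

Lemma ln_close x y : 1 <= x -> 1 <= y -> ln y - ln x <= Rabs (y - x).
Proof.
  move=> hx hy. case: (Rle_dec y x) => c.
  - have := ln_le_mono y x ltac:(lra) c. have := Rabs_pos (y - x). lra.
  - rewrite -ln_div; try lra. apply: Rle_trans (ln_le_sub1 _ _) _; first by apply: Rdiv_lt_0_compat; lra.
    rewrite Rabs_pos_eq; last lra.
    rewrite (_ : y / x - 1 = (y - x) / x); last by field; lra.
    apply: (Rmult_le_reg_r x); first lra. rewrite /Rdiv Rmult_assoc Rinv_l; last lra. nra.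
Qed.

Lemma pow_ln_close k : exists K, 0 <= K /\ forall x y, 2 <= x -> 1 <= y -> Rabs (y - x) <= 2 ->
  Rabs (y ^ k * ln y - x ^ k * ln x) <= K * x ^ k.
Proof.
  elim: k => [|k [K [K0 hK]]].
  - exists 2. split; first lra. move=> x y hx hy hd. rewrite /= !Rmult_1_l Rmult_1_r.
    have h1 := ln_close x y ltac:(lra) hy. have h2 := ln_close y x hy ltac:(lra). rewrite Rabs_minus_sym in h2.
    apply: Rabs_le. lra.
  - exists (2 * K + 2). split; first lra. move=> x y hx hy hd. have h := hK x y hx hy hd.
    have xk : 0 < x ^ k by apply: pow_lt; lra.
    have lx : 0 <= ln x <= x by split; [apply: ln_ge0; lra | have := ln_le_sub1 x; lra].
    rewrite (_ : y ^ S k * ln y - x ^ S k * ln x = y * (y ^ k * ln y - x ^ k * ln x) + (y - x) * (x ^ k * ln x)); last by rewrite /=; ring.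
    apply: Rle_trans (Rabs_triang _ _) _. rewrite !Rabs_mult.
    have yb : Rabs y <= 2 * x by rewrite Rabs_pos_eq; [move: hd => /Rabs_le_between; lra | lra].
    have e1 : Rabs y * Rabs (y ^ k * ln y - x ^ k * ln x) <= (2 * x) * (K * x ^ k) by apply: Rmult_le_compat => //; exact: Rabs_pos.
    have e2 : Rabs (y - x) * (Rabs (x ^ k) * Rabs (ln x)) <= 2 * (x ^ k * x).
    { rewrite (Rabs_pos_eq (x ^ k)); last lra. rewrite (Rabs_pos_eq (ln x)); last lra.
      apply: Rmult_le_compat => //; [exact: Rabs_pos | apply: Rmult_le_pos; lra | apply: Rmult_le_compat_l; lra]. }
    rewrite /=. lra.
Qed.

Lemma continuous_pow_ln k x : 0 < x -> continuous (fun x => x ^ k * ln x) x.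
Proof. move=> h. apply: ex_derive_continuousR. auto_derive. lra. Qed.

Lemma continuous_pow k x : continuous (fun x : R => x ^ k) x.
Proof. apply: ex_derive_continuousR. by auto_derive. Qed.

Lemma is_derive_pow_ln n x : 0 < x -> is_derive (fun x => x ^ S n * ln x) x (INR (S n) * (x ^ n * ln x) + x ^ n).
Proof. move=> h. auto_derive => //. rewrite -/(INR (S n)). field. lra. Qed.

Lemma is_derive_pow_S n x : is_derive (fun x : R => x ^ S n) x (INR (S n) * x ^ n).
Proof. auto_derive => //. rewrite -/(INR (S n)). ring. Qed.

(** b u1 - u2 is a primitive of the integrand, where u1 and u2 have the leading terms x^(k+1) ln x /
    (k+1) and x^(k+2) ln x / (k+2). At b these leave 1/(k+1) - 1/(k+2), the source of the product
    rho (rho + 1). *)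
Lemma RInt_pow_ln_le k A : 1 <= A -> exists K, 0 <= K /\ forall b, A <= b ->
  Rabs (RInt (fun x => x ^ k * ln x * (b - x)) A b - b ^ (k + 2) * ln b / (INR (k + 1) * INR (k + 2))) <= K * b ^ (k + 2).
Proof.
  move=> A1. rewrite (_ : (k + 2 = S (S k))%nat); last by lia. rewrite (_ : (k + 1 = S k)%nat); last by lia.
  set n1 := INR (S k). set n2 := INR (S (S k)).
  have n10 : 1 <= n1 by rewrite /n1 S_INR; have := pos_INR k; lra.
  have n20 : n2 = n1 + 1 by rewrite /n2 S_INR.
  set u1 := fun x => x ^ S k * ln x / n1 - x ^ S k / n1 ^ 2.
  set u2 := fun x => x ^ S (S k) * ln x / n2 - x ^ S (S k) / n2 ^ 2.
  have d1 : forall x, 0 < x -> is_derive u1 x (x ^ k * ln x).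
  { move=> x hx. have h := is_derive_minus (K:=R_AbsRing) (V:=R_NormedModule) _ _ x _ _ (is_derive_scal _ x (/ n1) _ (is_derive_pow_ln k x hx)) (is_derive_scal _ x (/ n1 ^ 2) _ (is_derive_pow_S k x)).
    apply: (is_derive_ext (fun x => / n1 * (x ^ S k * ln x) - / n1 ^ 2 * x ^ S k)); first by move=> s; rewrite /u1 /Rdiv; Rring.
    rewrite (_ : x ^ k * ln x = / n1 * (n1 * (x ^ k * ln x) + x ^ k) - / n1 ^ 2 * (n1 * x ^ k)); first exact: h.
    field. lra. }
  have d2 : forall x, 0 < x -> is_derive u2 x (x ^ S k * ln x).
  { move=> x hx. have h := is_derive_minus (K:=R_AbsRing) (V:=R_NormedModule) _ _ x _ _ (is_derive_scal _ x (/ n2) _ (is_derive_pow_ln (S k) x hx)) (is_derive_scal _ x (/ n2 ^ 2) _ (is_derive_pow_S (S k) x)).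
    apply: (is_derive_ext (fun x => / n2 * (x ^ S (S k) * ln x) - / n2 ^ 2 * x ^ S (S k))); first by move=> s; rewrite /u2 /Rdiv; Rring.
    rewrite (_ : x ^ S k * ln x = / n2 * (n2 * (x ^ S k * ln x) + x ^ S k) - / n2 ^ 2 * (n2 * x ^ S k)); first exact: h.
    field. lra. }
  exists (2 + Rabs (u1 A) + Rabs (u2 A)).
  have a1 := Rabs_pos (u1 A). have a2 := Rabs_pos (u2 A). split; first lra.
  move=> b hb.
  have e : RInt (fun x => x ^ k * ln x * (b - x)) A b = (b * u1 b - u2 b) - (b * u1 A - u2 A).
  { apply: is_RInt_unique. apply: (is_RInt_derive (V:=R_CompleteNormedModule) (fun x => b * u1 x - u2 x)) => x; rewrite Rmin_left // Rmax_right // => hx.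
    - have h := is_derive_minus (K:=R_AbsRing) (V:=R_NormedModule) _ _ x _ _ (is_derive_scal _ x b _ (d1 x ltac:(lra))) (d2 x ltac:(lra)).
      rewrite (_ : x ^ k * ln x * (b - x) = b * (x ^ k * ln x) - x ^ S k * ln x); first exact: h. rewrite /=; ring.
    - apply: continuous_multR; first by apply: continuous_pow_ln; lra.
      apply: continuous_minusR; [exact: continuous_const | exact: continuous_id]. }
  rewrite e.
  set P := b ^ S (S k).
  have P1 : b <= P by rewrite /P -{1}(pow_1 b); apply: Rle_pow; [lra | lia].
  have bP : b * b ^ S k = P by [].
  rewrite (_ : b * u1 b - u2 b - (b * u1 A - u2 A) - P * ln b / (n1 * n2) = - (P / n1 ^ 2 - P / n2 ^ 2) - b * u1 A + u2 A); last first.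
  { rewrite /u1 /u2 -/P (_ : b * (b ^ S k * ln b / n1 - b ^ S k / n1 ^ 2) = P * ln b / n1 - P / n1 ^ 2); last by rewrite -bP /Rdiv; ring.
    rewrite n20. field. lra. }
  have i1 : 0 <= P / n1 ^ 2 <= P.
  { have : 1 <= n1 ^ 2 by nra. move=> h. split; first by apply: Rmult_le_pos; [lra | left; apply: Rinv_0_lt_compat; lra].
    apply: (Rmult_le_reg_r (n1 ^ 2)); first lra. rewrite /Rdiv Rmult_assoc Rinv_l; nra. }
  have i2 : 0 <= P / n2 ^ 2 <= P.
  { have : 1 <= n2 ^ 2 by nra. move=> h. split; first by apply: Rmult_le_pos; [lra | left; apply: Rinv_0_lt_compat; lra].
    apply: (Rmult_le_reg_r (n2 ^ 2)); first lra. rewrite /Rdiv Rmult_assoc Rinv_l; nra. }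
  have b1 : Rabs (b * u1 A) <= P * Rabs (u1 A) by rewrite Rabs_mult Rabs_pos_eq; [apply: Rmult_le_compat_r; lra | lra].
  have b2 : Rabs (u2 A) <= P * Rabs (u2 A) by nra.
  move/Rabs_le_between: b1 => b1. move/Rabs_le_between: b2 => b2. apply: Rabs_le. lra.
Qed.

Lemma RInt_le_const (g : R -> R) a b c : a <= b -> (forall x, a <= x <= b -> continuous g x) -> (forall x, a <= x <= b -> g x <= c) ->
  RInt g a b <= c * (b - a).
Proof.
  move=> ab hc hg. have e : RInt (fun _ => c) a b = c * (b - a).
  { rewrite (RInt_const (V:=R_CompleteNormedModule)) /scal /= /mult /=. Rring. }
  rewrite -e.
  apply: RInt_le => //.
  - apply: (ex_RInt_continuous (V:=R_CompleteNormedModule)) => x. by rewrite Rmin_left // Rmax_right //; exact: hc.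
  - exact: ex_RInt_const.
  - move=> x hx. apply: hg. lra.
Qed.

(** The margin 5 leaves room for the box around the contour, whose right side is at some B' < B +
    2. *)
Definition suitable f B m := exists x1 x2 H, x1 <= 0 /\ B + 5 <= x2 /\ B + 5 <= H /\ factored f x1 x2 H m.

(** [jensen_curve] with M x = M0 x^(rho-1) ln x + O(x^(rho-1)), the second term covering the shift
    from |z| to X. M0 may be negative, hence the absolute values in the errors. *)
Theorem depth_sum_sharp rho f t M0 R1 : class_F rho f -> 0 < t ->
  (forall z, log_curve t z -> R1 <= Cmod z -> Cmod (f z) <= exp (M0 * (Cmod z ^ (rho - 1) * ln (Cmod z)))) ->
  exists A1 K, 3 <= A1 /\ 0 <= K /\ forall B m, A1 <= B -> suitable f B m ->
    Rsum (fun a => depth t A1 a * Rmax 0 (B - Cmod a)) m <=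
      M0 / (2 * PI * (INR rho * INR (rho + 1))) * (B ^ (rho + 1) * ln B) + K * B ^ (rho + 1).
Proof.
  move=> hF t0 hMv. have rho1 := F_rho _ _ hF.
  set k := (rho - 1)%nat in hMv *.
  have [K1 [K10 hK1]] := pow_ln_close k.
  have aM := Rabs_pos M0.
  have cM : forall x, 2 < x -> continuous (fun x => M0 * (x ^ k * ln x) + Rabs M0 * K1 * x ^ k) x.
  { move=> x hx. apply: continuous_plusR; apply: continuous_multR; try exact: continuous_const.
    - apply: continuous_pow_ln. lra.
    - exact: continuous_pow. }
  have hZ : forall z X, log_curve t z -> Rmax R1 4 <= Cmod z -> Rabs (Cmod z - X) <= 1 -> Cmod (f z) <= exp (M0 * (X ^ k * ln X) + Rabs M0 * K1 * X ^ k).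
  { move=> z X hz hR hX. have m1 := Rmax_l R1 4. have m2 := Rmax_r R1 4.
    apply: Rle_trans (hMv z hz ltac:(lra)) _.
    have hX' := hX. move/Rabs_le_between: hX' => hX'.
    have h := hK1 X (Cmod z) ltac:(lra) ltac:(lra) ltac:(lra).
    set u := Cmod z ^ k * ln (Cmod z) in h *. set v := X ^ k * ln X in h *.
    have h2 : M0 * (u - v) <= Rabs M0 * (K1 * X ^ k).
    { apply: Rle_trans (Rle_abs _) _. rewrite Rabs_mult. apply: Rmult_le_compat_l => //. }
    apply: exp_le_mono. lra. }
  have [A [A1 [K [A3 [AA1 [K0 hJ]]]]]] := jensen_curve rho f t _ (Rmax R1 4) hF t0 cM hZ.
  have [K2 [K20 hK2]] := RInt_pow_ln_le k A ltac:(lra).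
  have [K3 [K30 hK3]] := pow_ln_close (k + 2).
  have PI0 := PI_RGT_0.
  have ek1 : (k + 1 = rho)%nat by rewrite /k; lia. have ek2 : (k + 2 = rho + 1)%nat by rewrite /k; lia.
  rewrite ek2 in hK3. rewrite ek1 ek2 in hK2.
  set n1 := INR rho in hK2 *. set n2 := INR (rho + 1) in hK2 *.
  have n10 : 1 <= n1 by rewrite /n1; have := le_INR _ _ rho1; rewrite [INR 1]/=; lra.
  have n20 : 1 <= n2 by rewrite /n2 plus_INR [INR 1]/= -/n1; lra.
  set c0 := n1 * n2. have c01 : 1 <= c0 by rewrite /c0; nra.
  set KK := (K + Rabs M0 * K2 * 4 ^ (rho + 1) + Rabs M0 * K1 * 4 ^ (rho + 1) + Rabs M0 * K3).
  have p4 : 0 < 4 ^ (rho + 1) by apply: pow_lt; lra.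
  have KK0 : 0 <= KK.
  { have : 0 <= Rabs M0 * K2 by apply: Rmult_le_pos. have : 0 <= Rabs M0 * K1 by apply: Rmult_le_pos. have : 0 <= Rabs M0 * K3 by apply: Rmult_le_pos.
    rewrite /KK. nra. }
  exists A1, (KK / (2 * PI)). split; first lra.
  split; first by apply: Rmult_le_pos => //; left; apply: Rinv_0_lt_compat; lra.
  move=> B m hB [x1 [x2 [H [hx1 [hx2 [hH hfac]]]]]].
  have [B' [hB' hle]] := hJ B hB x1 x2 H m hx1 hx2 hH hfac.
  have AB : A <= B' by lra.
  have cbx : forall x, continuous (fun x => B' - x) x by move=> x; apply: continuous_minusR; [exact: continuous_const | exact: continuous_id].
  have j1 : ex_RInt (fun x => x ^ k * ln x * (B' - x)) A B'.
  { apply: ex_RInt_continuousR => // x hx.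
    apply: continuous_multR; [apply: continuous_pow_ln; lra | exact: cbx]. }
  have cj2 : forall x, continuous (fun x => x ^ k * (B' - x)) x.
  { move=> x. apply: continuous_multR; [exact: continuous_pow | exact: cbx]. }
  have j2 : ex_RInt (fun x => x ^ k * (B' - x)) A B' by apply: (ex_RInt_continuous (V:=R_CompleteNormedModule)) => x _; exact: cj2.
  set I1 := RInt (fun x => x ^ k * ln x * (B' - x)) A B'. set I2 := RInt (fun x => x ^ k * (B' - x)) A B'.
  have eJ : RInt (fun x => (M0 * (x ^ k * ln x) + Rabs M0 * K1 * x ^ k) * (B' - x)) A B' = M0 * I1 + Rabs M0 * K1 * I2.
  { apply: is_RInt_unique. apply: (is_RInt_ext (fun x => M0 * (x ^ k * ln x * (B' - x)) + Rabs M0 * K1 * (x ^ k * (B' - x)))).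
    { move=> x _. Rring. }
    apply: (is_RInt_plus (V:=R_NormedModule)).
    - exact: (is_RInt_scal (V:=R_NormedModule) _ _ _ M0 _ (RInt_correct (V:=R_CompleteNormedModule) _ _ _ j1)).
    - exact: (is_RInt_scal (V:=R_NormedModule) _ _ _ (Rabs M0 * K1) _ (RInt_correct (V:=R_CompleteNormedModule) _ _ _ j2)). }
  rewrite eJ in hle.
  set P := B ^ (rho + 1) in hle *. set P' := B' ^ (rho + 1).
  have PP : P' <= 4 ^ (rho + 1) * P by rewrite /P' /P -Rpow_mult_distr; apply: pow_incr; lra.
  have P0 : 0 < P by apply: pow_lt; lra.
  have i1 := hK2 B' AB. rewrite -/I1 -/P' -/c0 in i1.
  have i2 : I2 <= P'.
  { have : I2 <= (B' ^ k * B') * (B' - A).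
    { apply: RInt_le_const => // x hx. have : x ^ k <= B' ^ k by apply: pow_incr; lra.
      move=> hk. apply: Rmult_le_compat; try lra. apply: pow_le; lra. }
    have e : P' = B' ^ k * B' * B' by rewrite /P' -ek2 (_ : (k + 2 = S (S k))%nat) /=; [ring | lia].
    have : 0 <= B' ^ k * B' by apply: Rmult_le_pos; [apply: pow_le; lra | lra]. nra. }
  have i3 := hK3 B B' ltac:(lra) ltac:(lra) ltac:(apply: Rabs_le; lra). rewrite -/P -/P' in i3.
  have k1 : M0 * I1 <= M0 * (P' * ln B' / c0) + Rabs M0 * (K2 * P').
  { have : M0 * (I1 - P' * ln B' / c0) <= Rabs M0 * (K2 * P').
    { apply: Rle_trans (Rle_abs _) _. rewrite Rabs_mult. apply: Rmult_le_compat_l => //. } lra. }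
  have k2 : M0 * (P' * ln B' / c0) <= M0 * (P * ln B / c0) + Rabs M0 * (K3 * P).
  { have : M0 * ((P' * ln B' - P * ln B) / c0) <= Rabs M0 * (K3 * P).
    { apply: Rle_trans (Rle_abs _) _. rewrite Rabs_mult. apply: Rmult_le_compat_l => //.
      rewrite /Rdiv Rabs_mult (Rabs_pos_eq (/ c0)); last by left; apply: Rinv_0_lt_compat; lra.
      have ic : / c0 <= 1 by rewrite -Rinv_1; apply: Rinv_le_contravar; lra.
      have := Rabs_pos (P' * ln B' - P * ln B). have : 0 < / c0 by apply: Rinv_0_lt_compat; lra. nra. }
    rewrite (_ : (P' * ln B' - P * ln B) / c0 = P' * ln B' / c0 - P * ln B / c0); last by field; lra. lra. }
  have k3 : Rabs M0 * (K2 * P') <= Rabs M0 * K2 * 4 ^ (rho + 1) * P.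
  { rewrite -Rmult_assoc (Rmult_assoc (Rabs M0 * K2)). apply: Rmult_le_compat_l => //. exact: Rmult_le_pos. }
  have k4 : Rabs M0 * K1 * I2 <= Rabs M0 * K1 * 4 ^ (rho + 1) * P.
  { rewrite (Rmult_assoc (Rabs M0 * K1)). apply: Rmult_le_compat_l; [exact: Rmult_le_pos | lra]. }
  set S := Rsum _ _ in hle *.
  apply: (Rmult_le_reg_l (2 * PI)); first lra.
  rewrite (_ : 2 * PI * (M0 / (2 * PI * c0) * (P * ln B) + KK / (2 * PI) * P) = M0 * (P * ln B / c0) + KK * P); last by field; lra.
  rewrite /KK. lra.
Qed.

(** No bound along the curve is assumed: the order of f alone gives M x = O(x^rho), and integrating
    it against B' - x adds two powers. It will be applied to the curve with t + 1, on which nothing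
    more is known. *)
Theorem depth_sum_crude rho f t : class_F rho f -> 0 < t ->
  exists A1 K, 3 <= A1 /\ 0 <= K /\ forall B m, A1 <= B -> suitable f B m ->
    Rsum (fun a => depth t A1 a * Rmax 0 (B - Cmod a)) m <= K * B ^ (rho + 2).
Proof.
  move=> hF t0. have rho1 := F_rho _ _ hF.
  have [cg [Kg [Rg hg]]] := F_growth _ _ hF.
  have [Rl [Rl3 hRl]] := ln_sq_small t t0.
  set c := Rabs cg. have c0 : 0 <= c by exact: Rabs_pos.
  set L := Rabs (ln (Rmax 1 Kg)). have L0 : 0 <= L by exact: Rabs_pos.
  have g1 : 1 <= Rmax 1 Kg by exact: Rmax_l. have g2 : Kg <= Rmax 1 Kg by exact: Rmax_r.
  set M := fun x => c * (x + 1) ^ rho + L.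
  have cM : forall x, continuous M x.
  { move=> x. apply: ex_derive_continuousR. rewrite /M. by auto_derive. }
  have hZ : forall z X, log_curve t z -> Rmax Rg 3 <= Cmod z -> Rabs (Cmod z - X) <= 1 -> Cmod (f z) <= exp (M X).
  { move=> z X [hz1 hz2] hR hX. have m1 := Rmax_l Rg 3. have m2 := Rmax_r Rg 3.
    have lz := ln_ge0 (Cmod z) ltac:(lra).
    apply: Rle_trans (hg z ltac:(rewrite hz1; nra) ltac:(lra)) _.
    move/Rabs_le_between: hX => hX.
    have zp : 0 <= Cmod z ^ rho by apply: pow_le; exact: Cmod_ge_0.
    have k1 : cg * Cmod z ^ rho <= c * (X + 1) ^ rho.
    { apply: Rle_trans (Rmult_le_compat_r _ _ _ zp (Rle_abs cg)) _. apply: Rmult_le_compat_l => //. apply: pow_incr. lra. }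
    have ep := exp_pos (cg * Cmod z ^ rho).
    apply: Rle_trans (Rmult_le_compat_r _ _ _ (Rlt_le _ _ ep) g2) _.
    rewrite /M exp_plus Rmult_comm. apply: Rmult_le_compat; try lra.
    - apply: exp_le_mono. lra.
    - rewrite -{1}(exp_ln (Rmax 1 Kg)); last lra. rewrite /L.
      case: (Rle_lt_or_eq_dec _ _ (Rle_abs (ln (Rmax 1 Kg)))) => [h|<-]; last lra. left. exact: exp_increasing. }
  have [A [A1 [K [A3 [AA1 [K0 hJ]]]]]] := jensen_curve rho f t M (Rmax Rg 3) hF t0 (fun x _ => cM x) hZ.
  have PI0 := PI_RGT_0. have PI3 := PI2_3_2.
  have p4 : 0 < 4 ^ (rho + 2) by apply: pow_lt; lra.
  have p8 : 0 < 8 ^ (rho + 2) by apply: pow_lt; lra.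
  exists A1, (K + (c + L) * 8 ^ (rho + 2)). split; first lra.
  split; first by apply: Rplus_le_le_0_compat => //; apply: Rmult_le_pos; lra.
  move=> B m hB [x1 [x2 [H [hx1 [hx2 [hH hfac]]]]]].
  have [B' [hB' hle]] := hJ B hB x1 x2 H m hx1 hx2 hH hfac.
  have hI : RInt (fun x => M x * (B' - x)) A B' <= (c + L) * 8 ^ (rho + 2) * B ^ (rho + 2).
  { apply: Rle_trans (RInt_le_const _ A B' ((c + L) * (8 * B) ^ rho * (8 * B)) ltac:(lra) _ _) _.
    - move=> x hx. apply: continuous_multR; first exact: cM.
      apply: continuous_minusR; [exact: continuous_const | exact: continuous_id].
    - move=> x hx. apply: Rmult_le_compat; try lra.
      + rewrite /M. apply: Rplus_le_le_0_compat => //. apply: Rmult_le_pos => //. apply: pow_le. lra.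
      + have q1 : (x + 1) ^ rho <= (8 * B) ^ rho by apply: pow_incr; lra.
        have q2 : 1 <= (8 * B) ^ rho by apply: pow_R1_Rle; lra.
        rewrite /M. nra.
    - rewrite (Rmult_assoc (c + L) (8 ^ (rho + 2))) -Rpow_mult_distr pow_add.
      have q : 0 <= (c + L) * (8 * B) ^ rho by apply: Rmult_le_pos; [lra | apply: pow_le; lra].
      have q3 : (8 * B) * (B' - A) <= (8 * B) * (8 * B) by apply: Rmult_le_compat_l; lra.
      have := Rmult_le_compat_l _ _ _ q q3. rewrite /=. lra. }
  set S := Rsum _ _ in hle *.
  have S0 : 2 * PI * S <= (K + (c + L) * 8 ^ (rho + 2)) * B ^ (rho + 2).
  { have : K * B ^ (rho + 1) <= K * B ^ (rho + 2) by apply: Rmult_le_compat_l => //; apply: Rle_pow; [lra | lia]. lra. }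
  have R0 : 0 <= (K + (c + L) * 8 ^ (rho + 2)) * B ^ (rho + 2).
  { apply: Rmult_le_pos; last by apply: pow_le; lra. apply: Rplus_le_le_0_compat => //; apply: Rmult_le_pos; lra. }
  case: (Rle_dec S 0) => hS; first lra. nra.
Qed.

(** * Superposition of the kernels (B - x)_+ *)

Lemma RInt_derive_R (f df : R -> R) a b : a <= b -> (forall x, a <= x <= b -> is_derive f x (df x)) ->
  (forall x, a <= x <= b -> continuous df x) -> is_RInt df a b (f b - f a).
Proof.
  move=> ab h1 h2. apply: (is_RInt_derive (V:=R_CompleteNormedModule) f df) => x; rewrite Rmin_left // Rmax_right //; [exact: h1 | exact: h2].
Qed.

Section Transfer.
Variables (p p' p'' V V' V'' : R -> R) (a r : R).
Hypothesis ar : a <= r.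
Hypothesis dp : forall x, a <= x <= r -> is_derive p x (p' x).
Hypothesis dp' : forall x, a <= x <= r -> is_derive p' x (p'' x).
Hypothesis cp'' : forall x, a <= x <= r -> continuous p'' x.
Hypothesis dV : forall x, a <= x <= r -> is_derive V x (V' x).
Hypothesis dV' : forall x, a <= x <= r -> is_derive V' x (V'' x).
Hypothesis cV'' : forall x, a <= x <= r -> continuous V'' x.
Hypothesis pr : p r = 0.
Hypothesis p'r : p' r <= 0.
Hypothesis p''0 : forall x, a <= x <= r -> 0 <= p'' x.

Lemma cts_of_derive (g dg : R -> R) x : is_derive g x (dg x) -> continuous g x.
Proof. move=> h. apply: ex_derive_continuousR. by exists (dg x). Qed.

(* p restricted to [x <= r] is a superposition of the functions (B - x)_+. *)
Lemma kernel_repr x : a <= x ->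
  is_RInt (fun B => p'' B * Rmax 0 (B - x)) a r ((if Rle_dec x r then p x else 0) + p' r * Rmax 0 (r - x)).
Proof.
  move=> ax. case: Rle_dec => xr; last first.
  - rewrite Rmax_left; last lra. rewrite Rmult_0_r Rplus_0_l.
    apply: (is_RInt_ext (fun _ => 0)).
    + move=> B. rewrite Rmin_left // Rmax_right // => hB. rewrite Rmax_left; [Rring | lra].
    + have := is_RInt_const (V:=R_NormedModule) a r 0. rewrite /scal /= /mult /= Rmult_0_r. exact.
  - rewrite Rmax_right; last lra.
    have h1 : is_RInt (fun B => p'' B * Rmax 0 (B - x)) a x 0.
    { apply: (is_RInt_ext (fun _ => 0)).
      + move=> B. rewrite Rmin_left // Rmax_right // => hB. rewrite Rmax_left; [Rring | lra].
      + have := is_RInt_const (V:=R_NormedModule) a x 0. rewrite /scal /= /mult /= Rmult_0_r. exact. }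
    have h2 : is_RInt (fun B => p'' B * Rmax 0 (B - x)) x r ((p' r * (r - x) - p r) - (p' x * (x - x) - p x)).
    { apply: (is_RInt_ext (fun B => p'' B * (B - x))).
      + move=> B. rewrite Rmin_left // Rmax_right // => hB. rewrite Rmax_right; [Rring | lra].
      + apply: (RInt_derive_R (fun B => p' B * (B - x) - p B)) => // B hB.
        * have d1 : is_derive (fun B => B - x) B 1 by auto_derive.
          have h := is_derive_minus (K:=R_AbsRing) (V:=R_NormedModule) _ _ B _ _ (is_derive_mult (K:=R_AbsRing) _ _ B _ _ (dp' B ltac:(lra)) d1 Rmult_comm) (dp B ltac:(lra)).
          rewrite (_ : p'' B * (B - x) = p'' B * (B - x) + p' B * 1 - p' B); [exact: h | ring].
        * apply: continuous_multR; first by apply: cp''; lra.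
          apply: continuous_minusR; [exact: continuous_id | exact: continuous_const]. }
    have := is_RInt_Chasles (V:=R_NormedModule) _ _ _ _ _ _ h1 h2. rewrite /plus /= pr.
    rewrite (_ : 0 + (p' r * (r - x) - 0 - (p' x * (x - x) - p x)) = p x + p' r * (r - x)); [exact | ring].
Qed.

Variables (y x : C -> R).

Lemma kernel_repr_sum m : (forall b, In b m -> y b = 0 \/ a <= x b) ->
  is_RInt (fun B => p'' B * Rsum (fun b => y b * Rmax 0 (B - x b)) m) a r
   (Rsum (fun b => y b * (if Rle_dec (x b) r then p (x b) else 0)) m + p' r * Rsum (fun b => y b * Rmax 0 (r - x b)) m).
Proof.
  elim: m => [|b m IH] hm.
  - rewrite /= Rmult_0_r Rplus_0_r. apply: (is_RInt_ext (fun _ => 0)); first by move=> s _; Rring.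
    have := is_RInt_const (V:=R_NormedModule) a r 0. rewrite /scal /= /mult /= Rmult_0_r. exact.
  - have {}IH := IH (fun b' hb => hm b' (or_intror hb)).
    have hb : is_RInt (fun B => y b * (p'' B * Rmax 0 (B - x b))) a r (y b * ((if Rle_dec (x b) r then p (x b) else 0) + p' r * Rmax 0 (r - x b))).
    { case: (hm b (or_introl eq_refl)) => [->|hx].
      - rewrite Rmult_0_l. apply: (is_RInt_ext (fun _ => 0)); first by move=> s _; Rring.
        have := is_RInt_const (V:=R_NormedModule) a r 0. rewrite /scal /= /mult /= Rmult_0_r. exact.
      - exact: (is_RInt_scal (V:=R_NormedModule) _ _ _ (y b) _ (kernel_repr (x b) hx)). }
    have h := is_RInt_plus (V:=R_NormedModule) _ _ _ _ _ _ hb IH.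
    rewrite [Rsum _ (b :: m)]/= [Rsum (fun b => y b * Rmax 0 (r - x b)) (b :: m)]/=.
    match type of h with is_RInt _ _ _ ?v => match goal with |- is_RInt _ _ _ ?v' => have e : v = v' by rewrite /plus /=; Rring end end.
    rewrite -e. apply: is_RInt_ext h => s _. rewrite /plus /=. Rring.
Qed.

(** Two integrations by parts turn the integral of p'' V into that of p V''. At r the term p' r V r
    is compared with p' r times the sum at B = r, and p' r <= 0 gives the right direction; the other
    term vanishes with p r. *)
Theorem transfer m : (forall b, In b m -> y b = 0 \/ a <= x b) ->
  (forall B, a <= B <= r -> Rsum (fun b => y b * Rmax 0 (B - x b)) m <= V B) ->
  Rsum (fun b => y b * (if Rle_dec (x b) r then p (x b) else 0)) m <=
    - p' a * V a + p a * V' a + RInt (fun B => p B * V'' B) a r.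
Proof.
  move=> hm hV. have h1 := kernel_repr_sum m hm.
  have cV : forall B, a <= B <= r -> continuous V B by move=> B hB; exact: cts_of_derive (dV B hB).
  have cp : forall B, a <= B <= r -> continuous p B by move=> B hB; exact: cts_of_derive (dp B hB).
  have x2 : ex_RInt (fun B => p'' B * V B) a r.
  { apply: ex_RInt_continuousR => // B hB.
    apply: continuous_multR; [exact: cp'' | exact: cV]. }
  have x3 : ex_RInt (fun B => p B * V'' B) a r.
  { apply: ex_RInt_continuousR => // B hB.
    apply: continuous_multR; [exact: cp | exact: cV'']. }
  have le : RInt (fun B => p'' B * Rsum (fun b => y b * Rmax 0 (B - x b)) m) a r <= RInt (fun B => p'' B * V B) a r.
  { apply: RInt_le => //; first by eexists; exact: h1.
    move=> B hB. apply: Rmult_le_compat_l; [apply: p''0; lra | apply: hV; lra]. }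
  rewrite (is_RInt_unique _ _ _ _ h1) in le.
  have h4 : is_RInt (fun B => p'' B * V B - p B * V'' B) a r ((p' r * V r - p r * V' r) - (p' a * V a - p a * V' a)).
  { apply: (RInt_derive_R (fun B => p' B * V B - p B * V' B)) => // B hB.
    - have h := is_derive_minus (K:=R_AbsRing) (V:=R_NormedModule) _ _ B _ _ (is_derive_mult (K:=R_AbsRing) _ _ B _ _ (dp' B hB) (dV B hB) Rmult_comm)
        (is_derive_mult (K:=R_AbsRing) _ _ B _ _ (dp B hB) (dV' B hB) Rmult_comm).
      rewrite (_ : p'' B * V B - p B * V'' B = (p'' B * V B + p' B * V' B) - (p' B * V' B + p B * V'' B)); [exact: h | ring].
    - apply: continuous_minusR; apply: continuous_multR; [exact: cp'' | exact: cV | exact: cp | exact: cV'']. }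
  have e4 := is_RInt_unique _ _ _ _ h4.
  have e5 : RInt (fun B => p'' B * V B - p B * V'' B) a r = RInt (fun B => p'' B * V B) a r - RInt (fun B => p B * V'' B) a r.
  { exact: (RInt_minus (V:=R_CompleteNormedModule) _ _ a r x2 x3). }
  rewrite e4 pr in e5.
  have k := Rmult_le_compat_neg_l (p' r) _ _ p'r (hV r ltac:(lra)).
  lra.
Qed.
End Transfer.

(** * Estimates for the kernels ln r / ln x - 1 and (ln r / ln x - 1) / x *)

Lemma eps_split k (g eps : R) : 0 < eps -> exists D, 0 <= D /\ forall x, 3 <= x -> g * (x ^ k / ln x) <= eps * x ^ k + D / x.
Proof.
  move=> e0. set X := exp (Rabs g / eps). have ag := Rabs_pos g.
  have X0 : 0 < X by exact: exp_pos.
  exists (Rabs g * X ^ S k). split; first by apply: Rmult_le_pos => //; apply: pow_le; lra.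
  move=> x hx. have l1 := ln_ge1 x hx. have xk : 0 < x ^ k by apply: pow_lt; lra.
  have gg := Rle_abs g.
  have il : 0 < / ln x by apply: Rinv_0_lt_compat; lra. have ix : 0 < / x by apply: Rinv_0_lt_compat; lra.
  have b1 : g * (x ^ k / ln x) <= Rabs g * (x ^ k / ln x).
  { apply: Rmult_le_compat_r => //. apply: Rmult_le_pos; lra. }
  have D0 : 0 <= Rabs g * X ^ S k / x by apply: Rmult_le_pos; [apply: Rmult_le_pos => //; apply: pow_le; lra | lra].
  apply: Rle_trans b1 _. case: (Rle_dec X x) => c.
  - have l2 : Rabs g / eps <= ln x by rewrite -(ln_exp (Rabs g / eps)); apply: ln_le_mono.
    have l3 : Rabs g <= eps * ln x.
    { have := Rmult_le_compat_l eps _ _ ltac:(lra) l2. rewrite (_ : eps * (Rabs g / eps) = Rabs g) //. by field; lra. }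
    have l4 : Rabs g * / ln x <= eps.
    { apply: (Rmult_le_reg_r (ln x)); first lra. rewrite Rmult_assoc Rinv_l; lra. }
    rewrite /Rdiv (Rmult_comm (x ^ k)) -Rmult_assoc. have := Rmult_le_compat_r (x ^ k) _ _ ltac:(lra) l4. rewrite /Rdiv in D0. lra.
  - have h1 : x ^ k / ln x <= x ^ k.
    { apply: (Rmult_le_reg_r (ln x)); first lra. rewrite /Rdiv Rmult_assoc Rinv_l; nra. }
    have h2 : x ^ k <= X ^ S k / x.
    { apply: (Rmult_le_reg_r x); first lra. rewrite /Rdiv Rmult_assoc Rinv_l ?Rmult_1_r; last lra.
      rewrite Rmult_comm -[x * x ^ k]/(x ^ S k). apply: pow_incr. lra. }
    have h3 := Rmult_le_compat_l _ _ _ ag (Rle_trans _ _ _ h1 h2).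
    have : 0 <= eps * x ^ k by nra. rewrite /Rdiv in h3 *. lra.
Qed.

(** With n = k + 1 a primitive is c (x^n (ln r - ln x) / n + x^n / n^2) - D (ln r - ln x)^2 / 2. Its
    value at r gives the main term with 1 / n^2; the contribution of a is of order (1 + ln r)^2. *)
Lemma RInt_log_kernel k c D a r : 3 <= a -> a <= r -> 0 <= D ->
  ex_RInt (fun x => (ln r - ln x) * (c * x ^ k + D / x)) a r /\
  RInt (fun x => (ln r - ln x) * (c * x ^ k + D / x)) a r <=
    c * r ^ S k / INR (S k) ^ 2 + (Rabs c * (2 * a ^ S k) + D) * (1 + ln r) ^ 2.
Proof.
  move=> ha har D0. set n := INR (S k). have n1 : 1 <= n by rewrite /n S_INR; have := pos_INR k; lra.
  have la := ln_ge1 a ha. have lr := ln_le_mono a r ltac:(lra) har.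
  have h : is_RInt (fun x => (ln r - ln x) * (c * x ^ k + D / x)) a r
    ((c * (r ^ S k / n * (ln r - ln r) + r ^ S k / n ^ 2) - D / 2 * (ln r - ln r) ^ 2) - (c * (a ^ S k / n * (ln r - ln a) + a ^ S k / n ^ 2) - D / 2 * (ln r - ln a) ^ 2)).
  { apply: (RInt_derive_R (fun x => c * (x ^ S k / n * (ln r - ln x) + x ^ S k / n ^ 2) - D / 2 * (ln r - ln x) ^ 2)) => // x hx.
    - auto_derive; first by repeat split; lra. rewrite -/(INR (S k)) -/n. field. lra.
    - apply: ex_derive_continuousR. auto_derive. repeat split; lra. }
  split; first by eexists; exact: h.
  rewrite (is_RInt_unique _ _ _ _ h).
  have A0 : 0 < a ^ S k by apply: pow_lt; lra.
  set A := a ^ S k in A0 *. set L := ln r in lr *. set la' := ln a in la lr *.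
  have i1 : 0 <= A / n * (L - la') + A / n ^ 2 <= 2 * A * (1 + L) ^ 2.
  { have q1 : 0 < / n <= 1 by split; [apply: Rinv_0_lt_compat; lra | rewrite -Rinv_1; apply: Rinv_le_contravar; lra].
    have q2 : 0 < / n ^ 2 <= 1 by split; [apply: Rinv_0_lt_compat; nra | rewrite -Rinv_1; apply: Rinv_le_contravar; nra].
    rewrite /Rdiv. have r1 : 0 <= A * / n <= A by nra. have r2 : 0 <= A * / n ^ 2 <= A by nra.
    have r3 : 0 <= A * / n * (L - la') <= A * L by nra. have : 1 + L <= (1 + L) ^ 2 by nra. nra. }
  have i2 : - c * (A / n * (L - la') + A / n ^ 2) <= Rabs c * (2 * A * (1 + L) ^ 2).
  { have := Rle_abs (- c). rewrite Rabs_Ropp. have := Rabs_pos c. nra. }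
  have i3 : D / 2 * (L - la') ^ 2 <= D * (1 + L) ^ 2.
  { have : (L - la') ^ 2 <= (1 + L) ^ 2 by nra. have := pow2_ge_0 (L - la'). nra. }
  rewrite (_ : L - L = 0); last by ring.
  rewrite (_ : c * r ^ S k / n ^ 2 = c * (r ^ S k / n ^ 2)); last by rewrite /Rdiv; ring. lra.
Qed.

Lemma ln_ge1_nz x : 3 <= x -> 0 < x /\ 1 <= ln x /\ 0 < / ln x <= 1.
Proof.
  move=> h. have l := ln_ge1 x h. split; first lra. split => //.
  split; [apply: Rinv_0_lt_compat; lra | rewrite -Rinv_1; apply: Rinv_le_contravar; lra].
Qed.

(** Here p V'' = (ln r - ln x) V'' / ln x: the logarithm of the leading term alpha n N x^k ln x of
    V'' cancels, and the rest is O(x^k / ln x) times ln r - ln x, made small by [eps_split].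
    Integration divides by N^2, which leaves alpha n / N. *)
Theorem kernel_sum_sharp k alpha beta a eps : 3 <= a -> 0 < eps -> exists K, 0 <= K /\ forall r, a <= r -> forall m y,
  (forall b, In b m -> y b = 0 \/ a <= Cmod b) ->
  (forall B, a <= B <= r -> Rsum (fun b => y b * Rmax 0 (B - Cmod b)) m <= alpha * (B ^ S (S k) * ln B) + beta * B ^ S (S k)) ->
  Rsum (fun b => y b * (if Rle_dec (Cmod b) r then ln r / ln (Cmod b) - 1 else 0)) m <=
    (alpha * (INR (S (S k)) / INR (S k)) + eps) * r ^ S k + K * (1 + ln r) ^ 2.
Proof.
  move=> ha e0.
  set N := INR (S k). set n := INR (S (S k)).
  have N1 : 1 <= N by rewrite /N S_INR; have := pos_INR k; lra.
  have n1 : 1 <= n by rewrite /n S_INR -/N; lra.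
  set V := fun x => alpha * (x ^ S (S k) * ln x) + beta * x ^ S (S k).
  set V' := fun x => alpha * (n * (x ^ S k * ln x) + x ^ S k) + beta * (n * x ^ S k).
  set V'' := fun x => alpha * (n * (N * (x ^ k * ln x) + x ^ k) + N * x ^ k) + beta * (n * (N * x ^ k)).
  have e1 : 0 < eps * N ^ 2 by apply: Rmult_lt_0_compat => //; apply: pow_lt; lra.
  have [D [D0 hD]] := eps_split k (alpha * (n + N) + beta * n * N) _ e1.
  exists (Rabs (alpha * n * N + eps * N ^ 2) * (2 * a ^ S k) + D + Rabs (V a) + Rabs (V' a)).
  have q1 := Rabs_pos (alpha * n * N + eps * N ^ 2). have q2 := Rabs_pos (V a). have q3 := Rabs_pos (V' a).
  have A0 : 0 < a ^ S k by apply: pow_lt; lra.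
  split.
  { have : 0 <= Rabs (alpha * n * N + eps * N ^ 2) * (2 * a ^ S k) by apply: Rmult_le_pos; lra. lra. }
  move=> r har m y hm hV.
  have [a1 [a2 a3]] := ln_ge1_nz a ha. have r3 : 3 <= r by lra. have [r1 [r2 r4]] := ln_ge1_nz r r3.
  have lar := ln_le_mono a r a1 har.
  set L := ln r in r2 lar hD *.
  set p := fun x => L / ln x - 1. set p' := fun x => - (L / (x * ln x ^ 2)).
  set p'' := fun x => L * (ln x + 2) / (x ^ 2 * ln x ^ 3).
  have dom : forall x, a <= x <= r -> 0 < x /\ 1 <= ln x /\ ln x <= L.
  { move=> x hx. have [h1 [h2 _]] := ln_ge1_nz x ltac:(lra). split => //. split => //. apply: ln_le_mono; lra. }
  have dp : forall x, a <= x <= r -> is_derive p x (p' x).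
  { move=> x hx. have [h1 [h2 h3]] := dom x hx. rewrite /p /p'. auto_derive; first by repeat split; lra. field. lra. }
  have dp' : forall x, a <= x <= r -> is_derive p' x (p'' x).
  { move=> x hx. have [h1 [h2 h3]] := dom x hx. rewrite /p' /p''.
    auto_derive; first by split => //; split => //; apply: Rmult_integral_contrapositive_currified; [lra | nra]. field. lra. }
  have cp'' : forall x, a <= x <= r -> continuous p'' x.
  { move=> x hx. have [h1 [h2 h3]] := dom x hx. apply: ex_derive_continuousR. rewrite /p''. auto_derive.
    do 2 (split; first done). split; last done. apply: Rmult_integral_contrapositive_currified; [nra | apply: Rgt_not_eq; apply: (pow_lt (ln x) 3); lra]. }
  have dV : forall x, a <= x <= r -> is_derive V x (V' x).
  { move=> x hx. have [h1 _] := dom x hx.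
    exact: (is_derive_plus (K:=R_AbsRing) (V:=R_NormedModule) _ _ x _ _ (is_derive_scal _ x alpha _ (is_derive_pow_ln (S k) x h1)) (is_derive_scal _ x beta _ (is_derive_pow_S (S k) x))). }
  have dV' : forall x, a <= x <= r -> is_derive V' x (V'' x).
  { move=> x hx. have [h1 _] := dom x hx.
    exact: (is_derive_plus (K:=R_AbsRing) (V:=R_NormedModule) _ _ x _ _
       (is_derive_scal _ x alpha _ (is_derive_plus (K:=R_AbsRing) (V:=R_NormedModule) _ _ x _ _ (is_derive_scal _ x n _ (is_derive_pow_ln k x h1)) (is_derive_pow_S k x)))
       (is_derive_scal _ x beta _ (is_derive_scal _ x n _ (is_derive_pow_S k x)))). }
  have cV'' : forall x, a <= x <= r -> continuous V'' x.
  { move=> x hx. have [h1 _] := dom x hx. apply: ex_derive_continuousR. rewrite /V''. by auto_derive. }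
  have pr : p r = 0 by rewrite /p -/L; field; lra.
  have ipos : forall u, 0 < u -> 0 < / u by exact: Rinv_0_lt_compat.
  have p'r : p' r <= 0.
  { rewrite /p' -/L. have : 0 <= L / (r * L ^ 2); last lra. apply: Rmult_le_pos; first lra. left. apply: ipos. apply: Rmult_lt_0_compat => //. nra. }
  have p''0 : forall x, a <= x <= r -> 0 <= p'' x.
  { move=> x hx. have [h1 [h2 h3]] := dom x hx. apply: Rmult_le_pos; first by nra. left. apply: ipos. apply: Rmult_lt_0_compat; apply: pow_lt; lra. }
  have tr := transfer p p' p'' V V' V'' a r har dp dp' cp'' dV dV' cV'' pr p'r p''0 y Cmod m hm hV.
  apply: Rle_trans tr _.
  have [ex hI] := RInt_log_kernel k (alpha * n * N + eps * N ^ 2) D a r ha har D0. rewrite -/L -/N in ex hI.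
  have le : RInt (fun x => p x * V'' x) a r <= RInt (fun x => (L - ln x) * ((alpha * n * N + eps * N ^ 2) * x ^ k + D / x)) a r.
  { apply: RInt_le => //.
    - apply: ex_RInt_continuousR => // x hx.
      apply: continuous_multR; [exact: cts_of_derive (dp x hx) | exact: cV''].
    - move=> x hx. have [h1 [h2 h3]] := dom x ltac:(lra). have hd := hD x ltac:(lra).
      rewrite (_ : p x * V'' x = (L - ln x) * (alpha * n * N * x ^ k + (alpha * (n + N) + beta * n * N) * (x ^ k / ln x))).
      + apply: Rmult_le_compat_l; lra.
      + rewrite /p /V''. field. lra. }
  have bd : - p' a * V a + p a * V' a <= (Rabs (V a) + Rabs (V' a)) * (1 + L) ^ 2.
  { have i1 : 0 < / a <= 1 by split; [exact: ipos | rewrite -Rinv_1; apply: Rinv_le_contravar; lra].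
    have s1 : 0 <= - p' a <= L.
    { rewrite /p' Ropp_involutive /Rdiv Rinv_mult -pow_inv.
      have : 0 < (/ ln a) ^ 2 <= 1 by nra. move=> i2. have i3 : 0 < / a * (/ ln a) ^ 2 <= 1 by nra.
      nra. }
    have s2 : 0 <= p a <= L.
    { rewrite /p /Rdiv. split; last by nra.
      have : 1 <= L * / ln a; last lra. apply: (Rmult_le_reg_r (ln a)); first lra. rewrite Rmult_assoc Rinv_l; lra. }
    have v1 := Rle_abs (V a). have v2 := Rle_abs (V' a).
    have : L <= (1 + L) ^ 2 by nra. move=> s3.
    have t1 : - p' a * V a <= L * Rabs (V a).
    { apply: Rle_trans (Rmult_le_compat_l _ _ _ (proj1 s1) v1) _. apply: Rmult_le_compat_r; lra. }
    have t2 : p a * V' a <= L * Rabs (V' a).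
    { apply: Rle_trans (Rmult_le_compat_l _ _ _ (proj1 s2) v2) _. apply: Rmult_le_compat_r; lra. }
    have t3 : L * (Rabs (V a) + Rabs (V' a)) <= (1 + L) ^ 2 * (Rabs (V a) + Rabs (V' a)) by apply: Rmult_le_compat_r; lra. lra. }
  have e2 : (alpha * n * N + eps * N ^ 2) * r ^ S k / N ^ 2 = (alpha * (n / N) + eps) * r ^ S k by field; lra.
  rewrite e2 in hI. lra.
Qed.

(** The additional 1/x in the kernel offsets the additional power in the bound, and V'' carries no
    logarithm: p V'' is O(x^k / ln x) times ln r - ln x, so no main term is left. The kernel is
    convex on x <= r because there ln x <= ln r. *)
Theorem kernel_sum_crude k beta a eps : 3 <= a -> 0 < eps -> exists K, 0 <= K /\ forall r, a <= r -> forall m y,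
  (forall b, In b m -> y b = 0 \/ a <= Cmod b) ->
  (forall B, a <= B <= r -> Rsum (fun b => y b * Rmax 0 (B - Cmod b)) m <= beta * B ^ S (S (S k))) ->
  Rsum (fun b => y b * (if Rle_dec (Cmod b) r then (ln r / ln (Cmod b) - 1) / Cmod b else 0)) m <=
    eps * r ^ S k + K * (1 + ln r) ^ 2.
Proof.
  move=> ha e0.
  set N := INR (S k). set n := INR (S (S k)). set l := INR (S (S (S k))).
  have N1 : 1 <= N by rewrite /N S_INR; have := pos_INR k; lra.
  set V := fun x => beta * x ^ S (S (S k)).
  set V' := fun x => beta * (l * x ^ S (S k)).
  set V'' := fun x => beta * (l * (n * x ^ S k)).
  have e1 : 0 < eps * N ^ 2 by apply: Rmult_lt_0_compat => //; apply: pow_lt; lra.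
  have [D [D0 hD]] := eps_split k (beta * l * n) _ e1.
  exists (Rabs (eps * N ^ 2) * (2 * a ^ S k) + D + Rabs (V a) * 3 + Rabs (V' a)).
  have q1 := Rabs_pos (eps * N ^ 2). have q2 := Rabs_pos (V a). have q3 := Rabs_pos (V' a).
  have A0 : 0 < a ^ S k by apply: pow_lt; lra.
  split.
  { have : 0 <= Rabs (eps * N ^ 2) * (2 * a ^ S k) by apply: Rmult_le_pos; lra. lra. }
  move=> r har m y hm hV.
  have [a1 [a2 a3]] := ln_ge1_nz a ha. have r3 : 3 <= r by lra. have [r1 [r2 r4]] := ln_ge1_nz r r3.
  have lar := ln_le_mono a r a1 har.
  set L := ln r in r2 lar hD *.
  set p := fun x => (L / ln x - 1) / x. set p' := fun x => - (L * (ln x + 1) / (x ^ 2 * ln x ^ 2)) + 1 / x ^ 2.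
  set p'' := fun x => (L * (2 * ln x ^ 2 + 3 * ln x + 2) - 2 * ln x ^ 3) / (x ^ 3 * ln x ^ 3).
  have ipos : forall u, 0 < u -> 0 < / u by exact: Rinv_0_lt_compat.
  have dom : forall x, a <= x <= r -> 0 < x /\ 1 <= ln x /\ ln x <= L.
  { move=> x hx. have [h1 [h2 _]] := ln_ge1_nz x ltac:(lra). split => //. split => //. apply: ln_le_mono; lra. }
  have dp : forall x, a <= x <= r -> is_derive p x (p' x).
  { move=> x hx. have [h1 [h2 h3]] := dom x hx. rewrite /p /p'. auto_derive; first by repeat split; lra. field. lra. }
  have dp' : forall x, a <= x <= r -> is_derive p' x (p'' x).
  { move=> x hx. have [h1 [h2 h3]] := dom x hx. rewrite /p' /p''.
    auto_derive; first by repeat split => //; try (apply: Rmult_integral_contrapositive_currified); nra. field. lra. }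
  have cp'' : forall x, a <= x <= r -> continuous p'' x.
  { move=> x hx. have [h1 [h2 h3]] := dom x hx. apply: ex_derive_continuousR. rewrite /p''. auto_derive.
    do 4 (split; first done). split; last done. apply: Rmult_integral_contrapositive_currified; apply: Rgt_not_eq; [apply: (pow_lt x 3) | apply: (pow_lt (ln x) 3)]; lra. }
  have dV : forall x, a <= x <= r -> is_derive V x (V' x).
  { move=> x hx. exact: (is_derive_scal _ x beta _ (is_derive_pow_S (S (S k)) x)). }
  have dV' : forall x, a <= x <= r -> is_derive V' x (V'' x).
  { move=> x hx. exact: (is_derive_scal _ x beta _ (is_derive_scal _ x l _ (is_derive_pow_S (S k) x))). }
  have cV'' : forall x, a <= x <= r -> continuous V'' x.
  { move=> x hx. apply: ex_derive_continuousR. rewrite /V''. by auto_derive. }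
  have pr : p r = 0 by rewrite /p -/L; field; lra.
  have p'r : p' r <= 0.
  { rewrite /p' -/L. rewrite (_ : - (L * (L + 1) / (r ^ 2 * L ^ 2)) + 1 / r ^ 2 = - (1 / (r ^ 2 * L))); last by field; lra.
    have : 0 < 1 / (r ^ 2 * L); last lra. apply: Rdiv_lt_0_compat; nra. }
  have p''0 : forall x, a <= x <= r -> 0 <= p'' x.
  { move=> x hx. have [h1 [h2 h3]] := dom x hx. apply: Rmult_le_pos.
    - set u := ln x in h2 h3 *. have : u * (2 * u ^ 2) <= L * (2 * u ^ 2) by apply: Rmult_le_compat_r; nra. nra.
    - left. apply: ipos. apply: Rmult_lt_0_compat; apply: pow_lt; lra. }
  have tr := transfer p p' p'' V V' V'' a r har dp dp' cp'' dV dV' cV'' pr p'r p''0 y Cmod m hm hV.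
  apply: Rle_trans tr _.
  have [ex hI] := RInt_log_kernel k (eps * N ^ 2) D a r ha har D0. rewrite -/L -/N in ex hI.
  have le : RInt (fun x => p x * V'' x) a r <= RInt (fun x => (L - ln x) * ((eps * N ^ 2) * x ^ k + D / x)) a r.
  { apply: RInt_le => //.
    - apply: ex_RInt_continuousR => // x hx.
      apply: continuous_multR; [exact: cts_of_derive (dp x hx) | exact: cV''].
    - move=> x hx. have [h1 [h2 h3]] := dom x ltac:(lra). have hd := hD x ltac:(lra).
      rewrite (_ : p x * V'' x = (L - ln x) * (beta * l * n * (x ^ k / ln x))).
      + apply: Rmult_le_compat_l; lra.
      + rewrite /p /V'' -[x ^ S k]/(x * x ^ k). field. lra. }
  have bd : - p' a * V a + p a * V' a <= (Rabs (V a) * 3 + Rabs (V' a)) * (1 + L) ^ 2.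
  { have i1 : 0 < / a <= 1 by split; [exact: ipos | rewrite -Rinv_1; apply: Rinv_le_contravar; lra].
    have s2 : 0 <= L / ln a - 1 <= L.
    { rewrite /Rdiv. split; last by nra.
      have : 1 <= L * / ln a; last lra. apply: (Rmult_le_reg_r (ln a)); first lra. rewrite Rmult_assoc Rinv_l; lra. }
    have s3 : 0 <= p a <= L by rewrite /p; rewrite {1 3}/Rdiv; nra.
    have s1 : Rabs (- p' a) <= 3 * L.
    { rewrite Rabs_Ropp. rewrite (_ : p' a = (/ a) ^ 2 * (- (L * / ln a) - L * (/ ln a * / ln a) + 1)); last by rewrite /p'; field; lra.
      have j1 : 0 < (/ a) ^ 2 <= 1 by nra. have j2 : 0 < / ln a * / ln a <= 1 by nra.
      have j3 : 0 <= L * / ln a <= L by nra. have j4 : 0 <= L * (/ ln a * / ln a) <= L by nra.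
      apply: Rabs_le. nra. }
    have v1 : - p' a * V a <= 3 * L * Rabs (V a).
    { apply: Rle_trans (Rle_abs _) _. rewrite Rabs_mult. apply: Rmult_le_compat_r => //. }
    have v2 := Rle_abs (V' a).
    have s4 : L <= (1 + L) ^ 2 by nra.
    have t2 : p a * V' a <= L * Rabs (V' a).
    { apply: Rle_trans (Rmult_le_compat_l _ _ _ (proj1 s3) v2) _. apply: Rmult_le_compat_r; lra. }
    have t3 : L * (3 * Rabs (V a) + Rabs (V' a)) <= (1 + L) ^ 2 * (3 * Rabs (V a) + Rabs (V' a)) by apply: Rmult_le_compat_r; lra. lra. }
  have e2 : (eps * N ^ 2) * r ^ S k / N ^ 2 = eps * r ^ S k by field; lra.
  rewrite e2 in hI. lra.
Qed.

(** * The counting integral *)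

Definition zone (tau nu : R) (z : C) : Prop :=
  0 < Re z /\ - tau * ln (1 + Cmod z) <= Im z <= 0 /\ Cmod z < nu.

Definition decb (P : Prop) : bool := if Pdec P then true else false.

Lemma decb_iff P : P <-> decb P = true.
Proof. rewrite /decb. by case: Pdec. Qed.

Lemma length_filter_sum (A : C -> Prop) m :
  INR (length (filter (fun a => decb (A a)) m)) = Rsum (fun a => if Pdec (A a) then 1 else 0) m.
Proof.
  elim: m => [|a m IH] //=. rewrite {1}/decb. case: Pdec => h; last by rewrite IH; ring.
  rewrite [length _]/= S_INR IH. ring.
Qed.

Lemma n_zeros_sum f x1 x2 H m tau nu : factored f x1 x2 H m -> x1 <= 0 -> nu <= x2 -> nu <= H ->
  INR (n_zeros f tau nu) = Rsum (fun a => if Pdec (zone tau nu a) then 1 else 0) m.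
Proof.
  move=> [e [h [e0 [hg [ef _]]]]] hx1 hx2 hH. rewrite -length_filter_sum. congr INR.
  apply: zero_count_eq. apply: (lists_zeros_filter f m h) => //.
  - move=> z. exact: decb_iff.
  - move=> z [z1 [[z2 z3] z4]].
    have [_ k1] := re_bounds z. have k2 := im_le_Cmod z.
    have k3 := Rle_abs (- Im z). rewrite Rabs_Ropp in k3.
    have [_ hh] := hg z ltac:(rewrite /in_rect; lra). exact: hh.
Qed.

Definition lnp (r : R) (a : C) : R := if Rlt_dec (Cmod a) r then ln r - ln (Cmod a) else 0.
(** The number tau(a) of the overview, from which on a is counted. *)
Definition level (a : C) : R := - Im a / ln (1 + Cmod a).

Lemma step_RInt_nu r a (P : Prop) : 0 < r -> 0 < Cmod a ->
  is_RInt (fun nu => (if Pdec (P /\ Cmod a < nu) then 1 else 0) / nu) 0 r (if Pdec P then lnp r a else 0).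
Proof.
  move=> r0 a0. case: Pdec => hP; last first.
  { apply: (is_RInt_ext (fun _ => 0)).
    - move=> x _. case: Pdec => [[]//|_]. rewrite /Rdiv Rmult_0_l. done.
    - have := is_RInt_const (V:=R_NormedModule) 0 r 0. rewrite /scal /= /mult /= Rmult_0_r. exact. }
  have zero : forall b, 0 <= b -> b <= Cmod a -> is_RInt (fun nu => (if Pdec (P /\ Cmod a < nu) then 1 else 0) / nu) 0 b 0.
  { move=> b b0 hb. apply: (is_RInt_ext (fun _ => 0)).
    - move=> x. rewrite Rmin_left // Rmax_right // => hx. case: Pdec => [[_ h]|_]; first lra. rewrite /Rdiv Rmult_0_l. done.
    - have := is_RInt_const (V:=R_NormedModule) 0 b 0. rewrite /scal /= /mult /= Rmult_0_r. exact. }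
  rewrite /lnp. case: Rlt_dec => har; last by apply: zero; lra.
  have h2 : is_RInt (fun nu => (if Pdec (P /\ Cmod a < nu) then 1 else 0) / nu) (Cmod a) r (ln r - ln (Cmod a)).
  { apply: (is_RInt_ext (fun nu => / nu)).
    - move=> x. rewrite Rmin_left ?Rmax_right; try lra. move=> hx. case: Pdec => h; last by case: h; split => //; lra.
      rewrite /Rdiv Rmult_1_l. done.
    - apply: RInt_derive_R; first lra.
      + move=> x hx. auto_derive; first lra. field. lra.
      + move=> x hx. apply: continuous_Rinv. lra. }
  have := is_RInt_Chasles (V:=R_NormedModule) _ _ _ _ _ _ (zero (Cmod a) ltac:(lra) ltac:(lra)) h2.
  by rewrite /plus /= Rplus_0_l.
Qed.

Lemma step_RInt_tau t s c : 0 <= t -> 0 <= s -> is_RInt (fun tau => if Rle_dec s tau then c else 0) 0 t (Rmax 0 (t - s) * c).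
Proof.
  move=> t0 s0.
  have zero : forall b, 0 <= b -> b <= s -> is_RInt (fun tau => if Rle_dec s tau then c else 0) 0 b 0.
  { move=> b b0 hb. apply: (is_RInt_ext (fun _ => 0)).
    - move=> x. rewrite Rmin_left // Rmax_right // => hx. case: Rle_dec => h; [lra | done].
    - have := is_RInt_const (V:=R_NormedModule) 0 b 0. rewrite /scal /= /mult /= Rmult_0_r. exact. }
  case: (Rle_dec t s) => h; first by rewrite Rmax_left ?Rmult_0_l; [apply: zero | lra].
  rewrite Rmax_right; last lra.
  have h2 : is_RInt (fun tau => if Rle_dec s tau then c else 0) s t ((t - s) * c).
  { apply: (is_RInt_ext (fun _ => c)).
    - move=> x. rewrite Rmin_left ?Rmax_right; try lra. move=> hx. case: Rle_dec => h'; [done | lra].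
    - exact: (is_RInt_const (V:=R_NormedModule) s t c). }
  have := is_RInt_Chasles (V:=R_NormedModule) _ _ _ _ _ _ (zero s ltac:(lra) ltac:(lra)) h2.
  by rewrite /plus /= Rplus_0_l.
Qed.

Lemma is_RInt_Rsum (F : R -> C -> R) (I : C -> R) a b m : (forall c, In c m -> is_RInt (fun x => F x c) a b (I c)) ->
  is_RInt (fun x => Rsum (F x) m) a b (Rsum I m).
Proof.
  elim: m => [|c m IH] h /=.
  - have := is_RInt_const (V:=R_NormedModule) a b 0. rewrite /scal /= /mult /= Rmult_0_r. exact.
  - exact: (is_RInt_plus (V:=R_NormedModule) _ _ _ _ _ _ (h c (or_introl eq_refl)) (IH (fun c' hc => h c' (or_intror hc)))).
Qed.

(** One finite list serves for all tau <= t and nu <= r at once, so that the integrals are taken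
    term by term over a fixed sum of step functions. *)
Lemma counting_integral f x1 x2 H m t r : factored f x1 x2 H m -> x1 <= 0 -> r <= x2 -> r <= H -> 0 <= t -> 0 < r ->
  RInt (fun tau => RInt (fun nu => INR (n_zeros f tau nu) / nu) 0 r) 0 t =
  Rsum (fun a => Rmax 0 (t - level a) * (if Rlt_dec 0 (Re a) then lnp r a else 0)) m.
Proof.
  move=> hfac hx1 hx2 hH t0 r0.
  have hm : forall a, In a m -> Im a < 0 by case: hfac => e [h [_ [_ [_ k]]]] a ha; exact: (proj1 (proj2 (k a ha))).
  have ca : forall a, In a m -> 0 < Cmod a.
  { move=> a ha. have := hm a ha. have := im_le_Cmod a. have := Rle_abs (- Im a). rewrite Rabs_Ropp. lra. }
  have la : forall a, In a m -> 0 < ln (1 + Cmod a) by move=> a ha; rewrite -ln_1; apply: ln_increasing; have := ca a ha; lra.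
  have inner : forall tau, 0 < tau < t -> RInt (fun nu => INR (n_zeros f tau nu) / nu) 0 r =
     Rsum (fun a => if Rle_dec (level a) tau then (if Rlt_dec 0 (Re a) then lnp r a else 0) else 0) m.
  { move=> tau htau. apply: is_RInt_unique.
    apply: (is_RInt_ext (fun nu => Rsum (fun a => (if Pdec ((0 < Re a /\ - tau * ln (1 + Cmod a) <= Im a <= 0) /\ Cmod a < nu) then 1 else 0) / nu) m)).
    - move=> nu. rewrite Rmin_left ?Rmax_right; try lra. move=> hnu.
      rewrite (n_zeros_sum f x1 x2 H m tau nu hfac hx1 ltac:(lra) ltac:(lra)).
      elim: m {hfac hm ca la} => [|a m IH]; first by rewrite /= /Rdiv Rmult_0_l.
      rewrite /= IH. rewrite /Rdiv Rmult_plus_distr_r. congr (_ * _ + _).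
      rewrite /zone. case: Pdec => h1; case: Pdec => h2 //; exfalso; tauto.
    - apply: is_RInt_Rsum => a ha.
      have -> : (if Rle_dec (level a) tau then if Rlt_dec 0 (Re a) then lnp r a else 0 else 0) =
        (if Pdec (0 < Re a /\ - tau * ln (1 + Cmod a) <= Im a <= 0) then lnp r a else 0).
      { have l := la a ha. have i := hm a ha.
        have eq : level a <= tau <-> - tau * ln (1 + Cmod a) <= Im a.
        { rewrite /level. split => h.
          - have := Rmult_le_compat_r _ _ _ (Rlt_le _ _ l) h. rewrite /Rdiv Rmult_assoc Rinv_l; lra.
          - apply: (Rmult_le_reg_r (ln (1 + Cmod a))) => //. rewrite /Rdiv Rmult_assoc Rinv_l; lra. }
        case: (Rle_dec (level a) tau) => h1; case: (Rlt_dec 0 (Re a)) => h2; case: Pdec => h3; try reflexivity; exfalso; try tauto.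
        apply: h3. split => //. split; [exact/eq | lra]. }
      apply: step_RInt_nu => //. exact: ca. }
  apply: is_RInt_unique. apply: (is_RInt_ext (fun tau => Rsum (fun a => if Rle_dec (level a) tau then (if Rlt_dec 0 (Re a) then lnp r a else 0) else 0) m)).
  - move=> tau. rewrite Rmin_left // Rmax_right // => ht. by rewrite inner.
  - apply: is_RInt_Rsum => a ha. apply: step_RInt_tau => //.
    rewrite /level. apply: Rmult_le_pos; first by have := hm a ha; lra. left. apply: Rinv_0_lt_compat. exact: la.
Qed.

Lemma Rsum_plus F G m : Rsum (fun a => F a + G a) m = Rsum F m + Rsum G m.
Proof. elim: m => [|a m IH] /=; [ring | rewrite IH; ring]. Qed.

Lemma Rsum_scal c F m : Rsum (fun a => c * F a) m = c * Rsum F m.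
Proof. elim: m => [|a m IH] /=; [ring | rewrite IH; ring]. Qed.

Lemma depth_ge0 t R1 a : 0 <= depth t R1 a.
Proof. rewrite /depth. case: Pdec => h; lra. Qed.

Lemma depth_mono t R1 R2 a : R1 <= R2 -> depth t R2 a <= depth t R1 a.
Proof. move=> h. rewrite /depth. case: Pdec => h1; case: Pdec => h2; lra. Qed.

Lemma depth_support t R1 a : depth t R1 a = 0 \/ R1 <= Cmod a.
Proof. rewrite /depth. case: Pdec => h; [right; tauto | by left]. Qed.

(** Zeros with |a| < R1 are finitely many and are paid for by the last term. For the others (t -
    level a) ln |a| <= Im a + t ln (1 + |a|) <= depth + t / |a|, even if a lies between the curves
    defined with ln |z| and ln (1 + |z|). To sum the excess t / |a|, it is multiplied by the depth
    for t + 1, which is at least ln |a| - t / |a| >= 2 - 1, by ln 16 >= 2 and t <= R1. *)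
Lemma zero_term_bound t R1 r d a : 0 < t -> 16 <= R1 -> t <= R1 -> 0 < d -> R1 <= r -> Im a < 0 -> d <= Cmod a ->
  Rmax 0 (t - level a) * (if Rlt_dec 0 (Re a) then lnp r a else 0) <=
  depth t R1 a * (if Rle_dec (Cmod a) r then ln r / ln (Cmod a) - 1 else 0) +
  t * (depth (t + 1) R1 a * (if Rle_dec (Cmod a) r then (ln r / ln (Cmod a) - 1) / Cmod a else 0)) +
  t * (ln r + Rabs (ln d)) * (if Pdec (zone t R1 a) then 1 else 0).
Proof.
  move=> t0 R8 tR d0 Rr ia da.
  have lr := ln_ge1 r ltac:(lra). have ad := Rabs_pos (ln d).
  have m0 : 0 < Cmod a by lra.
  have D1 := depth_ge0 t R1 a. have D2 := depth_ge0 (t + 1) R1 a.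
  have p0 : R1 <= Cmod a -> Cmod a <= r -> 1 <= ln (Cmod a) /\ 0 <= ln r / ln (Cmod a) - 1.
  { move=> h1 h2. have l1 := ln_ge1 (Cmod a) ltac:(lra). have l2 := ln_le_mono (Cmod a) r m0 h2. split => //.
    have : 1 <= ln r / ln (Cmod a); last lra. apply: (Rmult_le_reg_r (ln (Cmod a))); first lra. rewrite /Rdiv Rmult_assoc Rinv_l; lra. }
  have T3 : 0 <= t * (ln r + Rabs (ln d)) * (if Pdec (zone t R1 a) then 1 else 0).
  { apply: Rmult_le_pos; first by apply: Rmult_le_pos; lra. case: Pdec => _; lra. }
  have T1 : 0 <= depth t R1 a * (if Rle_dec (Cmod a) r then ln r / ln (Cmod a) - 1 else 0).
  { case: (depth_support t R1 a) => [->|h]; first by rewrite Rmult_0_l; lra. apply: Rmult_le_pos => //. case: Rle_dec => h'; [exact: (proj2 (p0 h h')) | lra]. }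
  have T2 : 0 <= t * (depth (t + 1) R1 a * (if Rle_dec (Cmod a) r then (ln r / ln (Cmod a) - 1) / Cmod a else 0)).
  { apply: Rmult_le_pos; first lra. case: (depth_support (t + 1) R1 a) => [->|h]; first by rewrite Rmult_0_l; lra.
    apply: Rmult_le_pos => //. case: Rle_dec => h'; last lra. apply: Rmult_le_pos; first exact: (proj2 (p0 h h')). left. exact: Rinv_0_lt_compat. }
  have LHS0 : Rmax 0 (t - level a) * (if Rlt_dec 0 (Re a) then lnp r a else 0) = 0 \/ (0 < Re a /\ level a < t /\ Cmod a < r).
  { rewrite /lnp. case: Rlt_dec => h1; last by left; ring. case: Rlt_dec => h2; last by left; ring.
    case: (Rlt_dec (level a) t) => h3; first by right. left. rewrite Rmax_left; [ring | lra]. }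
  case: LHS0 => [->|[h1 [h2 h3]]]; first lra.
  have l0 : 0 < ln (1 + Cmod a) by rewrite -ln_1; apply: ln_increasing; lra.
  have lev0 : 0 <= level a by apply: Rmult_le_pos; [lra | left; exact: Rinv_0_lt_compat].
  have lev : level a * ln (1 + Cmod a) = - Im a by rewrite /level; field; lra.
  rewrite Rmax_right; last lra. rewrite /lnp. case: Rlt_dec => // _. case: Rlt_dec => // _.
  have ima : - t * ln (1 + Cmod a) <= Im a by nra.
  case: (Rlt_dec (Cmod a) R1) => hR.
  - case: Pdec => hz; last by case: hz; split => //; split => //; lra.
    have la : ln d <= ln (Cmod a) by apply: ln_le_mono.
    have := Rle_abs (- ln d). rewrite Rabs_Ropp => k1.
    have k2 := ln_le_mono (Cmod a) r m0 ltac:(lra).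
    have : (t - level a) * (ln r - ln (Cmod a)) <= t * (ln r + Rabs (ln d)) by apply: Rmult_le_compat; lra. lra.
  - have hR' : R1 <= Cmod a by lra. have [l1 lp] := p0 hR' ltac:(lra).
    case: Rle_dec => hle; last lra.
    have ll : ln (Cmod a) <= ln (1 + Cmod a) by apply: ln_le_mono; lra.
    have lq : ln (1 + Cmod a) <= ln (Cmod a) + / Cmod a.
    { have := ln_le_sub1 ((1 + Cmod a) / Cmod a) ltac:(apply: Rdiv_lt_0_compat; lra).
      rewrite ln_div; try lra. rewrite (_ : (1 + Cmod a) / Cmod a - 1 = / Cmod a); last by field; lra. lra. }
    have im0 : 0 < / Cmod a by exact: Rinv_0_lt_compat.
    have tm : t * / Cmod a <= 1 by apply: (Rmult_le_reg_r (Cmod a)) => //; rewrite Rmult_assoc Rinv_l; lra.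
    set q := ln (Cmod a) in l1 lp ll lq *. set m := Cmod a in m0 hR' ll lq im0 tm l0 lev ima hle *.
    have q2 : 2 <= q.
    { rewrite /q -/m. apply: Rle_trans (ln_le_mono 16 m ltac:(lra) ltac:(lra)).
      rewrite (_ : 16 = (2 * 2) * (2 * 2)); last by ring. rewrite (ln_mult (2 * 2) (2 * 2)); try lra. rewrite (ln_mult 2 2); try lra. have := ln_lt_2. lra. }
    have d2 : 1 <= depth (t + 1) R1 a.
    { rewrite /depth -/m -/q. have e1 := Rmult_le_compat_l t _ _ (Rlt_le _ _ t0) lq. have e : - (t + 1) * q + 1 <= Im a by lra.
      case: Pdec => h; first lra. exfalso. apply: h. split; [lra | split; lra]. }
    have d1 : Im a + t * ln (1 + m) <= depth t R1 a + t * / m.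
    { rewrite /depth -/m -/q. have : t * ln (1 + m) <= t * (q + / m) by apply: Rmult_le_compat_l; lra.
      case: Pdec => h hh; first lra. have : Im a < - t * q; last lra. apply: Rnot_le_lt => hc. apply: h. split => //. }
    have s1 : (t - level a) * (ln r - q) <= (Im a + t * ln (1 + m)) * (ln r / q - 1).
    { have e : (t - level a) * (ln r - q) = ((t - level a) * q) * (ln r / q - 1) by field; lra.
      rewrite e. apply: Rmult_le_compat_r => //. have := Rmult_le_compat_l (t - level a) _ _ ltac:(lra) ll. lra. }
    have s2 := Rmult_le_compat_r _ _ _ lp d1.
    have s3 : t * / m * (ln r / q - 1) <= t * (depth (t + 1) R1 a * ((ln r / q - 1) / m)).
    { have z : 0 <= t * ((ln r / q - 1) * / m) by apply: Rmult_le_pos; [lra | apply: Rmult_le_pos; lra].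
      have := Rmult_le_compat_r _ _ _ z d2. rewrite /Rdiv. lra. }
    lra.
Qed.

Lemma zero_free_disk rho f : class_F rho f -> exists d, 0 < d /\ forall z, f z = 0%C -> d <= Cmod z.
Proof.
  move=> hF. have f0 := F_nonzero _ _ hF 0.
  have c0 := cdiff_cont _ _ (F_cdiff rho f hF (RtoC 0) ltac:(rewrite /=; lra)).
  have nb : locally (T := C_UniformSpace) (f 0) (fun w => w <> RtoC 0).
  { apply/locally_Cmod. exists (Cmod (f 0)). split; first exact: (proj1 (Cmod_gt_0 _) f0).
    move=> w hw e. move: hw. rewrite e (_ : (0 - f 0)%C = (- f 0)%C); last by ring. rewrite Cmod_opp. lra. }
  have /locally_Cmod [d [d0 hd]] := c0 _ nb. exists d. split => // z fz.
  apply: Rnot_lt_le => hz. apply: (hd z) => //. by rewrite (_ : (z - 0)%C = z); last ring.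
Qed.

Lemma depth_bound_mono t R1 R2 B m : R1 <= R2 ->
  Rsum (fun a => depth t R2 a * Rmax 0 (B - Cmod a)) m <= Rsum (fun a => depth t R1 a * Rmax 0 (B - Cmod a)) m.
Proof. move=> h. apply: Rsum_le => a _. apply: Rmult_le_compat_r; [exact: Rmax_l | exact: depth_mono]. Qed.

Lemma suitable_mono f B r m : B <= r -> suitable f r m -> suitable f B m.
Proof. move=> h [x1 [x2 [H [k1 [k2 [k3 k4]]]]]]. exists x1, x2, H. split => //. split; [lra | split => //; lra]. Qed.

Lemma counting_upper rho f t M0 R1 eps : class_F rho f -> 0 < t ->
  (forall z, log_curve t z -> R1 <= Cmod z -> Cmod (f z) <= exp (M0 * (Cmod z ^ (rho - 1) * ln (Cmod z)))) -> 0 < eps ->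
  exists r0, forall r, r0 <= r ->
  1 / r ^ rho * RInt (fun tau => RInt (fun nu => INR (n_zeros f tau nu) / nu) 0 r) 0 t <= M0 / (2 * PI * INR rho ^ 2) + eps.
Proof.
  move=> hF t0 hc e0.
  have [A1 [K [A13 [K0 hs]]]] := depth_sum_sharp rho f t M0 R1 hF t0 hc.
  have [A2 [K' [A23 [K0' hs']]]] := depth_sum_crude rho f (t + 1) hF ltac:(lra).
  have [d [d0 hd]] := zero_free_disk rho f hF.
  have rho1 := F_rho _ _ hF.
  case: rho hF hc rho1 hs hs' => [|k] hF hc rho1 hs hs'; first lia.
  set a0 := Rmax (Rmax A1 A2) (Rmax 16 t).
  have a1 : A1 <= a0 by apply: Rle_trans (Rmax_l _ _); exact: Rmax_l.
  have a2 : A2 <= a0 by apply: Rle_trans (Rmax_l _ _); exact: Rmax_r.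
  have a3 : 16 <= a0 by apply: Rle_trans (Rmax_r _ _); exact: Rmax_l.
  have a4 : t <= a0 by apply: Rle_trans (Rmax_r _ _); exact: Rmax_r.
  have rS : 0 < INR (S k) by apply: lt_0_INR; lia.
  have Pi0 := PI_RGT_0.
  set alpha := M0 / (2 * PI * (INR (S k) * INR (S k + 1))).
  (* eps is spent as eps/4 on the sharp sum, t times eps/(4t) on the crude one, and eps/2 on the
     powers of ln r. *)
  have et : 0 < eps / (4 * t) by apply: Rdiv_lt_0_compat; lra.
  have [K1 [K10 h1]] := kernel_sum_sharp k alpha K a0 (eps / 4) ltac:(lra) ltac:(lra).
  have [K2 [K20 h2]] := kernel_sum_crude k K' a0 (eps / (4 * t)) ltac:(lra) et.
  set N := INR (n_zeros f t a0). have N0 : 0 <= N by exact: pos_INR.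
  have D0 := Rabs_pos (ln d). set D := Rabs (ln d) in D0 *.
  set C0 := K1 + t * K2 + t * (1 + D) * N.
  have C00 : 0 <= C0 by rewrite /C0; have := Rmult_le_pos t K2; have := Rmult_le_pos t (1 + D); have := Rmult_le_pos (t * (1 + D)) N; lra.
  (* Since (1 + ln r)^2 <= 4 (ln r)^2, this constant in [ln_sq_small] bounds C0 (1 + ln r)^2 by eps
     r / 2. *)
  have cc : 0 < 8 * (C0 + 1) / eps by apply: Rdiv_lt_0_compat; lra.
  have [R0 [R03 hR0]] := ln_sq_small _ cc.
  exists (Rmax a0 R0) => r hr.
  have ra : a0 <= r by apply: Rle_trans hr; exact: Rmax_l.
  have rR : R0 <= r by apply: Rle_trans hr; exact: Rmax_r.
  have [l2 [_ l1]] := hR0 r rR.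
  have [e [m [h hfac]]] := box_factor (S k) f (- 1) (r + 6) (r + 6) hF ltac:(lra) ltac:(lra).
  have fac : factored f (- 1) (r + 6) (r + 6) m by exists e, h.
  have sui : suitable f r m by exists (- 1), (r + 6), (r + 6); split; [lra | split; [lra | split; [lra | exact: fac]]].
  rewrite (counting_integral f (- 1) (r + 6) (r + 6) m t r fac); try lra.
  have hm : forall a, In a m -> Im a < 0 /\ f a = 0%C by case: hfac => _ [_ [_ hh]] a ha; exact: (proj2 (hh a ha)).
  have tot : Rsum (fun a => Rmax 0 (t - level a) * (if Rlt_dec 0 (Re a) then lnp r a else 0)) m <=
    (alpha * (INR (S (S k)) / INR (S k)) + eps / 4) * r ^ S k + K1 * (1 + ln r) ^ 2 +
    t * (eps / (4 * t) * r ^ S k + K2 * (1 + ln r) ^ 2) + t * (ln r + D) * N.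
  { apply: Rle_trans.
    - apply: (Rsum_le _ (fun a => _ + t * _ + t * (ln r + D) * _)) => a ha. have [i z] := hm a ha.
      apply: (zero_term_bound t a0 r d a) => //. exact: hd.
    - rewrite !Rsum_plus !Rsum_scal. apply: Rplus_le_compat; first apply: Rplus_le_compat.
      + apply: h1 => //; first by move=> b _; exact: depth_support.
        move=> B hB. have := hs B m ltac:(lra) (suitable_mono _ _ _ _ (proj2 hB) sui).
        have := depth_bound_mono t A1 a0 B m a1. rewrite -/alpha (_ : (S k + 1)%nat = S (S k)); [lra | lia].
      + apply: Rmult_le_compat_l; first lra. apply: h2 => //; first by move=> b _; exact: depth_support.
        move=> B hB. have := hs' B m ltac:(lra) (suitable_mono _ _ _ _ (proj2 hB) sui).
        have := depth_bound_mono (t + 1) A2 a0 B m a2. rewrite (_ : (S k + 2)%nat = S (S (S k))); [lra | lia].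
      + right. congr (_ * _). symmetry. apply: (n_zeros_sum f (- 1) (r + 6) (r + 6) m t a0 fac); lra. }
  have rk : r <= r ^ S k by rewrite -{1}(pow_1 r); apply: Rle_pow; [lra | lia].
  have rp : 0 < r ^ S k by lra.
  have al : alpha * (INR (S (S k)) / INR (S k)) = M0 / (2 * PI * INR (S k) ^ 2).
  { rewrite /alpha (_ : (S k + 1)%nat = S (S k)); last lia. have v0 : 0 < INR (S (S k)) by apply: lt_0_INR; lia.
    set v := INR (S (S k)) in v0 *. set u := INR (S k) in rS *. field. repeat split; lra. }
  have small : t * K2 * (1 + ln r) ^ 2 + K1 * (1 + ln r) ^ 2 + t * (ln r + D) * N <= eps / 2 * r ^ S k.
  { have s1 : t * (ln r + D) * N <= t * (1 + D) * N * (1 + ln r) ^ 2.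
    { rewrite (_ : t * (1 + D) * N * (1 + ln r) ^ 2 = t * ((1 + D) * (1 + ln r) ^ 2) * N); last by ring.
      apply: Rmult_le_compat_r => //. apply: Rmult_le_compat_l; first lra. nra. }
    have s2 : C0 * (1 + ln r) ^ 2 <= eps / 2 * r.
    { apply: Rle_trans (_ : eps / 2 * (8 * (C0 + 1) / eps * ln r ^ 2) <= _); last by apply: Rmult_le_compat_l; lra.
      rewrite (_ : eps / 2 * (8 * (C0 + 1) / eps * ln r ^ 2) = (C0 + 1) * (4 * ln r ^ 2)); last by field; lra.
      apply: Rmult_le_compat; [lra | apply: pow2_ge_0 | lra | nra]. }
    have s3 : eps / 2 * r <= eps / 2 * r ^ S k by apply: Rmult_le_compat_l; lra.
    rewrite /C0 in s2. lra. }
  apply: (Rmult_le_reg_r (r ^ S k)) => //.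
  rewrite (_ : forall x, 1 / r ^ S k * x * r ^ S k = x); last by move=> x; field; lra.
  apply: Rle_trans tot _. rewrite al.
  rewrite (_ : t * (eps / (4 * t) * r ^ S k + K2 * (1 + ln r) ^ 2) = eps / 4 * r ^ S k + t * K2 * (1 + ln r) ^ 2); last by field; lra.
  lra.
Qed.

(** * The upper limits *)

(** The exponential form of the bound also covers the zeros of f on the curve, where [Rbar_ln] is
    minus infinity. R + 1 provides the strict inequality in [C_infinity]. *)
Lemma curve_bound rho f t M0 :
  within (log_curve t) C_infinity (fun z => Rbar_le (Rbar_div (Rbar_ln (Cmod (f z))) (Finite (Cmod z ^ (rho - 1) * ln (Cmod z)))) (Finite M0)) ->
  exists R1, forall z, log_curve t z -> R1 <= Cmod z -> Cmod (f z) <= exp (M0 * (Cmod z ^ (rho - 1) * ln (Cmod z))).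
Proof.
  move=> [R h]. exists (Rmax 3 (R + 1)) => z hz hR.
  have z3 : 3 <= Cmod z by apply: Rle_trans hR; exact: Rmax_l.
  have zR : R < Cmod z by have := Rmax_r 3 (R + 1); lra.
  have := h z zR hz. have l := ln_ge1 _ z3.
  have p : 0 < Cmod z ^ (rho - 1) * ln (Cmod z) by apply: Rmult_lt_0_compat; [apply: pow_lt; lra | lra].
  set w := (Cmod z ^ (rho - 1) * ln (Cmod z)) in p *. rewrite /Rbar_ln.
  case: Rlt_dec => fz.
  - rewrite /= => k. rewrite -{1}(exp_ln _ fz). have k2 : ln (Cmod (f z)) <= M0 * w; last exact: exp_le_mono.
    have := Rmult_le_compat_r _ _ _ (Rlt_le _ _ p) k. rewrite Rmult_assoc Rinv_l; lra.
  - move=> _. have := exp_pos (M0 * w). lra.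
Qed.

(** For t = 0 the curve is the positive real axis, where ln |f| is bounded below by a multiple of -
    x^(rho-1), by [ln_f_real]; an upper bound M0 x^(rho-1) ln x with M0 < 0 would contradict this
    for large x. *)
Lemma curve_bound_zero rho f M0 R1 : class_F rho f ->
  (forall z, log_curve 0 z -> R1 <= Cmod z -> Cmod (f z) <= exp (M0 * (Cmod z ^ (rho - 1) * ln (Cmod z)))) -> 0 <= M0.
Proof.
  move=> hF h. apply: Rnot_lt_le => m0. have [K [R0 hK]] := F_logder _ _ hF.
  have rho1 := F_rho _ _ hF.
  set b := ln (Cmod (f 0)). set T := (Rabs b + Rabs K + 1) / (- M0).
  have b0 := Rabs_pos b. have k0 := Rabs_pos K.
  have T0 : 0 < T by apply: Rdiv_lt_0_compat; lra.
  set x := Rmax (Rmax R1 R0) (Rmax 3 (exp (T + 1))).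
  have x1 : R1 <= x by apply: Rle_trans (Rmax_l _ _); exact: Rmax_l.
  have x2 : R0 <= x by apply: Rle_trans (Rmax_l _ _); exact: Rmax_r.
  have x3 : 3 <= x by apply: Rle_trans (Rmax_r _ _); exact: Rmax_l.
  have x4 : exp (T + 1) <= x by apply: Rle_trans (Rmax_r _ _); exact: Rmax_r.
  have lx : T + 1 <= ln x by rewrite -(ln_exp (T + 1)); apply: ln_le_mono => //; exact: exp_pos.
  have cx : Cmod (RtoC x) = x by rewrite Cmod_R Rabs_pos_eq; lra.
  have := h (RtoC x) ltac:(split; [rewrite /=; ring | rewrite /=; lra]) ltac:(lra). rewrite cx => hx.
  have := hK x ltac:(rewrite Rabs_pos_eq; lra). rewrite (Lg_RInt rho f hF) (Rabs_pos_eq x); last lra. move=> hL.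
  have := ln_f_real rho f hF x ltac:(lra). rewrite -/b => e.
  have fx : 0 < Cmod (f x) by exact: (proj1 (Cmod_gt_0 _) (F_nonzero _ _ hF x)).
  have := ln_le_mono _ _ fx hx. rewrite ln_exp e => hh.
  have rl := re_le_Cmod (Lg f x). have p1 : 1 <= x ^ (rho - 1) by apply: pow_R1_Rle; lra.
  set p := x ^ (rho - 1) in p1 hL hh.
  have q1 := Rle_abs (- b). rewrite Rabs_Ropp in q1. have q2 := Rle_abs (- Re (Lg f x)). rewrite Rabs_Ropp in q2.
  have q3 : K * p <= Rabs K * p by apply: Rmult_le_compat_r; [lra | exact: Rle_abs].
  have q4 : Rabs b <= Rabs b * p by nra.
  have q5 : - M0 * (p * (T + 1)) <= - M0 * (p * ln x) by apply: Rmult_le_compat_l; [lra | apply: Rmult_le_compat_l; lra].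
  have q6 : - M0 * (p * T) = p * (Rabs b + Rabs K + 1) by rewrite /T; field; lra.
  have q7 : 0 < - M0 * p by apply: Rmult_lt_0_compat; lra.
  lra.
Qed.

Lemma counting_limsup_bound rho f t M0 eps : class_F rho f -> 0 <= t -> 0 < eps ->
  within (log_curve t) C_infinity (fun z => Rbar_le (Rbar_div (Rbar_ln (Cmod (f z))) (Finite (Cmod z ^ (rho - 1) * ln (Cmod z)))) (Finite M0)) ->
  Rbar_locally p_infty (fun r => Rbar_le (Finite (1 / r ^ rho * RInt (fun tau => RInt (fun nu => INR (n_zeros f tau nu) / nu) 0 r) 0 t))
    (Finite (M0 / (2 * PI * INR rho ^ 2) + eps))).
Proof.
  move=> hF t0 e0 hw. have [R1 hc] := curve_bound rho f t M0 hw. case: (Rle_lt_or_eq_dec 0 t t0) => ht.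
  - have [r0 h] := counting_upper rho f t M0 R1 eps hF ht hc e0. exists r0 => r hr. apply: h. lra.
  - exists 0 => r hr. rewrite -ht in hc *. rewrite RInt_point /zero /= Rmult_0_r.
    have m0 := curve_bound_zero rho f M0 R1 hF hc. have rho1 := F_rho _ _ hF.
    have i0 : 0 < INR rho by apply: lt_0_INR; lia. have := PI_RGT_0 => Pi0.
    have : 0 <= M0 / (2 * PI * (INR rho * (INR rho * 1))); last lra.
    apply: Rmult_le_pos => //. left. apply: Rinv_0_lt_compat. apply: Rmult_lt_0_compat; first lra. nra.
Qed.

(** [key] says that c times a finite lower bound of S1 is a lower bound of S2; the cases deal with
    infima that may be infinite. *)
Lemma Glb_Rbar_div (S1 S2 : R -> Prop) c : 0 < c ->
  (forall M eps, S2 M -> 0 < eps -> S1 (M / c + eps)) -> Rbar_le (Glb_Rbar S1) (Rbar_div (Glb_Rbar S2) (Finite c)).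
Proof.
  move=> c0 h. have [l1 g1] := Glb_Rbar_correct S1. have [l2 g2] := Glb_Rbar_correct S2.
  have key : forall x, Rbar_le (Finite x) (Glb_Rbar S1) -> Rbar_le (Finite (x * c)) (Glb_Rbar S2).
  { move=> x hx. apply: g2 => M hM. rewrite /=. apply: le_epsilon => eps e0.
    have hle := Rbar_le_trans _ _ _ hx (l1 _ (h M (eps / c) hM ltac:(exact: Rdiv_lt_0_compat))). rewrite /= in hle.
    have := Rmult_le_compat_r _ _ _ (Rlt_le _ _ c0) hle. rewrite (_ : (M / c + eps / c) * c = M + eps); [lra | field; lra]. }
  have ci : 0 < / c by exact: Rinv_0_lt_compat.
  case E1: (Glb_Rbar S1) key => [x| |] key //.
  - have := key x (Rle_refl x). case: (Glb_Rbar S2) => [y| |] //=.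
    + move=> hy. apply: (Rmult_le_reg_r c) => //. rewrite Rmult_assoc Rinv_l; lra.
    + move=> _. case: Rle_dec => [p|]; last lra. case: Rle_lt_or_eq_dec => // q. lra.
  - have : Glb_Rbar S2 = p_infty; last first.
    { move=> -> /=. case: Rle_dec => [p|]; last lra. case: Rle_lt_or_eq_dec => // q. lra. }
    case E2: (Glb_Rbar S2) => [y| |] //; exfalso.
    + have := key ((y + 1) / c) I. rewrite E2 /=. rewrite /Rdiv Rmult_assoc Rinv_l; lra.
    + have := key 0 I. by rewrite E2.
Qed.

Theorem theorem1p2 :
  forall (rho : nat) (f : C -> C), class_F rho f ->
  forall t : R, 0 <= t ->
  Rbar_le
    (LimSup_filter (Rbar_locally p_infty)
       (fun r : R => Finite
          (1 / r ^ rho *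
           RInt (fun tau : R =>
             RInt (fun nu : R => INR (n_zeros f tau nu) / nu) 0 r) 0 t)))
    (Rbar_div (ell rho f t) (Finite (2 * PI * INR rho ^ 2))).
Proof.
  move=> rho f hF t t0. apply: Glb_Rbar_div.
  - have i0 : 0 < INR rho by apply: lt_0_INR; have := F_rho _ _ hF; lia. have := PI_RGT_0.
    move=> Pi0. apply: Rmult_lt_0_compat; [lra | exact: pow_lt].
  - move=> M eps hM e0. exact: counting_limsup_bound.
Qed.
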